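(* Let $n\ge1$, $Q=2n+2$, $1<p,q<\infty$, $0<r<\infty$ with $\frac1r\le\frac1p+\frac1q$, and $0<\lambda<Q$. Let $\alpha,\beta,\gamma\in\mathbb{R}$ satisfy $$\alpha<\frac{Q}{p'},\qquad \beta<\frac{Q}{q'},\qquad \gamma<\frac{Q}{r},$$ where $p'=p/(p-1)$, $q'=q/(q-1)$, and assume $\frac1r=\frac1p+\frac1q-\frac{\lambda-\alpha-\beta-\gamma}{Q}>0$. Let $$B_\lambda(f,g)(x)=\int_{\mathbb{H}^n} f(xy^{-1})\,g(xy)\,\frac{dy}{|y|^{Q-\lambda}} .$$ Then the following are equivalent: (a) There exists a constant $K>0$ such that $$\big\|\,|x|^{-\gamma}B_\lambda(f,g)\big\|_{L^r(\mathbb{H}^n)}\le K\,\big\||x|^{\alpha}f\big\|_{L^p(\mathbb{H}^n)}\big\||x|^{\beta}g\big\|_{L^q(\mathbb{H}^n)}$$ for all $f\in L^p(\mathbb{H}^n)$ and $g\in L^q(\mathbb{H}^n)$. (b) The exponents satisfy $$-Q+\lambda\le\beta+\gamma,\qquad -Q+\lambda\le\gamma+\alpha,\qquad -Q+\lambda\le\alpha+\beta,\qquad \alpha+\beta+\gamma\ge0.$$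
   Context: $\mathbb{H}^n=\mathbb{C}^n\times\mathbb{R}$ is the Heisenberg group with group law $(z,t)\cdot(w,s)=(z+w,\,t+s+\tfrac12\operatorname{Im}(z\cdot\bar w))$, inverse $(z,t)^{-1}=(-z,-t)$, Haar measure $dz\,dt$, and homogeneous dimension $Q=2n+2$. For $x=(z,t)$, $|x|=(|z|^4+t^2)^{1/4}$ denotes the Koranyi norm. *)

(* Defs.v *)
From HB Require Import structures.
From mathcomp Require Import all_boot all_order all_algebra.
From mathcomp Require Import all_classical all_reals all_analysis.
Set Implicit Arguments. Unset Strict Implicit. Unset Printing Implicit Defensive.
Import Order.TTheory GRing.Theory Num.Theory.
Local Open Scope classical_set_scope.
Local Open Scope ring_scope.

(* Product of two sigma-finite measures, packaged as a sigma-finite measure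
   (the library instance is not found by inference, so we redeclare it). *)
Section pmeas.
Local Open Scope ereal_scope.
Context (R : realType) d1 d2 (T1 : measurableType d1) (T2 : measurableType d2).
Variable m1 : {sigma_finite_measure set T1 -> \bar R}.
Variable m2 : {sigma_finite_measure set T2 -> \bar R}.
Definition pmeas := m1 \x m2.
HB.instance Definition _ := Measure.on pmeas.
Lemma pmeas_sigma_finite : sigma_finite setT pmeas.
Proof.
have /sigma_finiteP[F [TF ndF Foo]] := sigma_finiteT m1.
have /sigma_finiteP[G [TG ndG Goo]] := sigma_finiteT m2.
exists (fun n => F n `*` G n).
 rewrite -setXTT TF TG predeqE => -[x y]; split.
    move=> [/= [n _ Fnx] [k _ Gky]]; exists (maxn n k) => //; split.
    - by move: x Fnx; exact/subsetPset/ndF/leq_maxl.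
    - by move: y Gky; exact/subsetPset/ndG/leq_maxr.
  by move=> [n _ []/= ? ?]; split; exists n.
move=> k; have [? ?] := Foo k; have [? ?] := Goo k.
split; first exact: measurableX.
by rewrite /pmeas product_measure1E// lte_mul_pinfty// ge0_fin_numE.
Qed.
HB.instance Definition _ := Measure_isSigmaFinite.Build _ _ _ pmeas pmeas_sigma_finite.
End pmeas.

Section Rspace.
Variable R : realType.

(* Rsp k = R^(k+1) as a nested product R * (R * ( ... * R)), with the
   product (= Borel) sigma-algebra. *)
Fixpoint Rsp (k : nat) : {d : measure_display & measurableType d} :=
  match k with
  | 0 => existT measurableType _ (measurableTypeR R)
  | k'.+1 => existT measurableType _ ((measurableTypeR R * projT2 (Rsp k'))%type : measurableType _)
  end.

Definition Rn (k : nat) : measurableType (projT1 (Rsp k)) := projT2 (Rsp k).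

Definition lebR : {sigma_finite_measure set (measurableTypeR R) -> \bar R} :=
  @lebesgue_measure R.

Definition lebprod d (T : measurableType d) (m : {sigma_finite_measure set T -> \bar R}) :
  {sigma_finite_measure set (measurableTypeR R * T)%type -> \bar R} :=
  pmeas lebR m.

Fixpoint leb (k : nat) : {sigma_finite_measure set (Rn k) -> \bar R} :=
  match k return {sigma_finite_measure set (Rn k) -> \bar R} with
  | 0 => lebR
  | k'.+1 => lebprod (leb k')
  end.

Fixpoint crd (k : nat) : Rn k -> nat -> R :=
  match k return Rn k -> nat -> R with
  | 0 => fun x _ => x
  | k'.+1 => fun x i => if i is i'.+1 then crd x.2 i' else x.1
  end.

Fixpoint mkpt (k : nat) : (nat -> R) -> Rn k :=
  match k return (nat -> R) -> Rn k with
  | 0 => fun f => f 0%N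
  | k'.+1 => fun f => (f 0%N, mkpt k' (fun i => f i.+1))
  end.

End Rspace.

Section Heisenberg.
Variables (R : realType) (n : nat).

(* H^n = C^n x R, identified with R^(2n+1): a point x has
   z_j = crd x j + i crd x (n+j)  (j < n)  and  t = crd x (2n). *)
Definition Hn := Rn R (2 * n).
Definition Hmeas : {sigma_finite_measure set Hn -> \bar R} := leb R (2 * n).

Definition Hre (x : Hn) (j : nat) : R := crd x j.
Definition Him (x : Hn) (j : nat) : R := crd x (n + j).
Definition Ht (x : Hn) : R := crd x (2 * n).

(* Im (z . conj w) = sum_j Im (z_j * conj w_j) *)
Definition Imzw (x y : Hn) : R :=
  \sum_(j < n) (Him x j * Hre y j - Hre x j * Him y j).

Definition Hmul (x y : Hn) : Hn :=
  mkpt (2 * n) (fun i => if (i < 2 * n)%N then crd x i + crd y i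
                         else Ht x + Ht y + 2^-1 * Imzw x y).

Definition Hinv (x : Hn) : Hn := mkpt (2 * n) (fun i => - crd x i).

Definition Hz2 (x : Hn) : R := \sum_(j < n) (Hre x j ^+ 2 + Him x j ^+ 2).

Definition koranyi (x : Hn) : R := powR (Hz2 x ^+ 2 + Ht x ^+ 2) (4^-1).

Definition Qdim : R := (2 * n + 2)%:R.

Definition Blam (lam : R) (f g : Hn -> R) (x : Hn) : \bar R :=
  (\int[Hmeas]_y ((f (Hmul x (Hinv y)) * g (Hmul x y)
                   * powR (koranyi y) (lam - Qdim))%:E))%E.

End Heisenberg.

Definition hconj (R : realType) (p : R) : R := p / (p - 1).

(* Main.v *)
(* Sufficiency.  Replace |x| by the volume gauge M x = |x|^Q.  Among x, y, u = x y^-1 and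
   v = x y any two control the other two, so wherever one of the four gauges is smallest the
   other three are comparable; the four conditions in (b) say exactly that all of the
   (possibly negative) weights can then be traded for nonnegative weights satisfying strict
   integrability caps.  For such weights the square root of the operator is tested by duality
   against h in the dual of L^(2r), where 2r > 1.  The three functions, weights included, are
   cut at the heights of their decreasing rearrangements into multiples of indicators of
   nested sets of measure at most e^k.  For indicators of sets of measures e^i, e^l, e^m,
   Cauchy-Schwarz, also after averaging over translated balls, gives several competing
   bounds, and interpolating between them gains a factor e^(-eps (|i - l| + |i - m|)).  The
   resulting trilinear sum converges because 1/r <= 1/p + 1/q.

   Necessity.  Test (a) on indicators of unit boxes centred at heights c1, c2 on the vertical
   axis: B(f, g) is bounded below near the height (c1 + c2) / 2 by points y near the height
   (c2 - c1) / 2, and letting suitable ones of c1, c2, c1 + c2, c1 - c2 tend to infinity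
   yields the four inequalities. *)
Require Import Defs.
From HB Require Import structures.
From mathcomp Require Import all_boot all_order all_algebra.
From mathcomp Require Import all_classical all_reals all_analysis.
From mathcomp Require Import measurable_realfun ring lra.
Import Order.TTheory GRing.Theory Num.Theory.
Import numFieldNormedType.Exports.
Set Implicit Arguments. Unset Strict Implicit. Unset Printing Implicit Defensive.
Local Open Scope classical_set_scope.
Local Open Scope ring_scope.

(** * Order statistics *)

(** The exponent r may be below 1, where L^r has no useful dual; as 1/r <= 1/p + 1/q < 2, the square
    root of the operator can be placed in L^(2r), which has one, and it is still subadditive, so
    decompositions of f, g and the kernel pass through it. Testing it against an indicator makes the
    third measure e^m count twice: with a ball of volume e^s as kernel, the available bounds are, up
    to constants, exp of half of each sum of three entries of the list i, l, m, m, s, hence exp of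
    half the sum of the three smallest entries. Homogeneity says that the target exponents e1, e2, 2
    e3, tau of i, l, m, s add up to 3, and the integrability caps keep e1, e2, e3, tau strictly
    below 1. A weighted sum of this kind exceeds the sum of the three smallest entries by a multiple
    of their spread: this is the off-diagonal gain. The one bound that is not elementary is s + i +
    l. It controls the integral of the square root over the whole space, where Cauchy-Schwarz alone
    has no finite measure to work with; averaging over translated balls supplies one. *)

Section three_smallest.
Variable R : realFieldType.

(** Relational form of p = (t - x)^+. The two cases overlap at x = t, so ties need no care, and once
    a case is chosen only linear facts remain for [lra]. *)
Let pospart (t x p : R) := x <= t /\ p = t - x \/ t <= x /\ p = 0.

Let posl (t x : R) : x <= t -> pospart t x (t - x).
Proof. by left. Qed.

Let posr (t x : R) : t <= x -> pospart t x 0.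
Proof. by right. Qed.

(** As a function of x, -(t - x)^+ has slope 1 left of t and slope 0 right of it; a line through the
    corner whose slope stays d away from both lies above it by at least d |x - t|. *)
Let pospart_ge (c d t x p : R) : 0 < d -> d <= c <= 1 - d -> pospart t x p ->
  - p + d * `|x - t| <= c * (x - t).
Proof.
move=> d0 /andP[dc cd] [[xt ->]|[tx ->]].
  rewrite ler0_norm; last by lra.
  have : 0 <= (1 - d - c) * (t - x) by rewrite mulr_ge0//; lra.
  lra.
rewrite ger0_norm; last by lra.
have : 0 <= (c - d) * (x - t) by rewrite mulr_ge0//; lra.
lra.
Qed.

(** The witness t is the third smallest entry of the list i, l, m, m; since m is listed twice, its
    positive part is subtracted twice. *)
Let ex_threshold4 (i l m z : R) : i <= l ->
  z <= i + l + m -> z <= 2 * m + i -> z <= 2 * m + l ->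
  exists t p1 p2 p3, [/\ pospart t i p1, pospart t l p2, pospart t m p3
    & z <= 3 * t - p1 - p2 - 2 * p3].
Proof.
move=> il z1 z2 z3; have [mi|/ltW im] := leP m i.
  exists i, 0, 0, (i - m); split; [exact: posr|exact: posr|exact: posl|lra].
have [ml|/ltW lm] := leP m l.
  exists m, (m - i), 0, 0; split; [exact: posl|exact: posr|exact: posr|lra].
exists m, (m - i), (m - l), 0; split; [exact: posl|exact: posl|exact: posr|lra].
Qed.

Let ex_threshold5 (i l m s z : R) : i <= l ->
  z <= i + l + m -> z <= 2 * m + i -> z <= 2 * m + l -> z <= s + i + l ->
  z <= m + s + i -> z <= m + s + l -> z <= 2 * m + s ->
  exists t p1 p2 p3 p4,
    [/\ pospart t i p1, pospart t l p2, pospart t m p3, pospart t s p4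
      & z <= 3 * t - p1 - p2 - 2 * p3 - p4].
Proof.
move=> il z1 z2 z3 z4 z5 z6 z7; have [mi|/ltW im] := leP m i.
  have [sm|/ltW ms] := leP s m.
    exists m, 0, 0, 0, (m - s); split; rewrite ?subrr;
      [exact: posr|apply: posr; lra|exact: posr|exact: posl|lra].
  have [si|/ltW is'] := leP s i.
    exists s, 0, 0, (s - m), 0; split;
      [exact: posr|apply: posr; lra|exact: posl|exact: posr|lra].
  exists i, 0, 0, (i - m), 0; split;
    [exact: posr|exact: posr|exact: posl|exact: posr|lra].
have [ml|/ltW lm] := leP m l.
  have [sm|/ltW ms] := leP s m.
    exists m, (m - i), 0, 0, (m - s); split;
      [exact: posl|exact: posr|exact: posr|exact: posl|lra].
  exists m, (m - i), 0, 0, 0; split;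
    [exact: posl|exact: posr|exact: posr|exact: posr|lra].
have [sl|/ltW ls] := leP s l.
  exists l, (l - i), 0, 0, (l - s); split;
    [exact: posl|exact: posr|exact: posr|exact: posl|lra].
have [sm|/ltW ms] := leP s m.
  exists s, (s - i), (s - l), 0, 0; split;
    [apply: posl; lra|exact: posl|exact: posr|exact: posr|lra].
exists m, (m - i), (m - l), 0, 0; split;
  [exact: posl|exact: posl|exact: posr|exact: posr|lra].
Qed.

Let ler_mul_distD (d t a b : R) : 0 < d ->
  d * `|a - b| <= d * `|a - t| + d * `|b - t|.
Proof.
move=> d0; rewrite -mulrDr ler_wpM2l ?(ltW d0)//.
by rewrite (le_trans (ler_distD t _ _))// (distrC t b).
Qed.

(* The sum of the k smallest of the x_j equals [max_t (k t - sum_j (t - x_j)^+)],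
   attained when t is the k-th smallest; this form makes the gain over any
   admissible weighted sum of the x_j visible term by term. *)
Lemma three_smallest4 (e1 e2 g d i l m z : R) :
  e1 + e2 + 2 * g = 3 -> 0 < d -> d <= e1 <= 1 - d -> d <= e2 <= 1 - d ->
  d <= g <= 1 - d ->
  z <= i + l + m -> z <= 2 * m + i -> z <= 2 * m + l ->
  z <= e1 * i + e2 * l + 2 * g * m - d / 2 * (`|i - l| + `|i - m|).
Proof.
move=> hs d0 h1 h2 h3 z1 z2 z3.
have [t [p1 [p2 [p3 [P1 P2 P3 zt]]]]] : exists t p1 p2 p3,
    [/\ pospart t i p1, pospart t l p2, pospart t m p3
      & z <= 3 * t - p1 - p2 - 2 * p3].
  have [il|/ltW li] := leP i l; first exact: ex_threshold4.
  have [||||t [p1 [p2 [p3 [? ? ? ?]]]]] := @ex_threshold4 l i m z; rewrite ?(addrC l)//.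
  by exists t, p2, p1, p3; split => //; lra.
have k1 := pospart_ge d0 h1 P1; have k2 := pospart_ge d0 h2 P2.
have k3 := pospart_ge d0 h3 P3.
(* Both distances start at i, but the term d |i - t| is available only once: hence d / 2 here and d
   / 3 with three distances. *)
have T1 := ler_mul_distD t i l d0; have T2 := ler_mul_distD t i m d0.
have N a : 0 <= d * `|a - t| by rewrite mulr_ge0// ltW.
have N1 := N i; have N2 := N l; have N3 := N m.
have E : (e1 + e2 + 2 * g) * t = 3 * t by rewrite hs.
clear -k1 k2 k3 T1 T2 N1 N2 N3 E zt; lra.
Qed.

Lemma three_smallest5 (e1 e2 g e4 d i l m s z : R) :
  e1 + e2 + 2 * g + e4 = 3 -> 0 < d -> d <= e1 <= 1 - d -> d <= e2 <= 1 - d ->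
  d <= g <= 1 - d -> d <= e4 <= 1 - d ->
  z <= i + l + m -> z <= 2 * m + i -> z <= 2 * m + l -> z <= s + i + l ->
  z <= m + s + i -> z <= m + s + l -> z <= 2 * m + s ->
  z <= e1 * i + e2 * l + 2 * g * m + e4 * s
       - d / 3 * (`|i - l| + `|i - m| + `|i - s|).
Proof.
move=> hs d0 h1 h2 h3 h4 z1 z2 z3 z4 z5 z6 z7.
have [t [p1 [p2 [p3 [p4 [P1 P2 P3 P4 zt]]]]]] : exists t p1 p2 p3 p4,
    [/\ pospart t i p1, pospart t l p2, pospart t m p3, pospart t s p4
      & z <= 3 * t - p1 - p2 - 2 * p3 - p4].
  have [il|/ltW li] := leP i l; first exact: ex_threshold5.
  have [||||||||t [p1 [p2 [p3 [p4 [? ? ? ? ?]]]]]] := @ex_threshold5 l i m s z => //;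
    try by clear -z1 z2 z3 z4 z5 z6 z7; lra.
  by exists t, p2, p1, p3, p4; split => //; lra.
have k1 := pospart_ge d0 h1 P1; have k2 := pospart_ge d0 h2 P2.
have k3 := pospart_ge d0 h3 P3; have k4 := pospart_ge d0 h4 P4.
have T1 := ler_mul_distD t i l d0; have T2 := ler_mul_distD t i m d0.
have T3 := ler_mul_distD t i s d0.
have N a : 0 <= d * `|a - t| by rewrite mulr_ge0// ltW.
have N1 := N i; have N2 := N l; have N3 := N m; have N4 := N s.
have E : (e1 + e2 + 2 * g + e4) * t = 3 * t by rewrite hs.
clear -k1 k2 k3 k4 T1 T2 T3 N1 N2 N3 N4 E zt; lra.
Qed.

End three_smallest.

(** * Lebesgue measure on R^k *)

Section affine1.
Local Open Scope ereal_scope.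
Variable R : realType.
Notation mu := (@lebesgue_measure R).

Let affine (s c : R) (x : measurableTypeR R) : measurableTypeR R := (s * x + c)%R.

Let measurable_affine (s c : R) : measurable_fun setT (affine s c).
Proof. by apply: measurable_funD => //; exact: mulrl_measurable. Qed.

Let nu (s c : R) : {measure set (measurableTypeR R) -> \bar R} :=
  mscale (NngNum (normr_ge0 s))
    (measure_function_pushforward__canonical__measure_function_Measure mu
      (measurable_affine s c)).

(** Uniqueness of Lebesgue measure: |s| times its image under x -> s x + c has the right value on
    half-open intervals. For s < 0 the preimage is closed on the other side, which leaves its length
    unchanged. *)
Let lebesgue_measure_affine (s c : R) (A : set (measurableTypeR R)) :
  (s != 0)%R -> measurable A -> mu A = nu s c A.
Proof.
move=> s0 mA.
apply: (@lebesgue_measure_unique R (nu s c)) => //.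
move=> X [[a b]/= _ <-].
rewrite /nu /mscale /pushforward/=.
rewrite lebesgue_measure_itv/= lte_fin.
have [s1|s1] : (0 < s)%R \/ (s < 0)%R by case: (ltgtP s 0%R) s0 => //; auto.
- rewrite [X in _ = _ * mu X](_ : _ = `]((a - c) / s)%R, ((b - c) / s)%R]%classic); last first.
    apply/seteqP; split => x; rewrite /affine /= !in_itv/= ltr_pdivrMr// ler_pdivlMr//;
    rewrite (mulrC s) => /andP[? ?]; apply/andP; split; lra.
  rewrite lebesgue_measure_itv/= lte_fin ltr_pM2r ?invr_gt0//.
  rewrite ltrD2r; case: ifP => _; last by rewrite mule0.
  by rewrite -!EFinB -EFinM; congr EFin; rewrite gtr0_norm//; field.
- rewrite [X in _ = _ * mu X](_ : _ = `[((b - c) / s)%R, ((a - c) / s)%R[%classic); last first.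
    apply/seteqP; split => x; rewrite /affine /= !in_itv/= ler_ndivrMr// ltr_ndivlMr//;
    rewrite (mulrC s) => /andP[? ?]; apply/andP; split; lra.
  rewrite lebesgue_measure_itv/= lte_fin ltr_nM2r ?invr_lt0//.
  rewrite ltrD2r; case: ifP => _; last by rewrite mule0.
  by rewrite -!EFinB -EFinM; congr EFin; rewrite ltr0_norm//; field.
Qed.

Lemma integral_affine (s c : R) (f : measurableTypeR R -> \bar R) :
  (s != 0)%R -> measurable_fun setT f -> (forall x, 0 <= f x) ->
  \int[mu]_x f (s * x + c)%R = `|s|^-1%:E * \int[mu]_x f x.
Proof.
move=> s0 mf f0.
have -> : \int[mu]_x f x = \int[nu s c]_x f x.
  by apply: eq_measure_integral => A mA _; exact: lebesgue_measure_affine.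
rewrite ge0_integral_mscale//= ge0_integral_pushforward//.
by rewrite muleA -EFinM mulVf ?normr_eq0// mul1e preimage_setT.
Qed.
End affine1.

Section coordinates.
Variable R : realType.

Lemma crd_mkpt k (f : nat -> R) i : (i <= k)%N -> crd (mkpt k f) i = f i.
Proof.
by elim: k f i => [|k ih] f [|i]//= ik; rewrite ih.
Qed.

Lemma Rn_ext k (x y : Rn R k) : (forall i, (i <= k)%N -> crd x i = crd y i) -> x = y.
Proof.
elim: k x y => [|k ih] x y h; first exact: (h 0%N).
case: x h => x1 x2; case: y => y1 y2 h; congr (_, _); first exact: (h 0%N).
by apply: ih => i ik; exact: (h i.+1).
Qed.

Lemma measurable_crd k i : measurable_fun setT (fun x : Rn R k => crd x i : R).
Proof.
elim: k i => [|k ih] i; first exact: measurable_id.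
case: i => [|i]; first exact: measurable_fst.
exact: (measurableT_comp (ih i) measurable_snd).
Qed.

Lemma measurable_mkpt d (T : measurableType d) k (f : T -> nat -> R) :
  (forall i, measurable_fun setT (f^~ i)) ->
  measurable_fun setT (fun t => mkpt k (f t) : Rn R k).
Proof.
elim: k f => [|k ih] f mf; first exact: mf.
apply: (measurable_fun_pair (mf 0%N)).
by apply: (ih (fun t i => f t i.+1)) => i; exact: mf.
Qed.

Local Open Scope ereal_scope.

(* Integration in the coordinates in order, so that the shift of the last one
   may depend on all the others. *)
Lemma integral_triangular k (s : R) (c : nat -> R) (L : Rn R k -> R)
    (f : Rn R k -> \bar R) :
  (s != 0)%R -> measurable_fun setT L ->
  (forall x y : Rn R k, (forall i, (i < k)%N -> crd x i = crd y i) -> L x = L y) ->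
  measurable_fun setT f -> (forall x, 0 <= f x) ->
  \int[leb R k]_x f (mkpt k (fun i => if (i < k)%N then s * crd x i + c i
                                   else s * crd x i + L x)%R)
  = (`|s| ^- k.+1)%:E * \int[leb R k]_x f x.
Proof.
move=> s0; elim: k c L f => [|k ih] c L f mL hL mf f0.
  (* There are no earlier coordinates when k = 0, so the hypothesis on L makes it constant. *)
  rewrite expr1 -(integral_affine (L 0%R) s0 mf f0); apply: eq_integral => x _ /=.
  by congr (f (_ + _)%R); exact: hL.
pose g (z : measurableTypeR R * Rn R k) := f (s * z.1 + c 0%N, mkpt k (fun i => if (i < k)%N then s * crd z.2 i + c i.+1
                                   else s * crd z.2 i + L z))%R.
have mg : measurable_fun setT g.
  apply: (measurableT_comp mf).
  apply/measurable_fun_pair.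
    apply: measurable_funD => //.
    by apply: measurable_funM => //; exact: measurable_fst.
  apply: measurable_mkpt => i; case: ltnP => ik.
    apply: measurable_funD => //; apply: measurable_funM => //.
    exact: (measurableT_comp (@measurable_crd k i) measurable_snd).
  apply: measurable_funD => //; apply: measurable_funM => //.
  exact: (measurableT_comp (@measurable_crd k i) measurable_snd).
transitivity (\int[lebR R \x leb R k]_z g z); first by [].
rewrite fubini_tonelli1//; last by move=> ?; exact: f0.
rewrite /fubini_F.
pose h (t : measurableTypeR R) := \int[leb R k]_x f (t, x).
have mh : measurable_fun setT h.
  exact: (measurable_fun_fubini_tonelli_F f mf f0).
have h0 x : 0 <= h x by apply: integral_ge0.
have E x0 : \int[leb R k]_x g (x0, x) = (`|s| ^- k.+1)%:E * h (s * x0 + c 0%N)%R.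
  rewrite -(ih (fun i => c i.+1) (fun x => L (x0, x)) (fun x => f ((s * x0 + c 0%N)%R, x)))//.
  - exact: (measurableT_comp mL (pair1_measurable _)).
  - by move=> x y xy; apply: hL => -[|i]//= ik; exact: xy.
  - exact: (measurableT_comp mf (pair1_measurable _)).
under eq_integral do rewrite E.
rewrite ge0_integralZl//; last first.
  have ma : measurable_fun setT (fun x : measurableTypeR R => s * x + c 0%N : measurableTypeR R)%R.
    by apply: measurable_funD => //; exact: mulrl_measurable.
  exact: (measurableT_comp mh ma).
rewrite (integral_affine _ s0 mh h0) muleA -EFinM; congr (_%:E * _).
  by rewrite -invfM [in RHS]exprSr.
by rewrite -[LHS](fubini_tonelli1 f).
Qed.

End coordinates.

Section boxes.
Variable R : realType.

(** The half-widths depend on the coordinate because dilations are anisotropic: a Koranyi ball of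
    radius rho has extent rho horizontally and rho^2 vertically. *)
Definition box k (c a : nat -> R) : set (Rn R k) :=
  [set x | forall i, (i <= k)%N -> `|crd x i - c i| <= a i].

Lemma boxS k c a : @box k.+1 c a =
  [set t : R | `|t - c 0%N| <= a 0%N] `*` @box k (c \o S) (a \o S).
Proof.
apply/seteqP; split => [[t x] h|[t x] [/= h1 h2] [|i]//= ik].
  by split => /= [|i ik]; [exact: (h 0%N)|exact: (h i.+1)].
exact: h2.
Qed.

Lemma box1E (c a : R) : [set t : R | `|t - c| <= a] = `[c - a, c + a]%classic.
Proof. by apply/seteqP; split => t /=; rewrite in_itv/= ler_distl. Qed.

Lemma measurable_box k c a : measurable (@box k c a).
Proof.
elim: k c a => [|k ih] c a.
  have -> : @box 0 c a = [set t : R | `|t - c 0%N| <= a 0%N].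
    by apply/seteqP; split => [x h|x h [|//]]; [exact: (h 0%N)|].
  by rewrite box1E; exact: measurable_itv.
by rewrite boxS; apply: measurableX => //; rewrite box1E; exact: measurable_itv.
Qed.

Lemma measure_box k c a : (forall i, 0 <= a i) ->
  leb R k (@box k c a) = (\prod_(i < k.+1) (2 * a i))%:E.
Proof.
elim: k c a => [|k ih] c a a0.
  have -> : @box 0 c a = [set t : R | `|t - c 0%N| <= a 0%N].
    by apply/seteqP; split => [x h|x h [|//]]; [exact: (h 0%N)|].
  rewrite box1E /= lebesgue_measure_itv/= lte_fin big_ord1 ltrD2l.
  case: ifP => h; first by rewrite -EFinB; congr EFin; ring.
  have e : a 0%N = 0 by have := a0 0%N; move/negbT: h; rewrite -leNgt; lra.
  by rewrite /= e mulr0.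
rewrite boxS.
transitivity ((lebR R \x leb R k)%E ([set t : R | `|t - c 0%N| <= a 0%N] `*` @box k (c \o S) (a \o S))).
  by [].
rewrite product_measure1E; last 2 first.
- by rewrite box1E; exact: measurable_itv.
- exact: measurable_box.
rewrite box1E big_ord_recl EFinM ih; last by move=> i; exact: a0.
congr (_ * _)%E.
rewrite /= lebesgue_measure_itv/= lte_fin ltrD2l.
case: ifP => h; first by rewrite -EFinB; congr EFin; ring.
have e : a 0%N = 0 by have := a0 0%N; move/negbT: h; rewrite -leNgt; lra.
by rewrite /= e mulr0.
Qed.

End boxes.

(** * Coordinates and Koranyi norm on the Heisenberg group *)

Section heisenberg_geometry.
Variables (R : realType) (n : nat).
Notation H := (Hn R n).
Implicit Types x y z : H.

Definition hu x y := Hmul x (Hinv y).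
Definition hv x y := Hmul x y.
Definition hw z x := Hmul (Hinv z) x.

Lemma crd_Hmul x y i : (i < 2 * n)%N -> crd (Hmul x y) i = crd x i + crd y i.
Proof. by move=> h; rewrite crd_mkpt ?h// ltnW. Qed.

Lemma Ht_Hmul x y : Ht (Hmul x y) = Ht x + Ht y + 2^-1 * Imzw x y.
Proof. by rewrite /Ht crd_mkpt// ltnn. Qed.

Lemma crd_Hinv x i : (i <= 2 * n)%N -> crd (Hinv x) i = - crd x i.
Proof. by move=> h; rewrite crd_mkpt. Qed.

Lemma ltn_re (j : 'I_n) : (j < 2 * n)%N.
Proof. by rewrite mul2n -addnn (leq_trans (ltn_ord j))// leq_addr. Qed.

Lemma ltn_im (j : 'I_n) : (n + j < 2 * n)%N.
Proof. by rewrite mul2n -addnn ltn_add2l. Qed.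

Lemma Imzw_eq x y x' y' :
  (forall i, (i < 2 * n)%N -> crd x i = crd x' i) ->
  (forall i, (i < 2 * n)%N -> crd y i = crd y' i) -> Imzw x y = Imzw x' y'.
Proof.
move=> hx hy; apply: eq_bigr => j _; rewrite /Hre /Him.
by rewrite !hx ?hy ?ltn_re ?ltn_im.
Qed.

Lemma ImzwNr x y : Imzw x (Hinv y) = - Imzw x y.
Proof.
rewrite /Imzw -sumrN; apply: eq_bigr => j _; rewrite /Hre /Him.
by rewrite !crd_Hinv ?(ltnW (ltn_re _)) ?(ltnW (ltn_im _))//; ring.
Qed.

Lemma ImzwNl x y : Imzw (Hinv x) y = - Imzw x y.
Proof.
rewrite /Imzw -sumrN; apply: eq_bigr => j _; rewrite /Hre /Him.
by rewrite !crd_Hinv ?(ltnW (ltn_re _)) ?(ltnW (ltn_im _))//; ring.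
Qed.

Lemma Imzw_le x y : `|Imzw x y| <= Hz2 x + Hz2 y.
Proof.
rewrite /Imzw /Hz2 -big_split/= (le_trans (ler_norm_sum _ _ _))//.
apply: ler_sum => j _; rewrite ler_norml.
set a := Hre x j; set b := Him x j; set c := Hre y j; set d := Him y j.
have := sqr_ge0 (b + c); have := sqr_ge0 (a - d).
have := sqr_ge0 (b - c); have := sqr_ge0 (a + d).
have := sqr_ge0 a; have := sqr_ge0 b; have := sqr_ge0 c; have := sqr_ge0 d.
by lra.
Qed.

Lemma Hz2_ge0 x : 0 <= Hz2 x.
Proof. by apply: sumr_ge0 => j _; rewrite addr_ge0// sqr_ge0. Qed.

Lemma Hz2_comb (a b c : R) x y z :
  (forall p q r : R, p = (a * q + b * r) -> p ^+ 2 <= c * (q ^+ 2 + r ^+ 2)) ->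
  (forall i, (i < 2 * n)%N -> crd x i = a * crd y i + b * crd z i) ->
  Hz2 x <= c * (Hz2 y + Hz2 z).
Proof.
move=> hc h; rewrite /Hz2 -big_split/= mulr_sumr; apply: ler_sum => j _.
have := hc _ _ _ (h _ (ltn_re j)); have := hc _ _ _ (h _ (ltn_im j)).
by rewrite /Hre /Him; lra.
Qed.

Lemma Hre_sqr_le x i : (i < 2 * n)%N -> crd x i ^+ 2 <= Hz2 x.
Proof.
move=> hi; rewrite /Hz2.
have [h|h] := ltnP i n.
  rewrite (bigD1 (Ordinal h))//= /Hre /Him -addrA lerDl addr_ge0 ?sqr_ge0//.
  by apply: sumr_ge0 => j _; rewrite addr_ge0 ?sqr_ge0.
have h' : (i - n < n)%N by rewrite ltn_subLR// addnn -mul2n.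
rewrite (bigD1 (Ordinal h'))//= /Hre /Him subnKC// addrAC lerDr.
by rewrite addr_ge0 ?sqr_ge0// sumr_ge0// => j _; rewrite addr_ge0 ?sqr_ge0.
Qed.

Lemma koranyi_ge0 x : 0 <= koranyi x.
Proof. exact: powR_ge0. Qed.

Lemma koranyi_leP x (s : R) : 0 <= s ->
  (koranyi x <= s) = (Hz2 x ^+ 2 + Ht x ^+ 2 <= s ^+ 4).
Proof.
move=> s0; set A := _ + _.
have A0 : 0 <= A by rewrite addr_ge0// sqr_ge0.
have e : koranyi x ^+ 4 = A.
  by rewrite /koranyi -powR_mulrn ?powR_ge0// -powRrM mulVf// powRr1.
by rewrite -e ler_pXn2r// nnegrE koranyi_ge0.
Qed.

Lemma koranyi_bounds x (s : R) : 0 <= s -> koranyi x <= s ->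
  Hz2 x <= s ^+ 2 /\ `|Ht x| <= s ^+ 2.
Proof.
move=> s0; rewrite koranyi_leP// => h.
have z0 := Hz2_ge0 x.
have s20 : 0 <= s ^+ 2 by rewrite sqr_ge0.
have E : s ^+ 4 = s ^+ 2 ^+ 2 by rewrite -exprM.
have t0 := sqr_ge0 (Ht x); have z20 := sqr_ge0 (Hz2 x).
rewrite E in h; split.
  by rewrite -(@ler_pXn2r _ 2)//; lra.
by rewrite -(@ler_pXn2r _ 2)// real_normK ?num_real//; lra.
Qed.

(** The hypotheses give |x|^4 <= 2 c^2 s^4, and 2 c^2 <= (c + 1)^4 avoids a fourth root. *)
Lemma koranyi_le x (s c : R) : 0 <= s -> 0 <= c -> Hz2 x <= c * s ^+ 2 -> `|Ht x| <= c * s ^+ 2 ->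
  koranyi x <= (c + 1) * s.
Proof.
move=> s0 c0 hz ht; rewrite koranyi_leP ?mulr_ge0 ?addr_ge0//.
have z0 := Hz2_ge0 x.
have s20 : 0 <= c * s ^+ 2 by rewrite mulr_ge0 ?sqr_ge0.
have h1 : Hz2 x ^+ 2 <= (c * s ^+ 2) ^+ 2 by rewrite ler_pXn2r.
have h2 : Ht x ^+ 2 <= (c * s ^+ 2) ^+ 2.
  by rewrite -real_normK ?num_real// ler_pXn2r.
apply: (le_trans (lerD h1 h2)).
have -> : (c * s ^+ 2) ^+ 2 + (c * s ^+ 2) ^+ 2 = (2 * c ^+ 2) * s ^+ 4 by ring.
rewrite exprMn ler_wpM2r ?exprn_ge0//.
have c2 := sqr_ge0 c; have c3 : 0 <= c ^+ 3 by rewrite exprn_ge0.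
have c4 : 0 <= c ^+ 4 by rewrite exprn_ge0.
have -> : (c + 1) ^+ 4 = c ^+ 4 + 4 * c ^+ 3 + 6 * c ^+ 2 + 4 * c + 1 by ring.
lra.
Qed.

End heisenberg_geometry.

(** * Abstract geometry of the form *)

(* [M] is the volume gauge (the norm to the power of the homogeneous dimension),
   [u x y], [v x y], [w z x] stand for x y^-1, x y, z^-1 x. *)
Record bilinear_geometry (R : realType) d (T : measurableType d)
    (mu : {sigma_finite_measure set T -> \bar R}) (M : T -> R)
    (u v w : T -> T -> T) (C : R) : Prop := BilinearGeometry {
  geo_C1 : 1 <= C ;
  geo_M0 : forall x, 0 <= M x ;
  geo_mM : measurable_fun setT M ;
  geo_mu : measurable_fun setT (fun z : T * T => u z.1 z.2) ;
  geo_mv : measurable_fun setT (fun z : T * T => v z.1 z.2) ;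
  geo_mw : measurable_fun setT (fun z : T * T => w z.1 z.2) ;
  geo_vol_ge : forall s : R, 0 < s -> (s%:E <= C%:E * mu [set x | (M x <= s)%R])%E ;
  geo_vol_le : forall s : R, 0 < s -> (mu [set x | (M x <= s)%R] <= C%:E * s%:E)%E ;
  geo_int : forall f : T -> \bar R, measurable_fun setT f -> (forall x, 0 <= f x)%E ->
    [/\ forall x, (\int[mu]_y f (u x y) = \int[mu]_y f y)%E,
        forall x, (\int[mu]_y f (v x y) = \int[mu]_y f y)%E,
        forall z, (\int[mu]_x f (w z x) = \int[mu]_x f x)%E
      & [/\ forall y, (\int[mu]_x f (u x y) = \int[mu]_x f x)%E,
        forall y, (\int[mu]_x f (v x y) = \int[mu]_x f x)%E
      & forall x, (\int[mu]_z f (w z x) = \int[mu]_z f z)%E]] ;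
  geo_uv : forall f g : T -> \bar R,
    measurable_fun setT f -> (forall x, 0 <= f x)%E ->
    measurable_fun setT g -> (forall x, 0 <= g x)%E ->
    (\int[mu]_x \int[mu]_y (f (u x y) * g (v x y))
      <= (\int[mu]_x f x) * \int[mu]_x g x)%E ;
  geo_quasi : forall x y s, 0 <= s ->
    [/\ (M x <= s -> M y <= s -> M (u x y) <= C * s /\ M (v x y) <= C * s),
        (M (u x y) <= s -> M (v x y) <= s -> M x <= C * s /\ M y <= C * s),
        (M (u x y) <= s -> M x <= s -> M (v x y) <= C * s /\ M y <= C * s),
        (M (u x y) <= s -> M y <= s -> M (v x y) <= C * s /\ M x <= C * s)
      & [/\ (M (v x y) <= s -> M x <= s -> M (u x y) <= C * s /\ M y <= C * s)
      & (M (v x y) <= s -> M y <= s -> M (u x y) <= C * s /\ M x <= C * s)]] ;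
  geo_w : forall z x y s, 0 <= s -> M (w z x) <= s -> M y <= s ->
    M (w z (u x y)) <= C * s /\ M (w z (v x y)) <= C * s
}.

Section heisenberg_instance.
Variables (R : realType) (n : nat).
Notation H := (Hn R n).
Notation mu := (Hmeas R n).
Implicit Types x y z : H.

Lemma Hz2_u_v x y :
  Hz2 (hu x y) + Hz2 (hv x y) = 2 * (Hz2 x + Hz2 y).
Proof.
rewrite /Hz2 -!big_split/= mulr_sumr; apply: eq_bigr => j _.
rewrite /Hre /Him /hu /hv !crd_Hmul ?ltn_re ?ltn_im//.
by rewrite !crd_Hinv ?(ltnW (ltn_re _)) ?(ltnW (ltn_im _))//; ring.
Qed.

Lemma Hz2_y_u x y : Hz2 y <= 2 * (Hz2 (hu x y) + Hz2 x).
Proof.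
apply: (@Hz2_comb _ _ (-1) 1 2).
  by move=> p q r ->; have := sqr_ge0 (q + r); lra.
move=> i hi; rewrite /hu crd_Hmul// crd_Hinv ?(ltnW hi)//; ring.
Qed.

Lemma Hz2_y_v x y : Hz2 y <= 2 * (Hz2 (hv x y) + Hz2 x).
Proof.
apply: (@Hz2_comb _ _ 1 (-1) 2).
  by move=> p q r ->; have := sqr_ge0 (q + r); lra.
move=> i hi; rewrite /hv crd_Hmul//; ring.
Qed.

Lemma Hz2_x_u x y : Hz2 x <= 2 * (Hz2 (hu x y) + Hz2 y).
Proof.
apply: (@Hz2_comb _ _ 1 1 2).
  by move=> p q r ->; have := sqr_ge0 (q - r); lra.
move=> i hi; rewrite /hu crd_Hmul// crd_Hinv ?(ltnW hi)//; ring.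
Qed.

Lemma Hz2_x_v x y : Hz2 x <= 2 * (Hz2 (hv x y) + Hz2 y).
Proof.
apply: (@Hz2_comb _ _ 1 (-1) 2).
  by move=> p q r ->; have := sqr_ge0 (q + r); lra.
move=> i hi; rewrite /hv crd_Hmul//; ring.
Qed.

Lemma Ht_u x y : Ht (hu x y) = Ht x - Ht y - 2^-1 * Imzw x y.
Proof. by rewrite /hu Ht_Hmul {2}/Ht crd_Hinv// ImzwNr /Ht; ring. Qed.

Lemma Ht_v x y : Ht (hv x y) = Ht x + Ht y + 2^-1 * Imzw x y.
Proof. by rewrite /hv Ht_Hmul. Qed.

(** Horizontally this is the parallelogram law [Hz2_u_v] with its one-sided variants; vertically,
    any two of the four heights determine the others linearly up to a multiple of [Imzw x y], which
    [Imzw_le] absorbs. The factor 32 leaves slack in every case, and [koranyi_le] turns it into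
    33. *)
Lemma koranyi_quasi x y s : 0 <= s -> let k a := koranyi a <= s in
  let K a := koranyi a <= 33 * s in
  [/\ (k x -> k y -> K (hu x y) /\ K (hv x y)),
      (k (hu x y) -> k (hv x y) -> K x /\ K y),
      (k (hu x y) -> k x -> K (hv x y) /\ K y),
      (k (hu x y) -> k y -> K (hv x y) /\ K x)
    & [/\ (k (hv x y) -> k x -> K (hu x y) /\ K y)
    & (k (hv x y) -> k y -> K (hu x y) /\ K x)]].
Proof.
move=> s0 k K.
have s2 : 0 <= s ^+ 2 by rewrite sqr_ge0.
have B a : Hz2 a <= 32 * s ^+ 2 -> `|Ht a| <= 32 * s ^+ 2 -> K a.
  move=> h1 h2; rewrite /K (_ : 33 = 32 + 1 :> R); last by lra.
  exact: koranyi_le.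
have I := Imzw_le x y; have P := Hz2_u_v x y.
have := Hz2_y_u x y; have := Hz2_y_v x y; have := Hz2_x_u x y; have := Hz2_x_v x y.
have := Hz2_ge0 x; have := Hz2_ge0 y; have := Hz2_ge0 (hu x y); have := Hz2_ge0 (hv x y).
move: I; rewrite ler_norml => /andP[I1 I2] *.
split; last split.
all: move=> /(koranyi_bounds s0)[z1 +] /(koranyi_bounds s0)[z2 +].
all: rewrite ?Ht_u ?Ht_v !ler_norml => /andP[t1 t1'] /andP[t2 t2'].
all: split; apply: B; rewrite ?Ht_u ?Ht_v ?ler_norml; lra.
Qed.

Lemma Hmul_assoc x y z : Hmul (Hmul x y) z = Hmul x (Hmul y z).
Proof.
apply: Rn_ext => i; rewrite leq_eqVlt => /predU1P[->|hi]; last first.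
  by rewrite !crd_Hmul// addrA.
rewrite -!/(Ht _) !Ht_Hmul.
suff : Imzw x y + Imzw (Hmul x y) z = Imzw y z + Imzw x (Hmul y z) by lra.
rewrite /Imzw -!big_split/=; apply: eq_bigr => j _; rewrite /Hre /Him.
by rewrite !crd_Hmul ?ltn_re ?ltn_im//; ring.
Qed.

(** By associativity z^-1 (x y) = (z^-1 x) y, so this is the first case of [koranyi_quasi] with z^-1
    x in place of x. *)
Lemma koranyi_w z x y s : 0 <= s -> koranyi (hw z x) <= s -> koranyi y <= s ->
  koranyi (hw z (hu x y)) <= 33 * s /\ koranyi (hw z (hv x y)) <= 33 * s.
Proof.
move=> s0 h1 h2; rewrite /hw /hu /hv -!Hmul_assoc.
by have [/(_ h1 h2)] := koranyi_quasi (hw z x) y s0.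
Qed.

End heisenberg_instance.

Section heisenberg_integration.
Variables (R : realType) (n : nat).
Notation H := (Hn R n).
Notation mu := (Hmeas R n).
Implicit Types x y z : H.

Lemma measurable_Imzw d (T : measurableType d) (f g : T -> H) :
  measurable_fun setT f -> measurable_fun setT g ->
  measurable_fun setT (fun t => Imzw (f t) (g t)).
Proof.
move=> mf mg; apply: measurable_sum => j.
have mc (h : T -> H) i : measurable_fun setT h -> measurable_fun setT (fun t => crd (h t) i).
  by move=> mh; exact: (measurableT_comp (@measurable_crd R (2 * n) i) mh).
by apply: measurable_funB; apply: measurable_funM; exact: mc.
Qed.

Lemma measurable_Hmul d (T : measurableType d) (f g : T -> H) :
  measurable_fun setT f -> measurable_fun setT g ->
  measurable_fun setT (fun t => Hmul (f t) (g t)).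
Proof.
move=> mf mg; apply: measurable_mkpt => i.
have mc (h : T -> H) j : measurable_fun setT h -> measurable_fun setT (fun t => crd (h t) j).
  by move=> mh; exact: (measurableT_comp (@measurable_crd R (2 * n) j) mh).
case: ltnP => _; first by apply: measurable_funD; exact: mc.
apply: measurable_funD; first by apply: measurable_funD; exact: mc.
by apply: measurable_funM => //; exact: measurable_Imzw.
Qed.

Lemma measurable_Hinv d (T : measurableType d) (f : T -> H) :
  measurable_fun setT f -> measurable_fun setT (fun t => Hinv (f t)).
Proof.
move=> mf; apply: measurable_mkpt => i; apply: measurable_funN.
exact: (measurableT_comp (@measurable_crd R (2 * n) i) mf).
Qed.

Lemma measurable_koranyi : measurable_fun setT (@koranyi R n).
Proof.
apply: (@measurableT_comp _ _ _ _ _ _ (fun a : R => a `^ 4^-1)).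
  exact: measurable_powR.
apply: measurable_funD; apply: measurable_funX; last exact: measurable_crd.
apply: measurable_sum => j; apply: measurable_funD; apply: measurable_funX;
  exact: measurable_crd.
Qed.

Local Open Scope ereal_scope.

Lemma integral_Htriangular (s : R) (c : nat -> R) (L : H -> R) (phi : H -> H)
    (f : H -> \bar R) : (s != 0)%R -> measurable_fun setT L ->
  (forall x y, (forall i, (i < 2 * n)%N -> crd x i = crd y i) -> L x = L y) ->
  (forall y i, (i < 2 * n)%N -> crd (phi y) i = s * crd y i + c i)%R ->
  (forall y, Ht (phi y) = s * Ht y + L y)%R ->
  measurable_fun setT f -> (forall x, 0 <= f x) ->
  \int[mu]_x f (phi x) = (`|s| ^- (2 * n).+1)%:E * \int[mu]_x f x.
Proof.
move=> s0 mL hL h1 h2 mf f0; rewrite -(integral_triangular c s0 mL hL mf f0).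
apply: eq_integral => x _; congr f; apply: Rn_ext => i ik.
rewrite crd_mkpt//; move: ik; rewrite leq_eqVlt => /predU1P[->|ik].
  by rewrite ltnn; exact: h2.
by rewrite ik; exact: h1.
Qed.

Lemma integral_Htriangular1 (s : R) (c : nat -> R) (L : H -> R) (phi : H -> H)
    (f : H -> \bar R) : (`|s| = 1)%R -> measurable_fun setT L ->
  (forall x y, (forall i, (i < 2 * n)%N -> crd x i = crd y i) -> L x = L y) ->
  (forall y i, (i < 2 * n)%N -> crd (phi y) i = s * crd y i + c i)%R ->
  (forall y, Ht (phi y) = s * Ht y + L y)%R ->
  measurable_fun setT f -> (forall x, 0 <= f x) ->
  \int[mu]_x f (phi x) = \int[mu]_x f x.
Proof.
move=> s1 mL hL h1 h2 mf f0.
rewrite (integral_Htriangular _ mL hL h1 h2)//; last by rewrite -normr_gt0 s1.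
by rewrite s1 expr1n invr1 mul1e.
Qed.

(** [Imzw] does not see the vertical coordinates, so in each variable separately every one of the
    three products is plus or minus the identity, plus a constant, plus a vertical shift depending
    on the horizontal coordinates only. Such maps preserve Lebesgue measure. *)
Lemma heisenberg_geo_int (f : H -> \bar R) : measurable_fun setT f -> (forall x, 0 <= f x) ->
    [/\ forall x, \int[mu]_y f (hu x y) = \int[mu]_y f y,
        forall x, \int[mu]_y f (hv x y) = \int[mu]_y f y,
        forall z, \int[mu]_x f (hw z x) = \int[mu]_x f x
      & [/\ forall y, \int[mu]_x f (hu x y) = \int[mu]_x f x,
        forall y, \int[mu]_x f (hv x y) = \int[mu]_x f x
      & forall x, \int[mu]_z f (hw z x) = \int[mu]_z f z]].
Proof.
move=> mf f0.
have mI1 a (b : R) : measurable_fun setT (fun y : H => b + 2^-1 * Imzw a y)%R.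
  by apply: measurable_funD => //; apply: measurable_funM => //; exact: measurable_Imzw.
have mI2 a (b : R) : measurable_fun setT (fun y : H => b + 2^-1 * Imzw y a)%R.
  by apply: measurable_funD => //; apply: measurable_funM => //; exact: measurable_Imzw.
split; last split.
- move=> x; apply: (@integral_Htriangular1 (-1) (crd x) (fun y => Ht x + 2^-1 * Imzw (Hinv x) y)%R) => //.
  + by rewrite normrN normr1.
  + by move=> y y' yy'; congr (_ + _ * _)%R; exact: Imzw_eq.
  + by move=> y i ik; rewrite /hu crd_Hmul// crd_Hinv ?(ltnW ik)//; ring.
  + by move=> y; rewrite Ht_u ImzwNl; ring.
- move=> x; apply: (@integral_Htriangular1 1 (crd x) (fun y => Ht x + 2^-1 * Imzw x y)%R) => //.
  + by rewrite normr1.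
  + by move=> y y' yy'; congr (_ + _ * _)%R; exact: Imzw_eq.
  + by move=> y i ik; rewrite /hv crd_Hmul//; ring.
  + by move=> y; rewrite Ht_v; ring.
- move=> x; apply: (@integral_Htriangular1 1 (crd (Hinv x)) (fun y => Ht (Hinv x) + 2^-1 * Imzw (Hinv x) y)%R) => //.
  + by rewrite normr1.
  + by move=> y y' yy'; congr (_ + _ * _)%R; exact: Imzw_eq.
  + by move=> y i ik; rewrite /hw crd_Hmul//; ring.
  + by move=> y; rewrite /hw Ht_Hmul; ring.
- move=> x; apply: (@integral_Htriangular1 1 (crd (Hinv x)) (fun y => Ht (Hinv x) + 2^-1 * Imzw y (Hinv x))%R) => //.
  + by rewrite normr1.
  + by move=> y y' yy'; congr (_ + _ * _)%R; exact: Imzw_eq.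
  + by move=> y i ik; rewrite /hu crd_Hmul//; ring.
  + by move=> y; rewrite /hu Ht_Hmul; ring.
- move=> x; apply: (@integral_Htriangular1 1 (crd x) (fun y => Ht x + 2^-1 * Imzw y x)%R) => //.
  + by rewrite normr1.
  + by move=> y y' yy'; congr (_ + _ * _)%R; exact: Imzw_eq.
  + by move=> y i ik; rewrite /hv crd_Hmul//; ring.
  + by move=> y; rewrite Ht_v; ring.
- move=> x; apply: (@integral_Htriangular1 (-1) (crd x) (fun y => Ht x + 2^-1 * Imzw y (Hinv x))%R) => //.
  + by rewrite normrN normr1.
  + by move=> y y' yy'; congr (_ + _ * _)%R; exact: Imzw_eq.
  + by move=> y i ik; rewrite /hw crd_Hmul// crd_Hinv ?(ltnW ik)//; ring.
  + move=> y; rewrite /hw Ht_Hmul ImzwNl ImzwNr {1}/Ht crd_Hinv// /Ht; ring.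
Qed.

(** Euclidean point reflection in x. It carries x y^-1 to x y because the terms [Imzw x y] enter the
    two heights with opposite signs. *)
Let reflect x (a : H) : H := mkpt (2 * n) (fun i => 2 * crd x i - crd a i)%R.

Let hvE x y : hv x y = reflect x (hu x y).
Proof.
apply: Rn_ext => i ik; rewrite [RHS]crd_mkpt//.
move: ik; rewrite leq_eqVlt => /predU1P[->|ik].
  by have := Ht_v x y; have := Ht_u x y; rewrite /Ht => -> ->; ring.
by rewrite /hv /hu !crd_Hmul// crd_Hinv ?(ltnW ik)//; ring.
Qed.

(** Use a = x y^-1 as inner variable; then x y is the reflection of a in x, and for fixed a the map
    x -> 2 x - a has Jacobian 2^(2n+1). The resulting factor 2^-(2n+1) is bounded by 1. *)
Lemma heisenberg_geo_uv (f g : H -> \bar R) :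
    measurable_fun setT f -> (forall x, 0 <= f x)%E ->
    measurable_fun setT g -> (forall x, 0 <= g x)%E ->
    \int[mu]_x \int[mu]_y (f (hu x y) * g (hv x y))
      <= (\int[mu]_x f x) * \int[mu]_x g x.
Proof.
move=> mf f0 mg g0.
have mr : measurable_fun setT (fun z : H * H => reflect z.1 z.2).
  apply: measurable_mkpt => i; apply: measurable_funB.
    apply: measurable_funM => //.
    exact: (measurableT_comp (@measurable_crd R (2 * n) i) measurable_fst).
  exact: (measurableT_comp (@measurable_crd R (2 * n) i) measurable_snd).
pose h (z : H * H) := f z.2 * g (reflect z.1 z.2).
have mh : measurable_fun setT h.
  apply: emeasurable_funM; first exact: (measurableT_comp mf measurable_snd).
  exact: (measurableT_comp mg mr).
have h0 (z : H * H) : 0 <= h z by rewrite mule_ge0.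
have -> : \int[mu]_x \int[mu]_y (f (hu x y) * g (hv x y)) =
    \int[mu]_x \int[mu]_a h (x, a).
  apply: eq_integral => x _.
  have [|//|hint _ _ _] := @heisenberg_geo_int (fun a => h (x, a)).
    exact: (measurableT_comp mh (pair1_measurable _)).
  rewrite -(hint x).
  by apply: eq_integral => y _; rewrite /h /= hvE.
rewrite (fubini_tonelli h)//.
have E a : \int[mu]_x h (x, a) = f a * ((2 ^- (2 * n).+1)%:E * \int[mu]_x g x).
  rewrite /h /= ge0_integralZl//; last first.
    exact: (measurableT_comp mg (measurableT_comp mr (pair2_measurable _))).
  congr (_ * _).
  rewrite (@integral_Htriangular 2%R (fun i => - crd a i)%R (fun=> - Ht a)%R (reflect^~ a))//.
  - by rewrite ger0_norm.
  - by move=> y i ik; rewrite crd_mkpt// ltnW.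
  - by move=> y; rewrite /Ht crd_mkpt.
under eq_integral do rewrite E.
rewrite ge0_integralZr//; last first.
  by rewrite mule_ge0 ?integral_ge0// lee_fin invr_ge0 exprn_ge0.
apply: lee_wpmul2l; first exact: integral_ge0.
rewrite -[leRHS]mul1e; apply: lee_wpmul2r; first exact: integral_ge0.
by rewrite lee_fin invf_le1 ?exprn_ege1 ?exprn_gt0// ler1n.
Qed.

End heisenberg_integration.

(** * Volume of gauge balls *)

Section heisenberg_instance.
Variables (R : realType) (n : nat).
Hypothesis n1 : (1 <= n)%N.
Notation H := (Hn R n).
Notation mu := (Hmeas R n).
Notation Q := (Qdim R n).

Definition gauge (x : H) : R := koranyi x `^ Q.

Lemma Qdim_gt0 : 0 < Q.
Proof. by rewrite ltr0n addn2. Qed.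

Lemma ler_powR2 (r a b : R) : 0 < r -> 0 <= a -> 0 <= b -> (a `^ r <= b `^ r) = (a <= b).
Proof.
move=> r0 a0 b0; apply/idP/idP => h; last by rewrite ge0_ler_powR// ltW.
by rewrite leNgt; apply/negP => /(@gt0_ltr_powR _ r r0 b a); rewrite !nnegrE => /(_ b0 a0); rewrite ltNge h.
Qed.

Lemma gauge_leP (x : H) (s : R) : 0 <= s -> (gauge x <= s) = (koranyi x <= s `^ Q^-1).
Proof.
move=> s0; have Q0 := Qdim_gt0.
rewrite -[RHS](@ler_powR2 Q)// ?powR_ge0 ?koranyi_ge0//.
by rewrite -powRrM mulVf ?gt_eqF// powRr1.
Qed.

Lemma prod_sides (a b : R) :
  \prod_(i < (2 * n).+1) (2 * (if (i < 2 * n)%N then a else b)) =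
  (2 * a) ^+ (2 * n) * (2 * b).
Proof.
rewrite big_ord_recr/= ltnn; congr (_ * _).
rewrite (eq_bigr (fun=> 2 * a)); last by move=> i _; rewrite ltn_ord.
by rewrite prodr_const card_ord.
Qed.

Let rho (s : R) := s `^ Q^-1.

Let rhoQ s : 0 <= s -> rho s ^+ (2 * n) * rho s ^+ 2 = s.
Proof.
move=> s0; rewrite -exprD -powR_mulrn ?powR_ge0// -powRrM mulVf ?powRr1//.
by rewrite gt_eqF// Qdim_gt0.
Qed.

Lemma measurable_gauge : measurable_fun setT gauge.
Proof. exact: (measurableT_comp (@measurable_powR R Q) (@measurable_koranyi R n)). Qed.

Lemma measurable_gauge_le (s : R) : measurable [set x : H | gauge x <= s].
Proof.
rewrite -[X in measurable X]setTI.
have -> : [set x : H | gauge x <= s] = gauge @^-1` `]-oo, s]%classic.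
  by apply/seteqP; split => x /=; rewrite in_itv.
by apply: measurable_gauge.
Qed.

Lemma gauge_vol_le (s : R) : 0 < s ->
  (mu [set x | (gauge x <= s)%R] <= ((2 ^+ (2 * n).+1) * s)%:E)%E.
Proof.
move=> s0; have r0 : 0 <= rho s by exact: powR_ge0.
pose a i := if (i < 2 * n)%N then rho s else rho s ^+ 2.
have -> : (2 ^+ (2 * n).+1) * s = \prod_(i < (2 * n).+1) (2 * a i).
  by rewrite prod_sides exprMn -{1}(rhoQ (ltW s0)) exprS; ring.
rewrite -(@measure_box R (2 * n) (fun=> 0)); last first.
  by move=> i; rewrite /a; case: ifP => // _; rewrite exprn_ge0.
apply: le_measure; rewrite ?inE.
- exact: measurable_gauge_le.
- exact: measurable_box.
- move=> x /=; rewrite (gauge_leP _ (ltW s0)) => /(koranyi_bounds r0)[z t] i.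
  rewrite leq_eqVlt subr0 /a => /predU1P[->|ik]; first by rewrite ltnn.
  rewrite ik -(@ler_pXn2r _ 2) ?nnegrE// real_normK ?num_real//.
  exact: le_trans (Hre_sqr_le _ ik) z.
Qed.

Lemma gauge_vol_ge (s : R) : 0 < s ->
  (s%:E <= (n%:R ^+ (2 * n))%:E * mu [set x | (gauge x <= s)%R])%E.
Proof.
move=> s0; have r0 : 0 <= rho s by exact: powR_ge0.
have n0 : 0 < n%:R :> R by rewrite ltr0n.
(* With these half-widths both [Hz2 x] and the height are at most rho^2 / 2, so the fourth power of
   the norm is at most rho^4 / 2 and the box fits inside the ball. *)
pose a i := if (i < 2 * n)%N then rho s / (2 * n%:R) else rho s ^+ 2 / 2.
have a0 i : 0 <= a i.
  by rewrite /a; case: ifP => // _; rewrite divr_ge0 ?exprn_ge0// mulr_ge0 ?ler0n// ltW.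
have h : (mu (@box R (2 * n) (fun=> 0%R) a) <= mu [set x | (gauge x <= s)%R])%E.
  apply: le_measure; rewrite ?inE.
  - exact: measurable_box.
  - exact: measurable_gauge_le.
  - move=> x /= bx; rewrite (gauge_leP _ (ltW s0)) koranyi_leP//.
    have z : Hz2 x <= rho s ^+ 2 / 2.
      have h i : (i < 2 * n)%N -> crd x i ^+ 2 <= rho s ^+ 2 / (4 * n%:R).
        move=> ik; have := bx i (ltnW ik); rewrite subr0 /a ik.
        rewrite -(@ler_pXn2r _ 2) ?nnegrE//; last first.
          by rewrite divr_ge0// mulr_ge0.
        rewrite real_normK ?num_real// => /le_trans; apply.
        have -> : (rho s / (2 * n%:R)) ^+ 2 = rho s ^+ 2 / (4 * n%:R) * n%:R^-1.
          by field; rewrite gt_eqF.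
        rewrite ler_piMr//; first by rewrite divr_ge0 ?exprn_ge0// mulr_ge0// ler0n.
        by rewrite invf_le1// ler1n.
      apply: (@le_trans _ _ (\sum_(j < n) (rho s ^+ 2 / (4 * n%:R) + rho s ^+ 2 / (4 * n%:R)))).
        by apply: ler_sum => j _; rewrite lerD// h ?ltn_re ?ltn_im.
      rewrite sumr_const card_ord -[X in X <= _]mulr_natr.
      by rewrite le_eqVlt; apply/orP; left; apply/eqP; field; rewrite gt_eqF.
    have t : `|Ht x| <= rho s ^+ 2 / 2.
      by have := bx (2 * n)%N (leqnn _); rewrite subr0 /a ltnn.
    have z0 := Hz2_ge0 x.
    have e : 0 <= rho s ^+ 2 / 2 by rewrite divr_ge0 ?exprn_ge0.
    have h1 : Hz2 x ^+ 2 <= (rho s ^+ 2 / 2) ^+ 2 by rewrite ler_pXn2r.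
    have h2 : Ht x ^+ 2 <= (rho s ^+ 2 / 2) ^+ 2.
      by rewrite -real_normK ?num_real// ler_pXn2r.
    have -> : rho s ^+ 4 = (rho s ^+ 2 / 2) ^+ 2 * 4 by field.
    have := sqr_ge0 (rho s ^+ 2 / 2); lra.
apply: le_trans (lee_wpmul2l _ h); last by rewrite lee_fin exprn_ge0.
rewrite (@measure_box R (2 * n) (fun=> 0))// prod_sides -EFinM lee_fin.
rewrite -{1}(rhoQ (ltW s0)).
have -> : 2 * (rho s / (2 * n%:R)) = rho s / n%:R by field; rewrite gt_eqF.
rewrite expr_div_n le_eqVlt; apply/orP; left; apply/eqP; field.
by rewrite expf_neq0// gt_eqF.
Qed.

Lemma gauge_le_scale (x : H) (s : R) : 0 <= s -> koranyi x <= 33 * s `^ Q^-1 ->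
  gauge x <= 33 `^ Q * s.
Proof.
move=> s0 h; have Q0 := Qdim_gt0.
apply: (@le_trans _ _ ((33 * s `^ Q^-1) `^ Q)).
  by rewrite ler_powR2 ?koranyi_ge0// mulr_ge0// powR_ge0.
by rewrite powRM ?powR_ge0// -powRrM mulVf ?gt_eqF// powRr1.
Qed.

Lemma heisenberg_geometry : exists C, bilinear_geometry mu gauge (@hu R n) (@hv R n) (@hw R n) C.
Proof.
pose C1 : R := 2 ^+ (2 * n).+1; pose C2 : R := n%:R ^+ (2 * n); pose C3 : R := 33 `^ Q.
have C10 : 0 <= C1 by rewrite exprn_ge0.
have C20 : 0 <= C2 by rewrite exprn_ge0.
have C30 : 0 <= C3 by rewrite powR_ge0.
exists (1 + C1 + C2 + C3); split.
- by lra.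
- by move=> x; exact: powR_ge0.
- exact: measurable_gauge.
- apply: measurable_Hmul; first exact: measurable_fst.
  by apply: measurable_Hinv; exact: measurable_snd.
- by apply: measurable_Hmul; [exact: measurable_fst|exact: measurable_snd].
- apply: measurable_Hmul; last exact: measurable_snd.
  by apply: measurable_Hinv; exact: measurable_fst.
- move=> s s0; apply: (le_trans (gauge_vol_ge s0)).
  apply: lee_wpmul2r => //; rewrite lee_fin /C2; lra.
- move=> s s0; apply: (le_trans (gauge_vol_le s0)).
  rewrite -EFinM lee_fin ler_wpM2r ?(ltW s0)// -/C1; lra.
- exact: heisenberg_geo_int.
- exact: heisenberg_geo_uv.
- move=> x y s s0.
  have K z : koranyi z <= 33 * s `^ Q^-1 -> gauge z <= (1 + C1 + C2 + C3) * s.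
    move=> h; apply: (le_trans (gauge_le_scale s0 h)); rewrite ler_wpM2r// -/C3; lra.
  have G z : gauge z <= s -> koranyi z <= s `^ Q^-1 by rewrite gauge_leP.
  have [h1 h2 h3 h4 [h5 h6]] := koranyi_quasi x y (powR_ge0 s Q^-1).
  split; last split.
  + by move=> /G a /G b; have [? ?] := h1 a b; split; exact: K.
  + by move=> /G a /G b; have [? ?] := h2 a b; split; exact: K.
  + by move=> /G a /G b; have [? ?] := h3 a b; split; exact: K.
  + by move=> /G a /G b; have [? ?] := h4 a b; split; exact: K.
  + by move=> /G a /G b; have [? ?] := h5 a b; split; exact: K.
  + by move=> /G a /G b; have [? ?] := h6 a b; split; exact: K.
- move=> z x y s s0.
  have G t : gauge t <= s -> koranyi t <= s `^ Q^-1 by rewrite gauge_leP.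
  move=> /G a /G b.
  have K t : koranyi t <= 33 * s `^ Q^-1 -> gauge t <= (1 + C1 + C2 + C3) * s.
    move=> h; apply: (le_trans (gauge_le_scale s0 h)); rewrite ler_wpM2r// -/C3; lra.
  have [k1 k2] := @koranyi_w R n z x y _ (powR_ge0 s Q^-1) a b.
  by split; [exact: (K _ k1)|exact: (K _ k2)].
Qed.

End heisenberg_instance.

(** * Inequalities for integrals *)

Section tools.
Local Open Scope ereal_scope.
Context (R : realType) d (T : measurableType d) (mu : {measure set T -> \bar R}).

Lemma sqrte_amgm (t : R) (x y : \bar R) : (0 < t)%R -> 0 <= x -> 0 <= y ->
  x `^ 2^-1 * y `^ 2^-1 <= (t / 2)%:E * x + (t^-1 / 2)%:E * y.
Proof.
move=> t0; case: x => [x| |]//; case: y => [y| |]//.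
- rewrite !lee_fin => x0 y0; rewrite !powR12_sqrt//.
  have ht : (0 < t^-1)%R by rewrite invr_gt0.
  have := sqr_ge0 (Num.sqrt t * Num.sqrt x - Num.sqrt t^-1 * Num.sqrt y)%R.
  have e1 : (Num.sqrt t * Num.sqrt t^-1 = 1)%R.
    by rewrite -sqrtrM ?(ltW t0)// divff ?sqrtr1// gt_eqF.
  rewrite sqrrB !exprMn !sqr_sqrtr ?(ltW t0)// ?(ltW ht)//.
  have -> : (Num.sqrt t * Num.sqrt x * (Num.sqrt t^-1 * Num.sqrt y) =
    (Num.sqrt t * Num.sqrt t^-1) * (Num.sqrt x * Num.sqrt y))%R by ring.
  by rewrite e1; lra.
- move=> x0 _; rewrite gt0_muley ?lte_fin ?divr_gt0 ?invr_gt0//.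
  by rewrite -EFinM addey// leey.
- move=> _ y0; rewrite [X in _ <= X + _]gt0_muley ?lte_fin ?divr_gt0//.
  by rewrite -EFinM addye// leey.
- by move=> _ _; rewrite [X in _ <= X + _]gt0_muley ?lte_fin ?divr_gt0// gt0_muley ?lte_fin ?divr_gt0 ?invr_gt0//= leey.
Qed.

(** The optimal parameter is t = sqrt(b / a). When a or b is 0 no parameter is optimal, and a
    suitable finite t already refutes 0 < x. *)
Lemma le_sqrt_amgm (x a b : R) : (0 <= a)%R -> (0 <= b)%R ->
  (forall t, 0 < t -> x <= t / 2 * a + t^-1 / 2 * b)%R ->
  (x <= a `^ 2^-1 * b `^ 2^-1)%R.
Proof.
rewrite le_eqVlt => /predU1P[<-|a0].
  move=> b0 h; rewrite powR0 ?invr_neq0// mul0r leNgt; apply/negP => x0.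
  have t0 : (0 < (b + 1) / x)%R by rewrite divr_gt0// ltr_wpDl.
  have := h _ t0; rewrite mulr0 add0r invf_div.
  have : (x / (b + 1) * (b + 1) = x)%R by rewrite divfK// gt_eqF// ltr_wpDl.
  have : (0 < x / (b + 1))%R by rewrite divr_gt0// ltr_wpDl.
  set y := (x / (b + 1))%R => y0 e.
  have := mulr_ge0 (ltW y0) b0; lra.
rewrite le_eqVlt => /predU1P[<-|b0].
  move=> h; rewrite [X in (_ * X)%R]powR0 ?invr_neq0// mulr0 leNgt; apply/negP => x0.
  have t0 : (0 < x / a)%R by rewrite divr_gt0.
  have := h _ t0; rewrite mulr0 addr0.
  have -> : (x / a / 2 * a = x / 2)%R by field; rewrite gt_eqF.
  lra.
move=> h; rewrite !powR12_sqrt ?(ltW a0) ?(ltW b0)//.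
have sa : (0 < Num.sqrt a)%R by rewrite sqrtr_gt0.
have sb : (0 < Num.sqrt b)%R by rewrite sqrtr_gt0.
have := h (Num.sqrt b / Num.sqrt a)%R (divr_gt0 sb sa).
have ea := sqr_sqrtr (ltW a0); have eb := sqr_sqrtr (ltW b0).
move: sa sb ea eb; set s := Num.sqrt a; set r := Num.sqrt b => sa sb <- <-.
suff -> : (r / s / 2 * s ^+ 2 + (r / s)^-1 / 2 * r ^+ 2 = s * r)%R by [].
by field; rewrite !gt_eqF.
Qed.

Lemma cauchy_schwarz (f g : T -> \bar R) :
  measurable_fun setT f -> (forall x, 0 <= f x) ->
  measurable_fun setT g -> (forall x, 0 <= g x) ->
  \int[mu]_x f x < +oo -> \int[mu]_x g x < +oo ->
  \int[mu]_x (f x `^ 2^-1 * g x `^ 2^-1) <=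
    (\int[mu]_x f x) `^ 2^-1 * (\int[mu]_x g x) `^ 2^-1.
Proof.
move=> mf f0 mg g0 foo goo.
have If : 0 <= \int[mu]_x f x by exact: integral_ge0.
have Ig : 0 <= \int[mu]_x g x by exact: integral_ge0.
have mp (h : T -> \bar R) : measurable_fun setT h -> measurable_fun setT (fun x => h x `^ 2^-1).
  by move=> mh; exact: (measurableT_comp (@measurable_poweR R 2^-1) mh).
have H (t : R) : (0 < t)%R -> \int[mu]_x (f x `^ 2^-1 * g x `^ 2^-1) <=
    (t / 2)%:E * \int[mu]_x f x + (t^-1 / 2)%:E * \int[mu]_x g x.
  move=> t0.
  have t2 : 0 <= (t / 2)%:E by rewrite lee_fin divr_ge0// ltW.
  have t2' : 0 <= (t^-1 / 2)%:E by rewrite lee_fin divr_ge0 ?invr_ge0// ltW.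
  rewrite -!ge0_integralZl// -ge0_integralD//; last 4 first.
  - by move=> x _; rewrite mule_ge0.
  - exact: measurable_funeM.
  - by move=> x _; rewrite mule_ge0.
  - exact: measurable_funeM.
  apply: ge0_le_integral => //.
  - by move=> x _; rewrite mule_ge0 ?poweR_ge0.
  - by apply: emeasurable_funM; exact: mp.
  - by apply: emeasurable_funD; exact: measurable_funeM.
  - by move=> x _; exact: sqrte_amgm.
have finf : \int[mu]_x f x \is a fin_num by rewrite ge0_fin_numE.
have fing : \int[mu]_x g x \is a fin_num by rewrite ge0_fin_numE.
have fin : \int[mu]_x (f x `^ 2^-1 * g x `^ 2^-1) \is a fin_num.
  rewrite ge0_fin_numE; last by apply: integral_ge0 => x _; rewrite mule_ge0 ?poweR_ge0.
  apply: le_lt_trans (H _ ltr01) _.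
  by rewrite -(fineK finf) -(fineK fing) -!EFinM -EFinD ltry.
move: H If Ig; rewrite -(fineK fin) -(fineK finf) -(fineK fing).
set x := fine _; set a := fine _; set b := fine _.
rewrite !lee_fin => H a0 b0.
apply: le_sqrt_amgm => //.
Qed.

(** Converse of Hoelder's inequality. The extremal test function needs a finite nonzero norm, so phi
    is first cut at height n and restricted to [D_ n]; monotone convergence removes the cut. *)
Lemma duality (phi : T -> \bar R) (D_ : (set T)^nat) (p K : R) : (1 < p)%R ->
  (0 <= K)%R -> measurable_fun setT phi -> (forall x, 0 <= phi x) ->
  (forall n, measurable (D_ n)) -> (forall n, mu (D_ n) < +oo) ->
  nondecreasing_seq D_ -> (forall x, exists n, D_ n x) ->
  (forall h : T -> R, measurable_fun setT h -> (forall x, 0 <= h x)%R ->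
    \int[mu]_x (h x `^ (p / (p - 1)))%:E <= 1 ->
    \int[mu]_x (phi x * (h x)%:E) <= K%:E) ->
  \int[mu]_x (phi x `^ p) <= (K `^ p)%:E.
Proof.
move=> p1 K0 mphi phi0 mD Doo ndD DT hK.
have p0 : (0 < p)%R by lra.
pose f n x : R := (fine (mine (phi x) n%:R%:E) * \1_(D_ n) x)%R.
have minfin n x : mine (phi x) n%:R%:E \is a fin_num.
  rewrite ge0_fin_numE; first by rewrite gt_min ltry orbT.
  by rewrite le_min phi0 lee_fin ler0n.
have fE n x : (f n x)%:E = mine (phi x) n%:R%:E * (\1_(D_ n) x)%:E.
  by rewrite /f EFinM fineK.
have f0 n x : (0 <= f n x)%R.
  by rewrite /f mulr_ge0// fine_ge0// le_min phi0 lee_fin ler0n.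
have mf n : measurable_fun setT (f n).
  apply: measurable_funM; last exact: measurable_indic.
  apply: (measurableT_comp (fine_measurable measurableT)).
  by apply: measurable_mine.
have fphi n x : (f n x)%:E <= phi x.
  rewrite fE indicE; case: (_ \in _); rewrite ?mule1 ?mule0//.
  by rewrite ge_min lexx.
have fn n x : (f n x <= n%:R * \1_(D_ n) x)%R.
  by rewrite -lee_fin fE EFinM; apply: lee_wpmul2r; rewrite ?lee_fin// ge_min lexx orbT.
have mfp n (r : R) : measurable_fun setT (fun x => f n x `^ r)%R.
  by apply: (measurableT_comp (@measurable_powR R r)).
have X n : \int[mu]_x (f n x `^ p)%:E <= (K `^ p)%:E.
  have Xoo : \int[mu]_x (f n x `^ p)%:E < +oo.
    apply: (@le_lt_trans _ _ (\int[mu]_x ((n%:R `^ p)%:E * (\1_(D_ n) x)%:E))).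
      apply: ge0_le_integral => //.
      - by move=> x _; rewrite lee_fin powR_ge0.
      - exact/measurable_EFinP.
      - by apply: measurable_funeM; exact/measurable_EFinP/measurable_indic.
      - move=> x _; rewrite -EFinM lee_fin.
        apply: (@le_trans _ _ ((n%:R * \1_(D_ n) x) `^ p)%R).
          by apply: ge0_ler_powR; rewrite ?(ltW p0) ?nnegrE ?f0 ?fn ?mulr_ge0//.
        rewrite powRM// indicE; case: (_ \in _); rewrite ?powR1//.
        by rewrite powR0 ?gt_eqF.
    rewrite ge0_integralZl_EFin ?powR_ge0//; last exact/measurable_EFinP/measurable_indic.
    by rewrite integral_indic// setIT lte_mul_pinfty// lee_fin powR_ge0.
  have [X0|X0] := eqVneq (\int[mu]_x (f n x `^ p)%:E) 0.
    by rewrite X0 lee_fin powR_ge0.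
  have Xge : 0 <= \int[mu]_x (f n x `^ p)%:E.
    by apply: integral_ge0 => x _; rewrite lee_fin powR_ge0.
  have Xfin : \int[mu]_x (f n x `^ p)%:E \is a fin_num by rewrite ge0_fin_numE.
  move: Xge X0; rewrite -(fineK Xfin); set a := fine _ => a0 a1.
  have {a0 a1}a0 : (0 < a)%R by rewrite lt_neqAle -lee_fin a0 andbT eq_sym -eqe.
  pose q := (p / (p - 1))%R.
  have q0 : (0 < q)%R by rewrite divr_gt0//; lra.
  (* The extremal function of Hoelder's inequality, normalised in L^q; pairing it with f_n returns
     the L^p norm a^(1/p). *)
  pose h x := (f n x `^ (p - 1) * a `^ (- q^-1))%R.
  have hf x : (h x `^ q = f n x `^ p * a^-1)%R.
    rewrite /h powRM ?powR_ge0// -!powRrM mulNr mulVf ?gt_eqF// powR_inv1 ?ltW//.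
    by rewrite mulrCA divff ?mulr1// gt_eqF//; lra.
  have h1 : \int[mu]_x (h x `^ q)%:E <= 1.
    under eq_integral do rewrite hf EFinM.
    rewrite ge0_integralZr//; last 3 first.
    - exact/measurable_EFinP.
    - by move=> x _; rewrite lee_fin powR_ge0.
    - by rewrite lee_fin invr_ge0 ltW.
    by rewrite -(fineK Xfin) -/a -EFinM divff// gt_eqF.
  have mh : measurable_fun setT h by apply: measurable_funM => //; exact: mfp.
  have h0 x : (0 <= h x)%R by rewrite /h mulr_ge0 ?powR_ge0.
  have := hK h mh h0 h1.
  have : (a `^ p^-1)%:E <= \int[mu]_x (phi x * (h x)%:E).
    apply: (@le_trans _ _ (\int[mu]_x ((f n x `^ p)%:E * (a `^ (- q^-1))%:E))).
      rewrite ge0_integralZr//; last 3 first.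
      - exact/measurable_EFinP.
      - by move=> x _; rewrite lee_fin powR_ge0.
      - by rewrite lee_fin powR_ge0.
      rewrite -(fineK Xfin) -/a -EFinM lee_fin -{2}(powRr1 (ltW a0)).
      rewrite -powRD; last by rewrite (gt_eqF a0) implybT.
      suff -> : (1 - q^-1 = p^-1)%R by [].
      by rewrite /q; field; rewrite !gt_eqF//; lra.
    apply: ge0_le_integral => //.
    - by move=> x _; rewrite mule_ge0 ?lee_fin ?powR_ge0.
    - by apply: emeasurable_funM => //; exact/measurable_EFinP.
    - by apply: emeasurable_funM => //; exact/measurable_EFinP.
    - move=> x _; rewrite -EFinM -(mulr_powRB1 (f0 n x) p0) -mulrA EFinM.
      by apply: lee_wpmul2r; [rewrite lee_fin; exact: h0|exact: fphi].
  move=> /le_trans/[apply]; rewrite lee_fin => aK.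
  rewrite lee_fin; apply: (@le_trans _ _ ((a `^ p^-1) `^ p)%R).
    by rewrite -powRrM mulVf ?gt_eqF// powRr1// ltW.
  by rewrite ge0_ler_powR ?nnegrE ?powR_ge0// ltW.
(* At a point of finite value the truncations are eventually constant; where phi is infinite they
   equal n eventually and diverge. *)
have cv x : (f n x `^ p)%:E @[n --> \oo] --> phi x `^ p.
  have [N DN] := DT x.
  have [phioo|phifin] := eqVneq (phi x) +oo.
    rewrite phioo poweRyr ?gt_eqF//; apply/cvgeyPge => A.
    near=> n.
    have Dn : \1_(D_ n) x = 1%R :> R.
      rewrite indicE mem_set//; suff : D_ N `<=` D_ n by apply.
      by apply/subsetPset/ndD; near: n; exists N.
    rewrite /f Dn mulr1 phioo min_r ?leey//= lee_fin.
    apply: (@le_trans _ _ ((`|A| `^ p^-1) `^ p)%R).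
      by rewrite -powRrM mulVf ?gt_eqF// powRr1// ler_norm.
    rewrite ge0_ler_powR ?nnegrE ?powR_ge0 ?(ltW p0)//.
    near: n; exists (Num.truncn (`|A| `^ p^-1)%R).+1 => // n /= ln.
    by rewrite ltW// (lt_le_trans (truncnS_gt _))// ler_nat.
  have pf : phi x \is a fin_num by rewrite ge0_fin_numE// lt_neqAle phifin leey.
  apply: cvg_near_cst; near=> n.
  have Dn : \1_(D_ n) x = 1%R :> R.
    rewrite indicE mem_set//; suff : D_ N `<=` D_ n by apply.
    by apply/subsetPset/ndD; near: n; exists N.
  rewrite /f Dn mulr1 min_l; first by rewrite -poweR_EFin fineK.
  rewrite -(fineK pf) lee_fin.
  near: n; exists (Num.truncn (fine (phi x))).+1 => // n /= ln.
  by rewrite ltW// (lt_le_trans (truncnS_gt _))// ler_nat.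
have <- : limn (fun n => \int[mu]_x (f n x `^ p)%:E) = \int[mu]_x (phi x `^ p).
  apply/cvg_lim => //.
  have -> : \int[mu]_x (phi x `^ p) = \int[mu]_x limn (fun n => (f n x `^ p)%:E).
    by apply: eq_integral => x _; apply/esym/cvg_lim.
  apply: cvg_monotone_convergence => //.
  - by move=> n; exact/measurable_EFinP.
  - by move=> n x _; rewrite lee_fin powR_ge0.
  - move=> x _ m n mn; rewrite lee_fin ge0_ler_powR ?nnegrE ?(ltW p0)//.
    rewrite -lee_fin !fE; apply: lee_pmul.
    + by rewrite le_min phi0 lee_fin ler0n.
    + by rewrite lee_fin.
    + rewrite le_min ge_min lexx/= ge_min; apply/orP; right.
      by rewrite lee_fin ler_nat.
    + rewrite lee_fin !indicE; case: (boolP (x \in D_ m)) => // /set_mem xm.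
      rewrite mem_set//; suff : D_ m `<=` D_ n by apply.
      exact/subsetPset/ndD.
apply: lime_le; last by apply: nearW.
apply: ereal_nondecreasing_is_cvgn => m n mn; apply: ge0_le_integral => //.
- by move=> x _; rewrite lee_fin powR_ge0.
- exact/measurable_EFinP.
- exact/measurable_EFinP.
- move=> x _; rewrite lee_fin ge0_ler_powR ?nnegrE ?(ltW p0)//.
  rewrite -lee_fin !fE; apply: lee_pmul.
  + by rewrite le_min phi0 lee_fin ler0n.
  + by rewrite lee_fin.
  + rewrite le_min ge_min lexx/= ge_min; apply/orP; right.
    by rewrite lee_fin ler_nat.
  + rewrite lee_fin !indicE; case: (boolP (x \in D_ m)) => // /set_mem xm.
    rewrite mem_set//; suff : D_ m `<=` D_ n by apply.
    exact/subsetPset/ndD.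
Unshelve. all: by end_near.
Qed.

End tools.

(** * Estimates for indicator functions *)

Section set_estimates.
Local Open Scope ereal_scope.
Context (R : realType) d (T : measurableType d)
  (mu : {sigma_finite_measure set T -> \bar R}) (M : T -> R)
  (u v w : T -> T -> T) (C : R) (G : bilinear_geometry mu M u v w C).

Definition biform (f g k : T -> R) (x : T) : \bar R :=
  \int[mu]_y (f (u x y) * g (v x y) * k y)%:E.

Section form_measurability.
Variables (f g k : T -> R).
Hypotheses (mf : measurable_fun setT f) (mg : measurable_fun setT g)
  (mk : measurable_fun setT k).

Lemma measurable_biform_integrand2 :
  measurable_fun setT (fun z : T * T => (f (u z.1 z.2) * g (v z.1 z.2) * k z.2)%:E).
Proof.
apply/measurable_EFinP; apply: measurable_funM; first apply: measurable_funM.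
- exact: (measurableT_comp mf (geo_mu G)).
- exact: (measurableT_comp mg (geo_mv G)).
- exact: (measurableT_comp mk measurable_snd).
Qed.

Lemma measurable_biform_integrand x :
  measurable_fun setT (fun y => (f (u x y) * g (v x y) * k y)%:E).
Proof. exact: (measurableT_comp measurable_biform_integrand2 (pair1_measurable x)). Qed.

Hypotheses (f0 : forall x, (0 <= f x)%R) (g0 : forall x, (0 <= g x)%R)
  (k0 : forall x, (0 <= k x)%R).

Lemma measurable_biform : measurable_fun setT (biform f g k).
Proof.
apply: (measurable_fun_fubini_tonelli_F _ measurable_biform_integrand2) => z.
by rewrite lee_fin !mulr_ge0.
Qed.

Lemma biform_ge0 x : 0 <= biform f g k x.
Proof. by apply: integral_ge0 => y _; rewrite lee_fin !mulr_ge0. Qed.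

End form_measurability.

Lemma biform_le (f g k f' g' k' : T -> R) x :
  measurable_fun setT f -> measurable_fun setT g -> measurable_fun setT k ->
  measurable_fun setT f' -> measurable_fun setT g' -> measurable_fun setT k' ->
  (forall x, (0 <= f x)%R) -> (forall x, (0 <= g x)%R) -> (forall x, (0 <= k x)%R) ->
  (forall x, (f x <= f' x)%R) -> (forall x, (g x <= g' x)%R) -> (forall x, (k x <= k' x)%R) ->
  biform f g k x <= biform f' g' k' x.
Proof.
move=> mf mg mk mf' mg' mk' f0 g0 k0 ff gg kk; apply: ge0_le_integral => //.
- by move=> y _; rewrite lee_fin !mulr_ge0.
- exact: measurable_biform_integrand.
- exact: measurable_biform_integrand.
- by move=> y _; rewrite lee_fin !ler_pM ?mulr_ge0.
Qed.

Lemma indic_ge0 (A : set T) x : (0 <= \1_A x :> R)%R.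
Proof. by rewrite indicE. Qed.

Lemma indic_le1 (A : set T) x : (\1_A x <= 1 :> R)%R.
Proof. by rewrite indicE; case: (_ \in _). Qed.

Let mind (A : set T) : measurable A -> measurable_fun setT (\1_A : T -> R).
Proof. by move=> mA; exact: measurable_indic. Qed.

Let minde (A : set T) : measurable A -> measurable_fun setT (fun x => (\1_A x : R)%:E).
Proof. by move=> mA; apply/measurable_EFinP; exact: measurable_indic. Qed.

Let int_indic (A : set T) : measurable A -> \int[mu]_x (\1_A x)%:E = mu A.
Proof. by move=> mA; rewrite integral_indic// setIT. Qed.

Lemma measurable_gauge_ball (s : R) : measurable [set x | (M x <= s)%R].
Proof.
rewrite -[X in measurable X]setTI.
have -> : [set x | (M x <= s)%R] = M @^-1` `]-oo, s]%classic.
  by apply/seteqP; split => x /=; rewrite in_itv.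
by apply: (geo_mM G).
Qed.

Variables (E F B : set T).
Hypotheses (mE : measurable E) (mF : measurable F) (mB : measurable B).

Let lam := biform \1_E \1_F \1_B.

Let mi2 (f : T -> R) (g : T * T -> T) : measurable_fun setT f -> measurable_fun setT g ->
  measurable_fun setT (fun z => (f (g z))%:E).
Proof. by move=> mf mg; apply/measurable_EFinP; exact: (measurableT_comp mf mg). Qed.

(** Drop two of the three indicators and use invariance of the measure under u x or v x for the
    remaining one. *)
Lemma lam_sup x : [/\ lam x <= mu E, lam x <= mu F & lam x <= mu B].
Proof.
have lin : measurable_fun setT (fun y => (\1_E (u x y) * \1_F (v x y) * \1_B y)%:E : \bar R).
  by apply: measurable_biform_integrand; exact: mind.
have l0 y : 0 <= (\1_E (u x y) * \1_F (v x y) * \1_B y)%:E :> \bar R.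
  by rewrite lee_fin !mulr_ge0 ?indic_ge0.
have [iu iv _ _] := geo_int G (minde mE) (fun x => indic_ge0 E x).
have [iu' iv' _ _] := geo_int G (minde mF) (fun x => indic_ge0 F x).
split.
- rewrite -(int_indic mE) -(iu x); apply: ge0_le_integral => //.
  + exact: (measurableT_comp (minde mE) (measurableT_comp (geo_mu G) (pair1_measurable x))).
  + by move=> y _; rewrite lee_fin -mulrA ler_piMr ?mulr_ile1 ?indic_ge0 ?indic_le1.
- rewrite -(int_indic mF) -(iv' x); apply: ge0_le_integral => //.
  + exact: (measurableT_comp (minde mF) (measurableT_comp (geo_mv G) (pair1_measurable x))).
  + by move=> y _; rewrite lee_fin mulrAC ler_piMl ?mulr_ile1 ?indic_ge0 ?indic_le1.
- rewrite -(int_indic mB); apply: ge0_le_integral => //.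
  + exact: minde.
  + by move=> y _; rewrite lee_fin ler_piMl ?mulr_ile1 ?indic_ge0 ?indic_le1.
Qed.

Let lam2 z : \bar R := (\1_E (u z.1 z.2) * \1_F (v z.1 z.2) * \1_B z.2)%:E.

Let mlam2 : measurable_fun setT lam2.
Proof. by apply: measurable_biform_integrand2; exact: mind. Qed.

Let lam20 z : 0 <= lam2 z.
Proof. by rewrite lee_fin !mulr_ge0 ?indic_ge0. Qed.

Let lam_L1_aux (g : T * T -> T) (A : set T) : measurable A ->
  measurable_fun setT g -> (forall y, \int[mu]_x (\1_A (g (x, y)))%:E = mu A) ->
  (forall z, lam2 z <= (\1_A (g z) * \1_B z.2)%:E) ->
  \int[mu]_x lam x <= mu A * mu B.
Proof.
move=> mA mg ig le2.
have mAB : measurable_fun setT (fun z : T * T => (\1_A (g z) * \1_B z.2 : R)%:E).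
  apply/measurable_EFinP; apply: measurable_funM.
    exact: (measurableT_comp (mind mA) mg).
  exact: (measurableT_comp (mind mB) measurable_snd).
have AB0 z : 0 <= (\1_A (g z) * \1_B z.2 : R)%:E.
  by rewrite lee_fin mulr_ge0 ?indic_ge0.
apply: (@le_trans _ _ (\int[mu]_x \int[mu]_y (\1_A (g (x, y)) * \1_B y : R)%:E)).
  apply: ge0_le_integral => //.
  - by move=> x _; apply: integral_ge0 => y _; exact: (lam20 (x, y)).
  - exact: (measurable_fun_fubini_tonelli_F lam2 mlam2 lam20).
  - exact: (measurable_fun_fubini_tonelli_F _ mAB AB0).
  - move=> x _; apply: ge0_le_integral => //.
    + exact: (measurableT_comp mlam2 (pair1_measurable x)).
    + exact: (measurableT_comp mAB (pair1_measurable x)).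
    + by move=> y _; exact: (le2 (x, y)).
rewrite (fubini_tonelli (fun z => (\1_A (g z) * \1_B z.2 : R)%:E))//=.
have H y : \int[mu]_x (\1_A (g (x, y)) * \1_B y : R)%:E = mu A * (\1_B y)%:E.
  under eq_integral do rewrite EFinM.
  rewrite ge0_integralZr ?lee_fin ?indic_ge0//; first by rewrite ig.
  exact: (measurableT_comp (minde mA) (measurableT_comp mg (pair2_measurable y))).
under eq_integral do rewrite H.
rewrite ge0_integralZl//; first by rewrite int_indic.
exact: minde.
Qed.

(** Drop one indicator. When B is kept, Tonelli and invariance in x factor the integral; the pair E,
    F is [geo_uv]. *)
Lemma lam_L1 : [/\ \int[mu]_x lam x <= mu E * mu B, \int[mu]_x lam x <= mu F * mu B
   & \int[mu]_x lam x <= mu E * mu F].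
Proof.
have [_ _ _ [iu _ _]] := geo_int G (minde mE) (fun x => indic_ge0 E x).
have [_ _ _ [_ iv _]] := geo_int G (minde mF) (fun x => indic_ge0 F x).
split.
- apply: (lam_L1_aux mE (geo_mu G)) => [y|z]; first by rewrite iu int_indic.
  by rewrite lee_fin mulrAC ler_piMr ?mulr_ge0 ?indic_ge0 ?indic_le1.
- apply: (lam_L1_aux mF (geo_mv G)) => [y|z]; first by rewrite iv int_indic.
  by rewrite lee_fin -mulrA ler_piMl ?mulr_ge0 ?indic_ge0 ?indic_le1.
- have mEF : measurable_fun setT (fun z : T * T => (\1_E (u z.1 z.2))%:E * (\1_F (v z.1 z.2))%:E : \bar R).
    apply: emeasurable_funM; first exact: (mi2 (mind mE) (geo_mu G)).
    exact: (mi2 (mind mF) (geo_mv G)).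
  have EF0 z : 0 <= (\1_E (u z.1 z.2))%:E * (\1_F (v z.1 z.2))%:E :> \bar R.
    by rewrite mule_ge0 ?lee_fin ?indic_ge0.
  have := geo_uv G (minde mE) (fun x => indic_ge0 E x) (minde mF) (fun x => indic_ge0 F x).
  rewrite (int_indic mE) (int_indic mF); apply: le_trans.
  apply: ge0_le_integral => //.
  + by move=> x _; apply: integral_ge0 => y _; exact: (lam20 (x, y)).
  + exact: (measurable_fun_fubini_tonelli_F lam2 mlam2 lam20).
  + exact: (measurable_fun_fubini_tonelli_F _ mEF EF0).
  + move=> x _; apply: ge0_le_integral => //.
    * exact: (measurableT_comp mlam2 (pair1_measurable x)).
    * exact: (measurableT_comp mEF (pair1_measurable x)).
    * by move=> y _; rewrite -EFinM lee_fin ler_piMr ?mulr_ge0 ?indic_ge0 ?indic_le1.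
Qed.

Let ball (s : R) := [set x | (M x <= s)%R].

Let mwz (A : set T) (z : T) : measurable A -> measurable_fun setT (fun x => (\1_A (w z x) : R)%:E).
Proof.
by move=> mA; exact: (measurableT_comp (mi2 (mind mA) (geo_mw G)) (pair1_measurable z)).
Qed.

(** Indicator, in a, of the part of A lying in the ball of size s moved to the centre z. *)
Let conc (A : set T) (s : R) (z a : T) : \bar R := (\1_A a)%:E * (\1_(ball s) (w z a))%:E.

Let mconc A s : measurable A -> measurable_fun setT (fun p : T * T => conc A s p.1 p.2).
Proof.
move=> mA; apply: emeasurable_funM; first exact: (mi2 (mind mA) measurable_snd).
exact: (mi2 (mind (measurable_gauge_ball s)) (geo_mw G)).
Qed.

Let conc0 A s z a : 0 <= conc A s z a.
Proof. by rewrite mule_ge0 ?lee_fin ?indic_ge0. Qed.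

(** Every point of A lies in the moved ball for a set of centres z of measure mu (ball s). *)
Let int_conc A s : measurable A ->
  \int[mu]_z \int[mu]_a conc A s z a = mu A * mu (ball s).
Proof.
move=> mA; rewrite (fubini_tonelli (fun p => conc A s p.1 p.2)) => [|//|[? ?]]; last 2 first.
- exact: mconc.
- exact: conc0.
have H a : \int[mu]_z conc A s z a = (\1_A a)%:E * mu (ball s).
  rewrite /conc ge0_integralZl//; last first.
    exact: (measurableT_comp (mi2 (mind (measurable_gauge_ball s)) (geo_mw G)) (pair2_measurable a)).
  have [_ _ _ [_ _ iw]] := geo_int G (minde (measurable_gauge_ball s)) (fun x => indic_ge0 _ x).
  by rewrite iw int_indic//; exact: measurable_gauge_ball.
under eq_integral do rewrite H.
rewrite ge0_integralZr//; last exact: minde.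
by rewrite int_indic.
Qed.

Let sqrt_indic (A : set T) x : (\1_A x : R)%:E `^ 2^-1 = (\1_A x)%:E.
Proof.
by rewrite indicE; case: (_ \in _); rewrite poweR_EFin ?powR1// powR0// invr_neq0.
Qed.

(** If x is within s of z and y within s of the identity, then x y^-1 and x y are within C s of z.
    Near z the form thus sees only the parts of E and F near z. *)
Let sum_indic_ball s (z x y : T) : (0 <= s)%R -> B = ball s ->
  ((\1_(ball s) (w z x))%:E * lam2 (x, y) <=
    conc E (C * s) z (u x y) * conc F (C * s) z (v x y)).
Proof.
move=> s0 Bs; rewrite /lam2 /= Bs /conc -!EFinM lee_fin !indicE.
case: (boolP (w z x \in ball s)) => [/set_mem h1|_]; last first.
  by rewrite mul0r !mulr_ge0.
case: (boolP (y \in ball s)) => [/set_mem h2|_]; last by rewrite !mulr0 !mulr_ge0.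
have [k1 k2] := geo_w G s0 h1 h2.
by rewrite [w z (u x y) \in _]mem_set// [w z (v x y) \in _]mem_set// !mul1r !mulr1.
Qed.

Let conc_le A s z : measurable A -> \int[mu]_a conc A s z a <= mu A.
Proof.
move=> mA; rewrite -(int_indic mA); apply: ge0_le_integral => //.
- exact: (measurableT_comp (mconc s mA) (pair1_measurable z)).
- exact: minde.
- by move=> a _; rewrite /conc -EFinM lee_fin ler_piMr ?indic_ge0 ?indic_le1.
Qed.

(* Averaging over the translates z B of the ball B: on each of them the square
   root is controlled by the L^1 norm, which localizes both E and F. *)
Lemma lam_half (s : R) : (0 < s)%R -> B = ball s -> mu E < +oo -> mu F < +oo ->
  s%:E * \int[mu]_x (lam x `^ 2^-1) <=
  C%:E * (mu B `^ 2^-1 * ((mu E * mu (ball (C * s))) `^ 2^-1 *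
    (mu F * mu (ball (C * s))) `^ 2^-1)).
Proof.
move=> s0 Bs Eoo Foo.
have C0 : (0 < C)%R by exact: lt_le_trans (geo_C1 G).
have Cs0 : (0 < C * s)%R by rewrite mulr_gt0.
have ballfin t : (0 < t)%R -> mu (ball t) < +oo.
  by move=> t0; apply: (le_lt_trans (geo_vol_le G t0)); rewrite -EFinM ltry.
have Boo : mu B < +oo by rewrite Bs ballfin.
have mlam : measurable_fun setT lam.
  by apply: measurable_biform; [exact: mind..|exact: indic_ge0|exact: indic_ge0|exact: indic_ge0].
have lam0 x : 0 <= lam x by apply: biform_ge0; exact: indic_ge0.
have mlamh : measurable_fun setT (fun x => lam x `^ 2^-1).
  exact: (measurableT_comp (@measurable_poweR R 2^-1) mlam).
have int0 : 0 <= \int[mu]_x (lam x `^ 2^-1).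
  by apply: integral_ge0 => x _; exact: poweR_ge0.
(* The volume s is replaced by mu B, which is what an integral over the centres z produces. *)
apply: (@le_trans _ _ (C%:E * (mu B * \int[mu]_x (lam x `^ 2^-1)))).
  by rewrite muleA; apply: lee_wpmul2r => //; rewrite Bs; exact: (geo_vol_ge G s0).
apply: lee_wpmul2l; first by rewrite lee_fin ltW.
have mw2 : measurable_fun setT (fun p : T * T => (lam p.1 `^ 2^-1) * (\1_B (w p.2 p.1) : R)%:E).
  apply: emeasurable_funM; first exact: (measurableT_comp mlamh measurable_fst).
  apply: (mi2 (mind mB)).
  exact: (measurableT_comp (geo_mw G) (@measurable_swap _ _ T T)).
have w20 (p : T * T) : 0 <= (lam p.1 `^ 2^-1) * (\1_B (w p.2 p.1) : R)%:E.
  by rewrite mule_ge0 ?poweR_ge0// lee_fin indic_ge0.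
have -> : mu B * \int[mu]_x (lam x `^ 2^-1) =
    \int[mu]_z \int[mu]_x (lam x `^ 2^-1 * (\1_B (w z x))%:E).
  rewrite -(fubini_tonelli (fun p : T * T => (lam p.1 `^ 2^-1) * (\1_B (w p.2 p.1) : R)%:E))//=.
  rewrite muleC -ge0_integralZr//; last by move=> x _; exact: poweR_ge0.
  apply: eq_integral => x _.
  rewrite ge0_integralZl ?poweR_ge0//; last first.
    exact: (measurableT_comp (mi2 (mind mB) (geo_mw G)) (pair2_measurable x)).
  have [_ _ _ [_ _ iw]] := geo_int G (minde mB) (fun x => indic_ge0 B x).
  by rewrite iw int_indic.
have mcE := mconc (C * s) mE; have mcF := mconc (C * s) mF.
pose e z := \int[mu]_a conc E (C * s) z a.
pose f z := \int[mu]_a conc F (C * s) z a.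
have e0 z : 0 <= e z by apply: integral_ge0 => a _; exact: conc0.
have f0 z : 0 <= f z by apply: integral_ge0 => a _; exact: conc0.
have me : measurable_fun setT e.
  exact: (measurable_fun_fubini_tonelli_F _ mcE (fun p => conc0 E (C * s) p.1 p.2)).
have mf : measurable_fun setT f.
  exact: (measurable_fun_fubini_tonelli_F _ mcF (fun p => conc0 F (C * s) p.1 p.2)).
(* Cauchy-Schwarz in the centre z: the local masses e and f of E and F have total integrals mu E and
   mu F times the volume of the enlarged ball. *)
have ef : \int[mu]_z (e z `^ 2^-1 * f z `^ 2^-1) <=
    (mu E * mu (ball (C * s))) `^ 2^-1 * (mu F * mu (ball (C * s))) `^ 2^-1.
  rewrite -!int_conc//; apply: cauchy_schwarz => //.
    by rewrite /e int_conc// lte_mul_pinfty// ?ge0_fin_numE// ballfin.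
  by rewrite /f int_conc// lte_mul_pinfty// ?ge0_fin_numE// ballfin.
apply: (@le_trans _ _ (\int[mu]_z (mu B `^ 2^-1 * (e z `^ 2^-1 * f z `^ 2^-1)))); last first.
  rewrite ge0_integralZl//.
  - by apply: lee_wpmul2l => //; exact: poweR_ge0.
  - by apply: emeasurable_funM; apply: (measurableT_comp (@measurable_poweR R 2^-1)).
  - by move=> z _; rewrite mule_ge0 ?poweR_ge0.
  - exact: poweR_ge0.
apply: ge0_le_integral => //.
- by move=> z _; apply: integral_ge0 => x _; exact: (w20 (x, z)).
- exact: (measurable_fun_fubini_tonelli_G _ mw2 w20).
- apply: measurable_funeM; apply: emeasurable_funM;
    by apply: (measurableT_comp (@measurable_poweR R 2^-1)).
move=> z _.
(* [lam] restricted to the translate zB. Its integral is at most e z * f z by [geo_uv] applied to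
   the localized indicators. *)
pose g x := (\1_B (w z x))%:E * lam x.
have mg : measurable_fun setT g by apply: emeasurable_funM => //; exact: mwz.
have g0 x : 0 <= g x by rewrite mule_ge0 ?lee_fin ?indic_ge0.
have gef : \int[mu]_x g x <= e z * f z.
  have mc A : measurable A -> measurable_fun setT (conc A (C * s) z).
    by move=> mA; exact: (measurableT_comp (mconc (C * s) mA) (pair1_measurable z)).
  apply: le_trans (geo_uv G (mc E mE) (conc0 E (C * s) z) (mc F mF) (conc0 F (C * s) z)).
  have mcc : measurable_fun setT (fun p : T * T => conc E (C * s) z (u p.1 p.2) * conc F (C * s) z (v p.1 p.2)).
    apply: emeasurable_funM.
      exact: (measurableT_comp (mc E mE) (geo_mu G)).
    exact: (measurableT_comp (mc F mF) (geo_mv G)).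
  have cc0 (p : T * T) : 0 <= conc E (C * s) z (u p.1 p.2) * conc F (C * s) z (v p.1 p.2).
    by rewrite mule_ge0 ?conc0.
  apply: ge0_le_integral => //.
    exact: (measurable_fun_fubini_tonelli_F _ mcc cc0).
  move=> x _; rewrite /g /lam /biform -ge0_integralZl ?lee_fin ?indic_ge0//; last first.
    exact: (measurableT_comp mlam2 (pair1_measurable x)).
  apply: ge0_le_integral => //.
  - by apply: measurable_funeM; exact: (measurableT_comp mlam2 (pair1_measurable x)).
  - exact: (measurableT_comp mcc (pair1_measurable x)).
  - by move=> y _; have := sum_indic_ball z x y (ltW s0) Bs; rewrite -Bs.
have goo : \int[mu]_x g x < +oo.
  apply: (le_lt_trans gef); rewrite lte_mul_pinfty// ?ge0_fin_numE//.
    by apply: (le_lt_trans (conc_le (C * s) z mE)).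
  by apply: (le_lt_trans (conc_le (C * s) z mF)).
rewrite -poweRM//.
(* Cauchy-Schwarz on zB, whose measure is mu B: this is the passage from the square root to the L^1
   norm. *)
apply: (@le_trans _ _ (mu B `^ 2^-1 * (\int[mu]_x g x) `^ 2^-1)); last first.
  apply: lee_wpmul2l; first exact: poweR_ge0.
  by apply: gt0_ler_poweR => //; rewrite in_itv/= ?mule_ge0 ?integral_ge0 ?leey.
have [_ _ iw _] := geo_int G (minde mB) (fun x => indic_ge0 B x).
have E1 : \int[mu]_x (\1_B (w z x) : R)%:E = mu B by rewrite iw int_indic.
rewrite -E1; apply: le_trans (cauchy_schwarz _ _ mg g0 _ goo) => //.
- apply: ge0_le_integral => //.
  + by move=> x _; exact: (w20 (x, z)).
  + exact: (measurableT_comp mw2 (pair2_measurable z)).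
  + apply: emeasurable_funM; first apply: (measurableT_comp (@measurable_poweR R 2^-1)).
      exact: mwz.
    exact: (measurableT_comp (@measurable_poweR R 2^-1) mg).
  + move=> x _; rewrite sqrt_indic /g.
    rewrite [X in X * _ <= _]/= poweRM ?lee_fin ?indic_ge0// sqrt_indic.
    rewrite muleC indicE; case: (_ \in _); rewrite ?mul0e// !mul1e//.
- exact: mwz.
- by rewrite E1.
Qed.

End set_estimates.

Section exponential_sums.
Variable R : realType.

(* The summand at j is dominated by the increment at j of a bounded monotone
   function, so the sum telescopes. *)
Lemma sum_expR_dist (eps : R) : 0 < eps -> exists2 K : R, 0 < K &
  forall (a : R) n, \sum_(j < n) expR (- (eps * `|a - j%:R|)) <= K.
Proof.
move=> e0; have q1 : expR (- eps) < 1 by rewrite -expR0 ltr_expR oppr_lt0.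
have q0 := expR_gt0 (- eps).
pose K := (1 - expR (- eps))^-1.
have K0 : 0 < K by rewrite invr_gt0 subr_gt0.
have K1 : K * (1 - expR (- eps)) = 1 by rewrite mulVf// gt_eqF// subr_gt0.
exists (2 * K); first by rewrite mulr_gt0.
move=> a n.
pose phi (t : R) := if t <= a then K * expR (- (eps * (a - t)))
  else K * (2 - expR (- (eps * (t - a)))).
have phi0 t : 0 <= phi t.
  rewrite /phi; case: (leP t a) => h; rewrite mulr_ge0 ?expR_ge0 ?(ltW K0)//.
  have : expR (- (eps * (t - a))) <= 1.
    by rewrite -expR0 ler_expR oppr_le0 mulr_ge0 ?(ltW e0)// subr_ge0 ltW.
  lra.
have phi2 t : phi t <= 2 * K.
  rewrite /phi (mulrC 2); case: (leP t a) => h.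
    rewrite ler_wpM2l ?(ltW K0)//.
    have : expR (- (eps * (a - t))) <= 1.
      by rewrite -expR0 ler_expR oppr_le0 mulr_ge0 ?(ltW e0)// subr_ge0.
    lra.
  rewrite ler_wpM2l ?(ltW K0)//; have := expR_ge0 (- (eps * (t - a))); lra.
have step (t : R) : expR (- (eps * `|a - t|)) <= phi (t + 1) - phi t.
  rewrite /phi; have [t1|t1] := leP (t + 1) a.
    have -> : (t <= a) = true by apply/idP; lra.
    rewrite ger0_norm; last by lra.
    have -> : - (eps * (a - t)) = - eps + - (eps * (a - (t + 1))) by ring.
    rewrite expRD; set p := expR (- (eps * (a - (t + 1)))).
    have p0 : 0 < p by exact: expR_gt0.
    have -> : K * p - K * (expR (- eps) * p) = (K * (1 - expR (- eps))) * p by ring.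
    rewrite K1; have : 0 <= (1 - expR (- eps)) * p by rewrite mulr_ge0 ?ltW// subr_gt0.
    lra.
  have [ta|at_] := leP t a.
    rewrite ger0_norm; last by lra.
    set p := expR (- (eps * (a - t))); set q := expR (- (eps * (t + 1 - a))).
    have pq : p * q = expR (- eps) by rewrite -expRD; congr expR; ring.
    have p1 : p <= 1 by rewrite -expR0 ler_expR oppr_le0 mulr_ge0//; lra.
    have q1' : q <= 1 by rewrite -expR0 ler_expR oppr_le0 mulr_ge0//; lra.
    have h : 0 <= (1 - p) * (1 - q) by rewrite mulr_ge0 ?subr_ge0.
    have h2 : K * (1 - p * q) <= K * (2 - q - p).
      by rewrite ler_wpM2l ?(ltW K0)//; lra.
    by move: h2; rewrite pq K1; lra.
  rewrite ler0_norm; last by lra.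
  rewrite opprB; have -> : - (eps * (t + 1 - a)) = - eps + - (eps * (t - a)) by ring.
  rewrite expRD; set p := expR (- (eps * (t - a))).
  have -> : K * (2 - expR (- eps) * p) - K * (2 - p) = (K * (1 - expR (- eps))) * p.
    by ring.
  by rewrite K1 mul1r.
apply: (@le_trans _ _ (phi n%:R - phi 0)); last by have := phi0 0; have := phi2 n%:R; lra.
elim: n => [|n ih]; first by rewrite big_ord0 subrr.
rewrite big_ord_recr/=; have := step n%:R; rewrite natr1; lra.
Qed.

Local Open Scope ereal_scope.

Lemma sqrteD (x y : \bar R) : 0 <= x -> 0 <= y ->
  (x + y) `^ 2^-1 <= x `^ 2^-1 + y `^ 2^-1.
Proof.
case: x => [x| |]//; case: y => [y| |]//=.
- rewrite !lee_fin => x0 y0; rewrite !powR12_sqrt ?addr_ge0//.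
  rewrite -(@ler_pXn2r _ 2) ?nnegrE ?addr_ge0 ?sqrtr_ge0//.
  rewrite sqrrD !sqr_sqrtr ?addr_ge0//.
  have : (0 <= Num.sqrt x * Num.sqrt y)%R by rewrite mulr_ge0 ?sqrtr_ge0.
  by lra.
- by move=> *; rewrite gt_eqF//= addey// leey.
- by move=> *; rewrite gt_eqF//= addye// leey.
- by move=> *; rewrite gt_eqF.
Qed.

Lemma sqrte_sum (I : Type) (s : seq I) (f : I -> \bar R) : (forall i, 0 <= f i) ->
  (\sum_(i <- s) f i) `^ 2^-1 <= \sum_(i <- s) f i `^ 2^-1.
Proof.
move=> f0; elim: s => [|i s ih].
  by rewrite !big_nil poweR0r// invr_neq0.
rewrite !big_cons; apply: (le_trans (sqrteD _ _)) => //.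
  exact: sume_ge0.
exact: leeD2l.
Qed.

Lemma sqrte_expR (a : R) : (expR a)%:E `^ 2^-1 = (expR (a / 2))%:E.
Proof. by rewrite poweR_EFin expRM. Qed.

Lemma le_sqrte (x y : \bar R) : 0 <= x -> x <= y -> x `^ 2^-1 <= y `^ 2^-1.
Proof.
move=> x0 xy; apply: gt0_ler_poweR => //; rewrite in_itv/= leey andbT//.
exact: le_trans xy.
Qed.

Lemma le_sqrte_expR (x : \bar R) (a : R) : 0 <= x -> x <= (expR a)%:E ->
  x `^ 2^-1 <= (expR (a / 2))%:E.
Proof. by move=> x0 xa; rewrite -sqrte_expR; exact: le_sqrte. Qed.

End exponential_sums.

(** * Bounds on triples of sets with off-diagonal gain *)

Section kernel_bounds.
Local Open Scope ereal_scope.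
Context (R : realType) d (T : measurableType d)
  (mu : {sigma_finite_measure set T -> \bar R}) (M : T -> R)
  (u v w : T -> T -> T) (C : R) (G : bilinear_geometry mu M u v w C).

Local Notation biform := (biform mu u v).

Definition set_form (k : T -> R) (E F A : set T) : \bar R :=
  \int[mu]_x ((\1_A x)%:E * biform \1_E \1_F k x `^ 2^-1).

Let ball (s : R) := [set x | (M x <= s)%R].
Let kappa := ln C.

Let expR_kappa : expR kappa = C.
Proof. by rewrite lnK// posrE (lt_le_trans ltr01)//; exact: geo_C1 G. Qed.

Let kappa0 : (0 <= kappa)%R.
Proof. by rewrite ln_ge0//; exact: geo_C1 G. Qed.

Let mind (A : set T) : measurable A -> measurable_fun setT (\1_A : T -> R).
Proof. by move=> mA; exact: measurable_indic. Qed.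

Let minde (A : set T) : measurable A -> measurable_fun setT (fun x => (\1_A x : R)%:E).
Proof. by move=> mA; apply/measurable_EFinP; exact: measurable_indic. Qed.

Section one_triple.
Variables (E F A B : set T).
Hypotheses (mE : measurable E) (mF : measurable F) (mA : measurable A)
  (mB : measurable B).
Variables (i l m : R).
Hypotheses (hE : mu E <= (expR i)%:E) (hF : mu F <= (expR l)%:E)
  (hA : mu A <= (expR m)%:E).

Local Notation lam := (biform \1_E \1_F \1_B).

Let mlam : measurable_fun setT lam.
Proof. by apply: (measurable_biform G); [exact: mind..|exact: indic_ge0|exact: indic_ge0|exact: indic_ge0]. Qed.

Let lam0 x : 0 <= lam x.
Proof. by apply: biform_ge0; exact: indic_ge0. Qed.

Let mlamh : measurable_fun setT (fun x => lam x `^ 2^-1).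
Proof. exact: (measurableT_comp (@measurable_poweR R 2^-1) mlam). Qed.

Let int_indic (D : set T) : measurable D -> \int[mu]_x (\1_D x)%:E = mu D.
Proof. by move=> mD; rewrite integral_indic// setIT. Qed.

(** A uniform bound on [lam] is integrated over all of A, so m enters with weight 2 after halving;
    an L^1 bound goes through Cauchy-Schwarz in [set_form_L1] and uses m only once. *)
Lemma set_form_sup (z : R) : (forall x, lam x <= (expR z)%:E) ->
  set_form \1_B E F A <= (expR ((2 * m + z) / 2))%:E.
Proof.
move=> h.
apply: (@le_trans _ _ (\int[mu]_x ((\1_A x)%:E * (expR (z / 2))%:E))).
  apply: ge0_le_integral => //.
  - by move=> x _; rewrite mule_ge0 ?poweR_ge0// lee_fin indic_ge0.
  - by apply: emeasurable_funM => //; exact: minde.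
  - by apply: emeasurable_funM => //; exact: minde.
  - move=> x _; apply: lee_wpmul2l; first by rewrite lee_fin indic_ge0.
    exact: le_sqrte_expR.
rewrite ge0_integralZr//; last exact: minde.
rewrite int_indic// (_ : (2 * m + z) / 2 = m + z / 2)%R; last by field.
by rewrite expRD EFinM lee_pmul.
Qed.

Lemma set_form_L1 (z : R) : \int[mu]_x lam x <= (expR z)%:E ->
  set_form \1_B E F A <= (expR ((m + z) / 2))%:E.
Proof.
move=> h.
have -> : set_form \1_B E F A = \int[mu]_x ((\1_A x : R)%:E `^ 2^-1 * lam x `^ 2^-1).
  apply: eq_integral => x _; congr (_ * _).
  by rewrite indicE; case: (_ \in _); rewrite poweR_EFin ?powR1// powR0// invr_neq0.
apply: le_trans (cauchy_schwarz (minde mA) _ mlam lam0 _ _) _.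
- by move=> x; rewrite lee_fin indic_ge0.
- by rewrite int_indic//; exact: le_lt_trans hA (ltry _).
- exact: le_lt_trans h (ltry _).
rewrite int_indic// mulrDl expRD EFinM.
by apply: lee_pmul; rewrite ?poweR_ge0// le_sqrte_expR// integral_ge0.
Qed.

Let emul (a b : \bar R) (x y : R) : 0 <= a -> 0 <= b -> a <= (expR x)%:E -> b <= (expR y)%:E ->
  a * b <= (expR (x + y))%:E.
Proof. by move=> *; rewrite expRD EFinM; exact: lee_pmul. Qed.

Lemma set_form_bound3 :
  [/\ set_form \1_B E F A <= (expR ((i + l + m) / 2))%:E,
      set_form \1_B E F A <= (expR ((2 * m + i) / 2))%:E &
      set_form \1_B E F A <= (expR ((2 * m + l) / 2))%:E].
Proof.
split.
- rewrite addrC; apply: set_form_L1.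
  by have [_ _ h] := lam_L1 G mE mF mB; apply: (le_trans h); exact: emul.
- by apply: set_form_sup => x; have [h _ _] := lam_sup G mE mF mB x; exact: le_trans hE.
- by apply: set_form_sup => x; have [_ h _] := lam_sup G mE mF mB x; exact: le_trans hF.
Qed.

(** With [set_form_bound3] this exhausts the sums of three entries of i, l, m, m, s. Only the first
    comes from [lam_half]; it loses 7/2 kappa through the doubling constants, rounded up to the
    common 4 kappa. *)
Lemma set_form_bound5 (s : R) : B = ball (expR s) ->
  [/\ set_form \1_B E F A <= (expR (4 * kappa + (s + i + l) / 2))%:E,
      set_form \1_B E F A <= (expR (4 * kappa + (m + s + i) / 2))%:E,
      set_form \1_B E F A <= (expR (4 * kappa + (m + s + l) / 2))%:E &
      set_form \1_B E F A <= (expR (4 * kappa + (2 * m + s) / 2))%:E].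
Proof.
move=> Bs.
have hball (t : R) : mu (ball (expR t)) <= (expR (kappa + t))%:E.
  by apply: (le_trans (geo_vol_le G (expR_gt0 t))); rewrite expRD expR_kappa EFinM.
have hB : mu B <= (expR (kappa + s))%:E by rewrite Bs.
have mono (x y : R) : (x <= y)%R -> (expR x)%:E <= (expR y)%:E by rewrite lee_fin ler_expR.
have k0 := kappa0.
split.
- have h := lam_half G mE mF mB (expR_gt0 s) Bs (le_lt_trans hE (ltry _)) (le_lt_trans hF (ltry _)).
  have h1 : set_form \1_B E F A <= \int[mu]_x (lam x `^ 2^-1).
    apply: ge0_le_integral => //.
    + by move=> x _; rewrite mule_ge0 ?poweR_ge0// lee_fin indic_ge0.
    + by apply: emeasurable_funM => //; exact: minde.
    + by move=> x _; rewrite -[leRHS]mul1e; apply: lee_wpmul2r; rewrite ?poweR_ge0// lee_fin indic_le1.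
  apply: (le_trans h1).
  have h2 : (expR s)%:E * \int[mu]_x lam x `^ 2^-1 <= (expR s)%:E * (expR (4 * kappa + (s + i + l) / 2))%:E.
    apply: (le_trans h); rewrite -EFinM -expRD.
    have hCs : mu [set x | (M x <= C * expR s)%R] <= (expR (kappa + (kappa + s)))%:E.
      by rewrite -{1}expR_kappa -expRD; exact: hball.
    apply: (@le_trans _ _ ((expR kappa)%:E * ((expR ((kappa + s) / 2))%:E *
      ((expR ((i + (kappa + (kappa + s))) / 2))%:E * (expR ((l + (kappa + (kappa + s))) / 2))%:E)))).
      rewrite expR_kappa; apply: lee_wpmul2l.
        by rewrite lee_fin (le_trans ler01)//; exact: geo_C1 G.
      apply: lee_pmul; rewrite ?mule_ge0 ?poweR_ge0//.
        exact: le_sqrte_expR.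
      by apply: lee_pmul; rewrite ?poweR_ge0//; apply: le_sqrte_expR;
        rewrite ?mule_ge0//; exact: emul.
    by rewrite -!EFinM -!expRD; apply: mono; lra.
  by rewrite lee_pmul2l// lte_fin expR_gt0 in h2.
- apply: (@le_trans _ _ (expR ((m + (i + (kappa + s))) / 2))%:E); last by apply: mono; lra.
  apply: set_form_L1; have [h _ _] := lam_L1 G mE mF mB; apply: (le_trans h); exact: emul.
- apply: (@le_trans _ _ (expR ((m + (l + (kappa + s))) / 2))%:E); last by apply: mono; lra.
  apply: set_form_L1; have [_ h _] := lam_L1 G mE mF mB; apply: (le_trans h); exact: emul.
- apply: (@le_trans _ _ (expR ((2 * m + (kappa + s)) / 2))%:E); last by apply: mono; lra.
  by apply: set_form_sup => x; have [_ _ h] := lam_sup G mE mF mB x; exact: le_trans hB.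
Qed.

End one_triple.

(** The target exponents are halved because of the square root, and g is doubled because D is not
    under that root. The second term in the exponent is the gain when the three measures differ in
    scale. *)
Definition kernel_bound (k : T -> R) (A e1 e2 g eps : R) :=
  forall (E F D : set T) (i l m : R), measurable E -> measurable F -> measurable D ->
    mu E <= (expR i)%:E -> mu F <= (expR l)%:E -> mu D <= (expR m)%:E ->
    set_form k E F D <=
      (A * expR ((e1 * i + e2 * l + 2 * g * m) / 2 - eps * (`|i - l| + `|i - m|)))%:E.

Let le_expR_min (X : \bar R) (c a b : R) : X <= (expR (c + a / 2))%:E -> X <= (expR (c + b / 2))%:E ->
  X <= (expR (c + Num.min a b / 2))%:E.
Proof. by rewrite minEle; case: ifP. Qed.

(** Here the kernel set is the whole space, so the scale s is absent and the three bounds free of s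
    suffice. *)
Lemma kernel_bound_cst (e1 e2 g : R) : (e1 + e2 + 2 * g = 3)%R ->
  (0 < e1 < 1)%R -> (0 < e2 < 1)%R -> (0 < g < 1)%R ->
  exists2 eps : R, (0 < eps)%R & kernel_bound (fun=> 1%R) 1 e1 e2 g eps.
Proof.
move=> hs /andP[a1 b1] /andP[a2 b2] /andP[a3 b3].
have [dd [d0 h1 h2 h3]] : exists dd : R, [/\ (0 < dd)%R, (dd <= e1 <= 1 - dd)%R,
    (dd <= e2 <= 1 - dd)%R & (dd <= g <= 1 - dd)%R].
  (* The distance of the exponents from the endpoints 0 and 1, which is what [three_smallest4]
     converts into gain. *)
  exists (Num.min (Num.min (Num.min e1 (1 - e1)) (Num.min e2 (1 - e2))) (Num.min g (1 - g)))%R.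
  set D := Num.min _ _.
  have : (D <= D)%R by []. 
  rewrite {2}/D !le_min => /andP[/andP[/andP[? ?] /andP[? ?]] /andP[? ?]].
  split; [|by apply/andP; split; lra..].
  by rewrite /D !lt_min; repeat (apply/andP; split); lra.
exists (dd / 4)%R; first by lra.
move=> E F D i l m mE mF mD hE hF hD.
have -> : (fun=> 1%R) = \1_[set: T] :> (T -> R) by rewrite indicT.
have [t1 t2 t3] := set_form_bound3 mE mF mD measurableT hE hF hD.
have {t1 t2 t3}t : set_form \1_[set: T] E F D <=
    (expR (0 + Num.min (Num.min (i + l + m) (2 * m + i)) (2 * m + l) / 2))%:E.
  by apply: le_expR_min; [apply: le_expR_min|]; rewrite add0r.
apply: (le_trans t); rewrite mul1r lee_fin ler_expR add0r.
set z := Num.min _ _.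
have : (z <= z)%R by [].
rewrite {2}/z !le_min => /andP[/andP[z1 z2] z3].
have := three_smallest4 hs d0 h1 h2 h3 z1 z2 z3.
by set a := `|_|%R; set b := `|_|%R; lra.
Qed.

Definition trunc_power (t : R) (n : nat) (y : T) : R :=
  (M y `^ (- t) * \1_(ball (expR n%:R) `\` ball (expR (- n%:R))) y)%R.

Let mball (s : R) : measurable (ball s).
Proof. exact: (measurable_gauge_ball G). Qed.

Lemma measurable_trunc_power t n : measurable_fun setT (trunc_power t n).
Proof.
apply: measurable_funM; last by apply: mind; apply: measurableD; exact: mball.
exact: (measurableT_comp (@measurable_powR R (- t)) (geo_mM G)).
Qed.

Lemma trunc_power_ge0 t n y : (0 <= trunc_power t n y)%R.
Proof. by rewrite mulr_ge0 ?powR_ge0 ?indic_ge0. Qed.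

Let shell (n j : nat) : R := (j%:R - n%:R)%R.

Let ex_nat_itv (t : R) n : (0 < t <= n%:R)%R -> exists2 j : nat, (j < n)%N & (j%:R < t <= j%:R + 1)%R.
Proof.
elim: n => [/andP[? ?]|n ih /andP[t0 tn]]; first by exfalso; lra.
have [tn'|nt] := leP t n%:R.
  by have [|j jn jt] := ih; [rewrite t0|exists j => //; exact: ltnW].
by exists n => //; rewrite nt natr1.
Qed.

(** The annulus is covered by 2 n shells on which M lies between consecutive powers of e. Each shell
    is enlarged to a ball, since the estimates with a scale s are for balls; the value of the kernel
    is taken at the inner radius. *)
Let trunc_power_le (t : R) n y : (0 <= t)%R ->
  (trunc_power t n y <= \sum_(j < 2 * n) expR (- (t * shell n j)) * \1_(ball (expR (shell n j + 1))) y)%R.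
Proof.
move=> t0; rewrite /trunc_power [X in (_ * X)%R]indicE.
have s0 (j : nat) : (0 <= expR (- (t * shell n j)) * \1_(ball (expR (shell n j + 1))) y)%R.
  by rewrite mulr_ge0 ?expR_ge0 ?indic_ge0.
have [/set_mem[h1 h2]|_] := boolP (y \in _); last by rewrite mulr0 sumr_ge0.
rewrite mulr1.
have M0 : (0 < M y)%R.
  by apply: (lt_trans (expR_gt0 (- n%:R))); rewrite ltNge; apply/negP.
have e : M y = expR (ln (M y)) by rewrite lnK.
set a := ln (M y) in e.
have a1 : (a <= n%:R)%R by rewrite -ler_expR -e.
have a2 : (- n%:R < a)%R by rewrite -ltr_expR -e ltNge; apply/negP.
have [|j jn /andP[j1 j2]] := @ex_nat_itv (a + n%:R) (2 * n).
  by rewrite natrM; apply/andP; split; lra.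
rewrite (bigD1 (Ordinal jn))//= -[leLHS]addr0 lerD ?sumr_ge0//.
rewrite indicE mem_set ?mulr1; last by rewrite /ball/= e ler_expR /shell; lra.
rewrite e -expRM ler_expR mulrN lerN2 mulrC ler_wpM2r// /shell; lra.
Qed.

(** On the shell of scale s the kernel contributes e^(-t s / 2), which cancels the weight t of s in
    [three_smallest5]. What remains decays in |i - s|, so the sum over shells is bounded
    independently of the number of shells. *)
Lemma kernel_bound_power (t e1 e2 g : R) : (e1 + e2 + 2 * g + t = 3)%R ->
  (0 < e1 < 1)%R -> (0 < e2 < 1)%R -> (0 < g < 1)%R -> (0 < t < 1)%R ->
  exists A eps : R, [/\ (0 < A)%R, (0 < eps)%R &
    forall n, kernel_bound (trunc_power t n) A e1 e2 g eps].
Proof.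
move=> hs /andP[a1 b1] /andP[a2 b2] /andP[a3 b3] /andP[a4 b4].
have [dd [d0 h1 h2 h3 h4]] : exists dd : R, [/\ (0 < dd)%R, (dd <= e1 <= 1 - dd)%R,
    (dd <= e2 <= 1 - dd)%R, (dd <= g <= 1 - dd)%R & (dd <= t <= 1 - dd)%R].
  exists (Num.min (Num.min (Num.min (Num.min e1 (1 - e1)) (Num.min e2 (1 - e2)))
    (Num.min g (1 - g))) (Num.min t (1 - t)))%R.
  set D := Num.min _ _.
  have : (D <= D)%R by [].
  rewrite {2}/D !le_min => /andP[/andP[/andP[/andP[? ?] /andP[? ?]] /andP[? ?]] /andP[? ?]].
  split; [|by apply/andP; split; lra..].
  by rewrite /D !lt_min; repeat (apply/andP; split); lra.
have d6 : (0 < dd / 6)%R by lra.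
have [K K0 hK] := sum_expR_dist d6.
(* The factor e^(t/2) pays for evaluating the kernel at the inner radius of a shell while the ball
   has the outer one; K sums the decay in |i - s|. *)
exists (expR (4 * kappa + t / 2) * K)%R, (dd / 6)%R; split => //.
  by rewrite mulr_gt0 ?expR_gt0.
move=> n E F D i l m mE mF mD hE hF hD.
pose B (j : nat) := ball (expR (shell n j + 1)).
pose c (j : nat) := expR (- (t * shell n j)).
have mB j : measurable (B j) by exact: mball.
have ml j : measurable_fun setT (biform \1_E \1_F \1_(B j)).
  by apply: (measurable_biform G); [exact: mind..|exact: indic_ge0|exact: indic_ge0|exact: indic_ge0].
have l0 j x : 0 <= biform \1_E \1_F \1_(B j) x by apply: biform_ge0; exact: indic_ge0.
have mlh j : measurable_fun setT (fun x => biform \1_E \1_F \1_(B j) x `^ 2^-1).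
  exact: (measurableT_comp (@measurable_poweR R 2^-1) (ml j)).
have mtp : measurable_fun setT (biform \1_E \1_F (trunc_power t n)).
  apply: (measurable_biform G); [exact: mind|exact: mind|exact: measurable_trunc_power|exact: indic_ge0|exact: indic_ge0|exact: trunc_power_ge0].
have pw x : biform \1_E \1_F (trunc_power t n) x <=
    \sum_(j < 2 * n) (c j)%:E * biform \1_E \1_F \1_(B j) x.
  have mi j : measurable_fun setT (fun y => (\1_E (u x y) * \1_F (v x y) * \1_(B j) y)%:E : \bar R).
    by apply: (measurable_biform_integrand G); exact: mind.
  have mki : measurable_fun setT (fun y => (\1_E (u x y) * \1_F (v x y) * trunc_power t n y)%:E : \bar R).
    by apply: (measurable_biform_integrand G); [exact: mind|exact: mind|exact: measurable_trunc_power].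
  apply: (@le_trans _ _ (\int[mu]_y \sum_(j < 2 * n) (c j)%:E * (\1_E (u x y) * \1_F (v x y) * \1_(B j) y)%:E)).
    apply: ge0_le_integral => //.
    - by move=> y _; rewrite lee_fin !mulr_ge0 ?indic_ge0 ?powR_ge0.
    - by apply: emeasurable_sum => j; exact: measurable_funeM.
    - move=> y _; under eq_bigr do rewrite -EFinM.
      rewrite sumEFin lee_fin; apply: (@le_trans _ _ (\1_E (u x y) * \1_F (v x y) *
        \sum_(j < 2 * n) expR (- (t * shell n j)) * \1_(ball (expR (shell n j + 1))) y))%R.
        by rewrite ler_wpM2l ?mulr_ge0 ?indic_ge0 ?trunc_power_le// ltW.
      rewrite mulr_sumr le_eqVlt; apply/orP; left; apply/eqP; apply: eq_bigr => j _.
      by rewrite mulrCA.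
  rewrite ge0_integral_sum//.
  - apply: lee_sum => j _; rewrite ge0_integralZl// ?lee_fin ?expR_ge0//.
  - by move=> j; exact: measurable_funeM.
  - by move=> j y _; rewrite mule_ge0 ?lee_fin ?expR_ge0 ?mulr_ge0 ?indic_ge0.
have sq x : biform \1_E \1_F (trunc_power t n) x `^ 2^-1 <=
    \sum_(j < 2 * n) (expR (- (t * shell n j) / 2))%:E * biform \1_E \1_F \1_(B j) x `^ 2^-1.
  apply: le_trans (le_sqrte (biform_ge0 _ _ _ _ _ _ x) (pw x)) _;
    [exact: indic_ge0|exact: indic_ge0|exact: trunc_power_ge0|].
  apply: (le_trans (sqrte_sum _ _)).
    by move=> j; rewrite mule_ge0 ?lee_fin ?expR_ge0.
  by apply: lee_sum => j _; rewrite poweRM ?lee_fin ?expR_ge0// sqrte_expR.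
have step1 : set_form (trunc_power t n) E F D <=
    \sum_(j < 2 * n) (expR (- (t * shell n j) / 2))%:E * set_form \1_(B j) E F D.
  apply: (@le_trans _ _ (\int[mu]_x \sum_(j < 2 * n) (expR (- (t * shell n j) / 2))%:E *
     ((\1_D x)%:E * biform \1_E \1_F \1_(B j) x `^ 2^-1))).
    apply: ge0_le_integral => //.
    - by move=> x _; rewrite mule_ge0 ?poweR_ge0// lee_fin indic_ge0.
    - apply: emeasurable_funM; first exact: minde.
      exact: (measurableT_comp (@measurable_poweR R 2^-1) mtp).
    - apply: emeasurable_sum => j; apply: measurable_funeM.
      by apply: emeasurable_funM => //; exact: minde.
    - move=> x _; under eq_bigr do rewrite muleCA.
      rewrite -ge0_sume_distrr; last by move=> j _; rewrite mule_ge0 ?poweR_ge0 ?lee_fin ?expR_ge0.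
      by apply: lee_wpmul2l; rewrite ?lee_fin ?indic_ge0.
  have mD' j : measurable_fun setT (fun x => (\1_D x)%:E * biform \1_E \1_F \1_(B j) x `^ 2^-1).
    by apply: emeasurable_funM => //; exact: minde.
  have D0' j x : 0 <= (\1_D x)%:E * biform \1_E \1_F \1_(B j) x `^ 2^-1.
    by rewrite mule_ge0 ?poweR_ge0 ?lee_fin ?indic_ge0.
  rewrite ge0_integral_sum//.
  - by apply: lee_sum => j _; rewrite ge0_integralZl// ?lee_fin ?expR_ge0.
  - by move=> j; exact: measurable_funeM.
  - by move=> j x _; rewrite mule_ge0 ?lee_fin ?expR_ge0.
apply: (le_trans step1).
pose P := (e1 * i + e2 * l + 2 * g * m)%R; pose Q := (`|i - l| + `|i - m|)%R.
have step2 (j : nat) : set_form \1_(B j) E F D <=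
    (expR (4 * kappa + (P + t * (shell n j + 1) - dd / 3 * (Q + `|i - (shell n j + 1)|)) / 2))%:E.
  have [t1 t2 t3] := set_form_bound3 mE mF mD (mB j) hE hF hD.
  have [t4 t5 t6 t7] := set_form_bound5 mE mF mD (mB j) hE hF hD erefl.
  have up (z : R) : set_form \1_(B j) E F D <= (expR (z / 2))%:E ->
      set_form \1_(B j) E F D <= (expR (4 * kappa + z / 2))%:E.
    by move/le_trans; apply; rewrite lee_fin ler_expR lerDr mulr_ge0 ?kappa0.
  move: (up _ t1) (up _ t2) (up _ t3) => {}t1 {}t2 {}t3.
  set s := (shell n j + 1)%R in t4 t5 t6 t7 *.
  have tt := le_expR_min (le_expR_min (le_expR_min t1 t2) (le_expR_min t3 t4)) (le_expR_min t5 (le_expR_min t6 t7)).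
  apply: (le_trans tt); rewrite lee_fin ler_expR lerD2l.
  set z := Num.min _ _.
  have : (z <= z)%R by [].
  rewrite {2}/z !le_min => /andP[/andP[/andP[z1 z2] /andP[z3 z4]] /andP[z5 /andP[z6 z7]]].
  have := three_smallest5 hs d0 h1 h2 h3 h4 z1 z2 z3 z4 z5 z6 z7.
  by rewrite /P /Q; set a := `|_|%R; set b := `|_|%R; set c' := `|_|%R; lra.
apply: (@le_trans _ _ (\sum_(j < 2 * n) (expR (- (t * shell n j) / 2) *
   expR (4 * kappa + (P + t * (shell n j + 1) - dd / 3 * (Q + `|i - (shell n j + 1)|)) / 2))%:E)).
  by apply: lee_sum => j _; rewrite EFinM; apply: lee_wpmul2l; rewrite ?lee_fin ?expR_ge0.
rewrite sumEFin lee_fin.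
have -> : (\sum_(j < 2 * n) (expR (- (t * shell n j) / 2) *
   expR (4 * kappa + (P + t * (shell n j + 1) - dd / 3 * (Q + `|i - (shell n j + 1)|)) / 2)) =
   expR (4 * kappa + t / 2) * expR (P / 2 - dd / 6 * Q) *
    \sum_(j < 2 * n) expR (- (dd / 6 * `|(i + n%:R - 1) - j%:R|)))%R.
  rewrite mulr_sumr; apply: eq_bigr => j _; rewrite -!expRD; congr expR.
  have -> : (i - (shell n j + 1) = i + n%:R - 1 - j%:R)%R by rewrite /shell; ring.
  by field.
rewrite mulrAC ler_wpM2r ?expR_ge0// ler_wpM2l ?expR_ge0//.
Qed.

End kernel_bounds.

(** * Trilinear sums and rearrangements *)

Section trilinear_sums.
Variable R : realType.

(** With m the largest of the three, the product is at most m^(a+b+c), and this is at most m because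
    m <= 1. *)
Let powR_le_max (X Y Z a b c : R) : 0 <= X <= 1 -> 0 <= Y <= 1 -> 0 <= Z <= 1 ->
  0 < a -> 0 < b -> 0 < c -> 1 <= a + b + c ->
  X `^ a * Y `^ b * Z `^ c <= X + Y + Z.
Proof.
move=> /andP[X0 X1] /andP[Y0 Y1] /andP[Z0 Z1] a0 b0 c0 abc.
pose m := Num.max (Num.max X Y) Z.
have mX : X <= m by rewrite /m !le_max lexx.
have mY : Y <= m by rewrite /m !le_max lexx orbT.
have mZ : Z <= m by rewrite /m !le_max lexx !orbT.
have m1 : m <= 1 by rewrite /m !ge_max X1 Y1 Z1.
have m0 : 0 <= m by exact: le_trans mX.
have mle : m <= X + Y + Z by rewrite /m !ge_max; repeat (apply/andP; split); lra.
apply: le_trans mle.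
apply: (@le_trans _ _ (m `^ a * m `^ b * m `^ c)).
  by rewrite !ler_pM ?mulr_ge0 ?powR_ge0// ge0_ler_powR ?nnegrE// ltW.
move: m0; rewrite le_eqVlt => /predU1P[<-|m0].
  by rewrite powR0 ?gt_eqF// !mul0r.
rewrite -!powRD ?(gt_eqF m0) ?implybT//.
by rewrite -[leRHS]powRr1 ?(ltW m0)// ger_powR// m0 m1.
Qed.

(** Normalised P-th powers X, Y, Z lie in [0, 1] and have sums at most 1, so [powR_le_max] replaces
    the product by X + Y + Z. In each of the three terms the exponential factor is summed over the
    two free indices first, which costs K^2. *)
Lemma trilinear_sum_le (eps P1 P2 P3 A1 A2 A3 : R) : 0 < eps ->
  0 < P1 -> 0 < P2 -> 0 < P3 -> 1 <= P1^-1 + P2^-1 + P3^-1 ->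
  0 < A1 -> 0 < A2 -> 0 < A3 ->
  exists2 K : R, 0 < K & forall n (x y z : nat -> R),
    (forall i, 0 <= x i) -> (forall i, 0 <= y i) -> (forall i, 0 <= z i) ->
    \sum_(i < n) x i `^ P1 <= A1 -> \sum_(i < n) y i `^ P2 <= A2 ->
    \sum_(i < n) z i `^ P3 <= A3 ->
    \sum_(i < n) \sum_(l < n) \sum_(m < n) x i * y l * z m *
      expR (- (eps * (`|i%:R - l%:R| + `|i%:R - m%:R|))) <= K.
Proof.
move=> e0 P10 P20 P30 hP A10 A20 A30.
have [K K0 hK] := sum_expR_dist e0.
pose c := A1 `^ P1^-1 * A2 `^ P2^-1 * A3 `^ P3^-1.
have c0 : 0 < c by rewrite /c !mulr_gt0 ?powR_gt0.
exists (c * (3 * K ^+ 2)); first by rewrite mulr_gt0// mulr_gt0// exprn_gt0.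
move=> n x y z x0 y0 z0 hx hy hz.
have norm (P A : R) (f : nat -> R) : 0 < P -> 0 < A -> (forall i, 0 <= f i) ->
    \sum_(i < n) f i `^ P <= A -> exists2 F : nat -> R,
    (forall i, (i < n)%N -> 0 <= F i <= 1 /\ f i = A `^ P^-1 * F i `^ P^-1) &
    \sum_(i < n) F i <= 1.
  move=> P0 A0 f0 hf; exists (fun i => f i `^ P / A).
    move=> i ni; split.
      rewrite divr_ge0 ?powR_ge0 ?(ltW A0)//= ler_pdivrMr// mul1r.
      apply: le_trans hf; rewrite (bigD1 (Ordinal ni))//= lerDl sumr_ge0// => j _.
      exact: powR_ge0.
    rewrite -powRM ?divr_ge0 ?powR_ge0 ?(ltW A0)//.
    by rewrite mulrC divfK ?gt_eqF// -powRrM divff ?gt_eqF// powRr1.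
  by rewrite -mulr_suml ler_pdivrMr// mul1r.
have [X hX sX] := norm _ _ _ P10 A10 x0 hx.
have [Y hY sY] := norm _ _ _ P20 A20 y0 hy.
have [Z hZ sZ] := norm _ _ _ P30 A30 z0 hz.
have X0 (i : 'I_n) : 0 <= X i by have [/andP[]] := hX i (ltn_ord i).
have Y0 (i : 'I_n) : 0 <= Y i by have [/andP[]] := hY i (ltn_ord i).
have Z0 (i : 'I_n) : 0 <= Z i by have [/andP[]] := hZ i (ltn_ord i).
pose k (i l : nat) := expR (- (eps * `|i%:R - l%:R|)).
have k0 i l : 0 <= k i l by exact: expR_ge0.
have kC i l : k i l = k l i by rewrite /k distrC.
have kK (i : nat) : \sum_(l < n) k i l <= K by exact: hK.
apply: (@le_trans _ _ (\sum_(i < n) \sum_(l < n) \sum_(m < n)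
    c * (X i + Y l + Z m) * (k i l * k i m))).
  apply: ler_sum => i _; apply: ler_sum => l _; apply: ler_sum => m _.
  rewrite mulrDr opprD expRD ler_wpM2r ?mulr_ge0 ?expR_ge0//.
  have [Xi ->] := hX i (ltn_ord i); have [Yl ->] := hY l (ltn_ord l).
  have [Zm ->] := hZ m (ltn_ord m).
  have := powR_le_max Xi Yl Zm.
  have Pi1 : 0 < P1^-1 by rewrite invr_gt0.
  have Pi2 : 0 < P2^-1 by rewrite invr_gt0.
  have Pi3 : 0 < P3^-1 by rewrite invr_gt0.
  move=> /(_ _ _ _ Pi1 Pi2 Pi3 hP) h.
  rewrite (_ : A1 `^ P1^-1 * X i `^ P1^-1 * _ * _ =
    c * (X i `^ P1^-1 * Y l `^ P2^-1 * Z m `^ P3^-1)); last by rewrite /c; ring.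
  by rewrite ler_wpM2l// ltW.
have K2 : 0 <= K by exact: ltW.
have S1 : \sum_(i < n) \sum_(l < n) \sum_(m < n) X i * (k i l * k i m) <= K ^+ 2.
  apply: (@le_trans _ _ (\sum_(i < n) X i * K ^+ 2)).
    apply: ler_sum => i _.
    have -> : \sum_(l < n) \sum_(m < n) X i * (k i l * k i m) =
        X i * ((\sum_(l < n) k i l) * \sum_(m < n) k i m).
      rewrite mulr_suml mulr_sumr; apply: eq_bigr => l _.
      by rewrite !mulr_sumr; apply: eq_bigr => m _.
    by rewrite ler_wpM2l// expr2 ler_pM ?sumr_ge0.
  by rewrite -mulr_suml ler_piMl ?exprn_ge0.
have S2 : \sum_(i < n) \sum_(l < n) \sum_(m < n) Y l * (k i l * k i m) <= K ^+ 2.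
  rewrite exchange_big/=.
  apply: (@le_trans _ _ (\sum_(l < n) Y l * K ^+ 2)).
    apply: ler_sum => l _.
    apply: (@le_trans _ _ (\sum_(i < n) Y l * (k l i * K))).
      apply: ler_sum => i _; rewrite -mulr_sumr ler_wpM2l// -mulr_sumr (kC i).
      by rewrite ler_wpM2l.
    by rewrite -mulr_sumr ler_wpM2l// -mulr_suml expr2 ler_wpM2r.
  by rewrite -mulr_suml ler_piMl ?exprn_ge0.
have S3 : \sum_(i < n) \sum_(l < n) \sum_(m < n) Z m * (k i l * k i m) <= K ^+ 2.
  under eq_bigr do rewrite exchange_big/=.
  rewrite exchange_big/=.
  apply: (@le_trans _ _ (\sum_(m < n) Z m * K ^+ 2)).
    apply: ler_sum => m _.
    apply: (@le_trans _ _ (\sum_(i < n) Z m * (k m i * K))).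
      apply: ler_sum => i _; rewrite -mulr_sumr ler_wpM2l// -mulr_suml mulrC (kC i m).
      by rewrite ler_wpM2l.
    by rewrite -mulr_sumr ler_wpM2l// -mulr_suml expr2 ler_wpM2r.
  by rewrite -mulr_suml ler_piMl ?exprn_ge0.
have -> : \sum_(i < n) \sum_(l < n) \sum_(m < n) c * (X i + Y l + Z m) * (k i l * k i m) =
  c * (\sum_(i < n) \sum_(l < n) \sum_(m < n) X i * (k i l * k i m) +
  \sum_(i < n) \sum_(l < n) \sum_(m < n) Y l * (k i l * k i m) +
  \sum_(i < n) \sum_(l < n) \sum_(m < n) Z m * (k i l * k i m)).
  rewrite -!big_split mulr_sumr; apply: eq_bigr => i _.
  rewrite -!big_split mulr_sumr; apply: eq_bigr => l _.
  rewrite -!big_split mulr_sumr; apply: eq_bigr => m _ /=.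
  by ring.
by rewrite ler_wpM2l ?(ltW c0)//; lra.
Qed.

End trilinear_sums.

Section rearrangement.
Local Open Scope ereal_scope.
Context (R : realType) d (T : measurableType d) (mu : {measure set T -> \bar R}).
Variables (F : T -> R) (p : R).
Hypotheses (p0 : (0 < p)%R) (mF : measurable_fun setT F) (F0 : forall x, (0 <= F x)%R)
  (Fp : \int[mu]_x (F x `^ p)%:E <= 1).

Let above (s : R) := [set x | (s < F x)%R].

Lemma measurable_above s : measurable (above s).
Proof.
rewrite -[X in measurable X]setTI.
have -> : above s = F @^-1` `]s, +oo[%classic.
  by apply/seteqP; split => x /=; rewrite in_itv/= andbT.
exact: mF.
Qed.

Let mFp (c : R) : measurable_fun setT (fun x => ((c * F x) `^ p)%:E).
Proof.
apply/measurable_EFinP; apply: (measurableT_comp (@measurable_powR R p)).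
exact: measurable_funM.
Qed.

Let int_indic (A : set T) : measurable A -> \int[mu]_x (\1_A x)%:E = mu A.
Proof. by move=> mA; rewrite integral_indic// setIT. Qed.

Let minde (A : set T) : measurable A -> measurable_fun setT (fun x => (\1_A x : R)%:E).
Proof. by move=> mA; apply/measurable_EFinP; exact: measurable_indic. Qed.

Let markov (s : R) : (0 < s)%R -> (s `^ p)%:E * mu (above s) <= 1.
Proof.
move=> s0; apply: le_trans Fp.
rewrite -int_indic; last exact: measurable_above.
rewrite -ge0_integralZl_EFin ?powR_ge0//; last exact/minde/measurable_above.
apply: ge0_le_integral => //.
- by move=> x _; rewrite -EFinM lee_fin mulr_ge0 ?powR_ge0.
- exact/measurable_funeM/minde/measurable_above.
- by have := mFp 1; under eq_fun do rewrite mul1r.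
- move=> x _; rewrite -EFinM lee_fin indicE.
  have [/set_mem/= sF|_] := boolP (x \in above s); last by rewrite mulr0 powR_ge0.
  by rewrite mulr1 ge0_ler_powR ?nnegrE ?(ltW p0) ?(ltW s0)// ltW.
Qed.

Let level_set (t : R) : set R := [set s | (0 <= s)%R /\ mu (above s) <= (expR t)%:E].

Let level_set_nonempty t : level_set t !=set0.
Proof.
exists (expR (- t / p)); split; first exact: expR_ge0.
have := markov (expR_gt0 (- t / p)).
rewrite -expRM (_ : (- t / p * p = - t)%R); last by field; rewrite gt_eqF.
rewrite muleC -lee_pdivlMr ?expR_gt0// -expRN opprK mul1e//.
Qed.

Let level_set_lb t : has_lbound (level_set t).
Proof. by exists 0%R => s []. Qed.

(** The decreasing rearrangement of F at the measure e^t. *)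
Definition rearr (t : R) : R := inf (level_set t).

Lemma rearr_ge0 t : (0 <= rearr t)%R.
Proof. by apply: lb_le_inf => // s []. Qed.

Lemma rearr_antitone t t' : (t <= t')%R -> (rearr t' <= rearr t)%R.
Proof.
move=> tt'; apply: lb_le_inf => // s [s0 hs]; apply: ge_inf => //; split => //.
by apply: (le_trans hs); rewrite lee_fin ler_expR.
Qed.

Let above_antitone s s' : (s <= s')%R -> mu (above s') <= mu (above s).
Proof.
move=> ss'; apply: le_measure; rewrite ?inE; [exact: measurable_above|exact: measurable_above|].
by move=> x /=; exact: le_lt_trans.
Qed.

(** The infimum is attained: the strict superlevel sets at heights decreasing to [rearr t] increase
    to the one at [rearr t], and continuity of the measure from below applies. *)
Lemma measure_above_rearr t : mu (above (rearr t)) <= (expR t)%:E.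
Proof.
have E : above (rearr t) = \bigcup_n above (rearr t + n.+1%:R^-1)%R.
  apply/seteqP; split => [x /= h|x [n _] /=]; last first.
    by apply: le_lt_trans; rewrite lerDl invr_ge0.
  have h' : (0 < F x - rearr t)%R by rewrite subr_gt0.
  have [n hn] := ltr_add_invr h.
  by exists n.
have nd : nondecreasing_seq (fun n => above (rearr t + n.+1%:R^-1)%R).
  move=> m n mn; apply/subsetPset => x /=; apply: le_lt_trans.
  by rewrite lerD2l lef_pV2 ?posrE// ler_nat ltnS.
have mA n : measurable (above (rearr t + n.+1%:R^-1)%R) by exact: measurable_above.
have := @nondecreasing_cvg_mu _ _ _ mu _ mA (bigcup_measurable (fun n _ => mA n)) nd.
rewrite -E => /cvg_lim <-//; apply: lime_le.
  apply: ereal_nondecreasing_is_cvgn => m n mn; apply: le_measure; rewrite ?inE//.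
  exact/subsetPset/nd.
apply: nearW => n.
have : has_inf (level_set t) by split.
move=> /(inf_adherent (eps := n.+1%:R^-1)) [|s [s0 hs] hsn]; first by rewrite invr_gt0.
by apply: (le_trans _ hs); apply: above_antitone; exact: ltW.
Qed.

Lemma measure_above_lt t s : (0 <= s)%R -> (s < rearr t)%R -> (expR t)%:E < mu (above s).
Proof.
move=> s0 st; rewrite ltNge; apply/negP => h.
by move: st; rewrite ltNge => /negP; apply; apply: ge_inf.
Qed.

(** For decreasing th the indicators switch on at the first k with th k < y, and from there the sum
    telescopes to th k ^ p; it is 0 if there is no such k up to n. *)
Let tail (th : nat -> R) (y : R) n : R :=
  (\sum_(k < n) (th k `^ p - th k.+1 `^ p) * (th k < y)%R%:R + th n `^ p * (th n < y)%R%:R)%R.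

Let tail_le (th : nat -> R) (y : R) n : (forall k, 0 <= th k)%R ->
  (forall k, th k.+1 <= th k)%R -> (0 <= y)%R -> (tail th y n <= y `^ p)%R.
Proof.
move=> th0 thd y0.
have mono k : (th k.+1 `^ p <= th k `^ p)%R by rewrite ge0_ler_powR ?nnegrE ?(ltW p0).
suff : (tail th y n <= y `^ p)%R /\ ((y <= th n)%R -> tail th y n = 0%R) by case.
elim: n => [|n [ih1 ih2]]; rewrite /tail.
  rewrite big_ord0 add0r; have [h|h] := ltP (th 0%N) y.
    by rewrite mulr1; split => //; rewrite ge0_ler_powR ?nnegrE ?(ltW p0)// ltW.
  by rewrite mulr0; split => //; exact: powR_ge0.
rewrite big_ord_recr/= -/(tail th y n).
have -> : (\sum_(i < n) (th i `^ p - th i.+1 `^ p) * (th i < y)%R%:R +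
    (th n `^ p - th n.+1 `^ p) * (th n < y)%R%:R + th n.+1 `^ p * (th n.+1 < y)%R%:R =
    tail th y n + th n.+1 `^ p * ((th n.+1 < y)%R%:R - (th n < y)%R%:R))%R by rewrite /tail; ring.
have [yn|ny] := leP y (th n).
  rewrite (ih2 yn) add0r subr0; have [h|h] := ltP (th n.+1) y.
    by rewrite mulr1; split => //; rewrite ge0_ler_powR ?nnegrE ?(ltW p0)// ltW.
  by rewrite mulr0; split => //; exact: powR_ge0.
have -> : (th n.+1 < y)%R by exact: le_lt_trans ny.
by rewrite subrr mulr0 addr0; split => // yn; have := thd n; lra.
Qed.

(* Summation by parts: the increments of theta^p are weighted by the measures of
   the level sets {theta_k < 2 F}, whose sum telescopes pointwise below (2 F)^p. *)
Lemma sum_rearr (s : R) n :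
  (\sum_(i < n) expR (s + i%:R) * rearr (s + i%:R) `^ p <= 2 * 2 `^ p)%R.
Proof.
pose th (i : nat) := rearr (s + i%:R); pose a (i : nat) := expR (s + i%:R).
have th0 i : (0 <= th i)%R by exact: rearr_ge0.
have thd i : (th i.+1 <= th i)%R by apply: rearr_antitone; rewrite lerD2l ler_nat.
have a0 i : (0 < a i)%R by exact: expR_gt0.
(* The measures at least double because e >= 2; this bounds a (i+1) by twice the increment and makes
   the summation by parts work with the factor 2. *)
have aS i : (2 * a i <= a i.+1)%R.
  have -> : a i.+1 = (a i * expR 1)%R by rewrite /a -expRD -addrA natr1.
  by rewrite mulrC ler_wpM2l ?(ltW (a0 _))//; have := expR_ge1Dx (1 : R); lra.
have parts m : (\sum_(i < m) a i * th i `^ p <=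
    2 * (\sum_(k < m) (th k `^ p - th k.+1 `^ p) * a k) + a m * th m `^ p)%R.
  elim: m => [|m ih]; first by rewrite !big_ord0 mulr0 add0r mulr_ge0 ?powR_ge0// ltW.
  rewrite !big_ord_recr/=.
  move: ih (ler_wpM2r (powR_ge0 (th m.+1) p) (aS m)).
  set s1 := (\sum_(i < m) _)%R; set s2 := (\sum_(i < m) _)%R.
  move: s1 s2 (a m) (a m.+1) (th m `^ p)%R (th m.+1 `^ p)%R => s1 s2 x x' y y'.
  lra.
have b0 k : (0 <= th k `^ p - th k.+1 `^ p)%R.
  by rewrite subr_ge0 ge0_ler_powR ?nnegrE ?(ltW p0).
(* Strictly below the height th k the level set has measure above a k. Halving th k reaches such a
   level at the cost of 2^p in the end; if th k = 0 there is none, but then the coefficient b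
   vanishes too. *)
have key (b : R) k : (0 <= b)%R -> (th k = 0%R -> b = 0%R) ->
    (b * a k)%:E <= b%:E * \int[mu]_x (\1_(above (th k / 2)) x)%:E.
  move=> b_ge0 hb; have [/eqP tk|tk] := boolP (th k == 0%R).
    by rewrite hb// mul0r mul0e.
  have tk0 : (0 < th k)%R by rewrite lt_neqAle eq_sym tk th0.
  rewrite EFinM; apply: lee_wpmul2l => //.
  rewrite int_indic; last exact: measurable_above.
  by apply/ltW/measure_above_lt; lra.
have main : (\sum_(k < n) (th k `^ p - th k.+1 `^ p) * a k + a n * th n `^ p <= 2 `^ p)%R.
  rewrite -lee_fin EFinD -sumEFin.
  apply: (@le_trans _ _ (\sum_(k < n) \int[mu]_x ((th k `^ p - th k.+1 `^ p)%:E * (\1_(above (th k / 2)) x)%:E)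
     + \int[mu]_x ((th n `^ p)%:E * (\1_(above (th n / 2)) x)%:E))).
    apply: leeD.
      apply: lee_sum => k _; rewrite ge0_integralZl_EFin//; last exact/minde/measurable_above.
      apply: key => // tk; have := thd k; rewrite tk => tk1.
      have -> : th k.+1 = 0%R by apply/eqP; rewrite eq_le tk1 th0.
      by rewrite subrr.
    rewrite ge0_integralZl_EFin ?powR_ge0//; last exact/minde/measurable_above.
    by rewrite mulrC; apply: key; rewrite ?powR_ge0// => ->; rewrite powR0// gt_eqF.
  have mk (b : R) k : measurable_fun setT (fun x => b%:E * (\1_(above (th k / 2)) x)%:E).
    exact/measurable_funeM/minde/measurable_above.
  rewrite -ge0_integral_sum//; last first.
    by move=> k x _; rewrite mule_ge0// lee_fin.
  rewrite -ge0_integralD//; last 3 first.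
  - by move=> x _; apply: sume_ge0 => k _; rewrite mule_ge0// lee_fin.
  - by apply: emeasurable_sum => k; exact: mk.
  - by move=> x _; rewrite mule_ge0// lee_fin ?powR_ge0.
  apply: (@le_trans _ _ (\int[mu]_x ((2 * F x) `^ p)%:E)).
    apply: ge0_le_integral => //.
    - move=> x _; rewrite adde_ge0//; first by apply: sume_ge0 => k _; rewrite mule_ge0// lee_fin.
      by rewrite mule_ge0// lee_fin powR_ge0.
    - by apply: emeasurable_funD; [apply: emeasurable_sum => k; exact: mk|exact: mk].
    - move=> x _.
      have ind k : (\1_(above (th k / 2)) x = (th k < 2 * F x)%R%:R :> R)%R.
        rewrite indicE; congr (nat_of_bool _)%:R; apply/idP/idP => [/set_mem|h].
          by rewrite /above/= ltr_pdivrMr// mulrC.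
        by apply/mem_set; rewrite /above/= ltr_pdivrMr// mulrC.
      under eq_bigr do rewrite ind -EFinM.
      rewrite sumEFin ind -EFinM -EFinD lee_fin.
      by have := @tail_le th (2 * F x) n th0 thd; apply; rewrite mulr_ge0.
  under eq_integral do rewrite powRM// EFinM.
  rewrite ge0_integralZl_EFin ?powR_ge0//; last 2 first.
  - by move=> x _; rewrite lee_fin powR_ge0.
  - by have := mFp 1; under eq_fun do rewrite mul1r.
  rewrite -[leRHS]mule1; exact: lee_wpmul2l.
apply: (le_trans (parts n)); move: main (mulr_ge0 (ltW (a0 n)) (powR_ge0 (th n) p)).
set s1 := (\sum_(k < n) _)%R; move: s1 (a n * th n `^ p)%R (2 `^ p)%R => s1 x y.
lra.
Qed.

End rearrangement.

(** * Reduction to indicator functions *)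

Section atoms.
Local Open Scope ereal_scope.
Context (R : realType) d (T : measurableType d)
  (mu : {sigma_finite_measure set T -> \bar R}) (M : T -> R)
  (u v w : T -> T -> T) (C : R) (G : bilinear_geometry mu M u v w C).

Let mind (A : set T) : measurable A -> measurable_fun setT (\1_A : T -> R).
Proof. by move=> mA; exact: measurable_indic. Qed.

Let minde (A : set T) : measurable A -> measurable_fun setT (fun x => (\1_A x : R)%:E).
Proof. by move=> mA; apply/measurable_EFinP; exact: measurable_indic. Qed.

(** The sums over layers of f and g leave [biform] by bilinearity and then the square root by
    subadditivity, so their coefficients appear under a root; h is outside the root and its
    coefficients keep power one. *)
Lemma atomic_bound n (f g h k : T -> R) (al be ga : nat -> R) (E1 E2 E3 : nat -> set T) :
  measurable_fun setT f -> measurable_fun setT g -> measurable_fun setT h ->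
  measurable_fun setT k ->
  (forall x, 0 <= f x)%R -> (forall x, 0 <= g x)%R -> (forall x, 0 <= h x)%R ->
  (forall x, 0 <= k x)%R ->
  (forall i, 0 <= al i)%R -> (forall i, 0 <= be i)%R -> (forall i, 0 <= ga i)%R ->
  (forall i, measurable (E1 i)) -> (forall i, measurable (E2 i)) ->
  (forall i, measurable (E3 i)) ->
  (forall x, f x <= \sum_(i < n) al i * \1_(E1 i) x)%R ->
  (forall x, g x <= \sum_(i < n) be i * \1_(E2 i) x)%R ->
  (forall x, h x <= \sum_(i < n) ga i * \1_(E3 i) x)%R ->
  \int[mu]_x ((h x)%:E * biform mu u v f g k x `^ 2^-1) <=
  \sum_(i < n) \sum_(l < n) \sum_(m < n)
    (al i `^ 2^-1 * be l `^ 2^-1 * ga m)%:E * set_form mu u v k (E1 i) (E2 l) (E3 m).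
Proof.
move=> mf mg mh mk f0 g0 h0 k0 al0 be0 ga0 mE1 mE2 mE3 hf hg hh.
have mB i l : measurable_fun setT (biform mu u v \1_(E1 i) \1_(E2 l) k).
  by apply: (measurable_biform G); [exact: mind|exact: mind|exact: mk|exact: indic_ge0|exact: indic_ge0|exact: k0].
have B0 i l x : 0 <= biform mu u v \1_(E1 i) \1_(E2 l) k x.
  by apply: biform_ge0; [exact: indic_ge0|exact: indic_ge0|exact: k0].
have mBh i l : measurable_fun setT (fun x => biform mu u v \1_(E1 i) \1_(E2 l) k x `^ 2^-1).
  exact: (measurableT_comp (@measurable_poweR R 2^-1) (mB i l)).
have mfg : measurable_fun setT (biform mu u v f g k) by apply: (measurable_biform G).
have step1 x : biform mu u v f g k x <=
    \sum_(i < n) \sum_(l < n) (al i * be l)%:E * biform mu u v \1_(E1 i) \1_(E2 l) k x.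
  have mi i l : measurable_fun setT (fun y => (\1_(E1 i) (u x y) * \1_(E2 l) (v x y) * k y)%:E : \bar R).
    by apply: (measurable_biform_integrand G); [exact: mind|exact: mind|exact: mk].
  have i0 i l y : 0 <= (\1_(E1 i) (u x y) * \1_(E2 l) (v x y) * k y)%:E :> \bar R.
    by rewrite lee_fin !mulr_ge0.
  apply: (@le_trans _ _ (\int[mu]_y \sum_(i < n) \sum_(l < n) (al i * be l)%:E *
      (\1_(E1 i) (u x y) * \1_(E2 l) (v x y) * k y)%:E)).
    apply: ge0_le_integral => //.
    - by move=> y _; rewrite lee_fin !mulr_ge0.
    - exact: (measurable_biform_integrand G).
    - by apply: emeasurable_sum => i; apply: emeasurable_sum => l; exact: measurable_funeM.
    - move=> y _; under eq_bigr do (under eq_bigr do rewrite -EFinM; rewrite sumEFin).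
      rewrite sumEFin lee_fin.
      apply: (@le_trans _ _ ((\sum_(i < n) al i * \1_(E1 i) (u x y)) *
         (\sum_(l < n) be l * \1_(E2 l) (v x y)) * k y))%R.
        by rewrite ler_wpM2r// ler_pM.
      rewrite le_eqVlt; apply/orP; left; apply/eqP.
      rewrite -mulrA mulr_suml; apply: eq_bigr => i _.
      rewrite mulr_suml mulr_sumr; apply: eq_bigr => l _; ring.
  rewrite ge0_integral_sum//.
  - apply: lee_sum => i _; rewrite ge0_integral_sum//.
    + by apply: lee_sum => l _; rewrite ge0_integralZl// ?lee_fin ?mulr_ge0.
    + by move=> l; exact: measurable_funeM.
    + by move=> l y _; rewrite mule_ge0// lee_fin mulr_ge0.
  - by move=> i; apply: emeasurable_sum => l; exact: measurable_funeM.
  - by move=> i y _; apply: sume_ge0 => l _; rewrite mule_ge0// lee_fin mulr_ge0.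
have step2 x : biform mu u v f g k x `^ 2^-1 <=
    \sum_(i < n) \sum_(l < n) (al i `^ 2^-1 * be l `^ 2^-1)%:E *
      biform mu u v \1_(E1 i) \1_(E2 l) k x `^ 2^-1.
  have s0 i l : 0 <= (al i * be l)%:E * biform mu u v \1_(E1 i) \1_(E2 l) k x.
    by rewrite mule_ge0// lee_fin mulr_ge0.
  apply: (le_trans (le_sqrte _ (step1 x))); first exact: biform_ge0.
  apply: (le_trans (sqrte_sum _ _)) => [i|].
    by apply: sume_ge0 => l _; exact: s0.
  apply: lee_sum => i _; apply: (le_trans (sqrte_sum _ _)) => [l|]; first exact: s0.
  apply: lee_sum => l _.
  by rewrite poweRM ?lee_fin ?mulr_ge0// poweR_EFin powRM.
pose W i l m x := (\1_(E3 m) x)%:E * biform mu u v \1_(E1 i) \1_(E2 l) k x `^ 2^-1.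
have mW i l m : measurable_fun setT (W i l m).
  by apply: emeasurable_funM => //; exact: minde.
have W0 i l m x : 0 <= W i l m x by rewrite /W mule_ge0 ?poweR_ge0 ?lee_fin ?indic_ge0.
have c0 i l m : 0 <= (al i `^ 2^-1 * be l `^ 2^-1 * ga m)%:E.
  by rewrite lee_fin !mulr_ge0 ?powR_ge0.
apply: (@le_trans _ _ (\int[mu]_x \sum_(i < n) \sum_(l < n) \sum_(m < n)
   (al i `^ 2^-1 * be l `^ 2^-1 * ga m)%:E * W i l m x)).
  apply: ge0_le_integral => //.
  - by move=> x _; rewrite mule_ge0 ?poweR_ge0 ?lee_fin.
  - apply: emeasurable_funM; first exact/measurable_EFinP.
    exact: (measurableT_comp (@measurable_poweR R 2^-1) mfg).
  - apply: emeasurable_sum => i; apply: emeasurable_sum => l; apply: emeasurable_sum => m.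
    exact: measurable_funeM.
  - move=> x _.
    apply: (@le_trans _ _ ((\sum_(m < n) ga m * \1_(E3 m) x)%:E *
      \sum_(i < n) \sum_(l < n) (al i `^ 2^-1 * be l `^ 2^-1)%:E *
      biform mu u v \1_(E1 i) \1_(E2 l) k x `^ 2^-1)).
      by apply: lee_pmul; rewrite ?poweR_ge0 ?lee_fin.
    rewrite ge0_sume_distrr; last first.
      by move=> i _; apply: sume_ge0 => l _; rewrite mule_ge0 ?poweR_ge0// lee_fin mulr_ge0 ?powR_ge0.
    apply: lee_sum => i _; rewrite ge0_sume_distrr; last first.
      by move=> l _; rewrite mule_ge0 ?poweR_ge0// lee_fin mulr_ge0 ?powR_ge0.
    apply: lee_sum => l _; rewrite -sumEFin ge0_sume_distrl; last first.
      by move=> m _; rewrite lee_fin mulr_ge0 ?indic_ge0.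
    apply: lee_sum => m _; rewrite /W muleA -EFinM muleA -EFinM.
    by apply: lee_wpmul2r; rewrite ?poweR_ge0// lee_fin le_eqVlt; apply/orP; left; apply/eqP; ring.
rewrite ge0_integral_sum//; last 2 first.
- move=> i; apply: emeasurable_sum => l; apply: emeasurable_sum => m; exact: measurable_funeM.
- by move=> i x _; apply: sume_ge0 => l _; apply: sume_ge0 => m _; rewrite mule_ge0.
apply: lee_sum => i _; rewrite ge0_integral_sum//; last 2 first.
- move=> l; apply: emeasurable_sum => m; exact: measurable_funeM.
- by move=> l x _; apply: sume_ge0 => m _; rewrite mule_ge0.
apply: lee_sum => l _; rewrite ge0_integral_sum//; last 2 first.
- move=> m; exact: measurable_funeM.
- by move=> m x _; rewrite mule_ge0.
by apply: lee_sum => m _; rewrite ge0_integralZl.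
Qed.

(** Argued with suprema so that an infinite limit is included: if S is the supremum of the roots,
    then S^2 bounds the sequence. *)
Lemma cvg_sqrte (a : nat -> \bar R) (l : \bar R) : (forall n, 0 <= a n) ->
  nondecreasing_seq a -> a n @[n --> \oo] --> l -> a n `^ 2^-1 @[n --> \oo] --> l `^ 2^-1.
Proof.
move=> a0 nda al.
have el : l = ereal_sup (range a).
  by rewrite -(cvg_lim _ al)//; apply/cvg_lim => //; exact: ereal_nondecreasing_cvgn.
have nds : nondecreasing_seq (fun n => a n `^ 2^-1).
  by move=> m n mn; apply: le_sqrte => //; exact: nda.
have le_l n : a n <= l by rewrite el; apply: ereal_sup_ubound; exists n.
have l0 : 0 <= l by apply: (le_trans (a0 0%N)).
suff -> : l `^ 2^-1 = ereal_sup (range (fun n => a n `^ 2^-1)).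
  exact: ereal_nondecreasing_cvgn.
set S := ereal_sup _.
have leS n : a n `^ 2^-1 <= S by apply: ereal_sup_ubound; exists n.
have S0 : 0 <= S by apply: (le_trans (poweR_ge0 (a 0%N) 2^-1)).
apply/eqP; rewrite eq_le; apply/andP; split; last first.
  by apply: ge_ereal_sup => _ [n _ <-]; exact: le_sqrte.
have : l <= S `^ 2.
  rewrite el; apply: ge_ereal_sup => _ [n _ <-].
  have -> : a n = (a n `^ 2^-1) `^ 2 by rewrite -poweRrM mulVf// poweRe1.
  by apply: gt0_ler_poweR; rewrite ?in_itv/= ?poweR_ge0 ?leey ?S0.
move/(le_sqrte l0) => /le_trans; apply.
by rewrite -poweRrM divff// poweRe1.
Qed.

End atoms.

Section level_decomposition.
Local Open Scope ereal_scope.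
Context (R : realType) d (T : measurableType d)
  (mu : {sigma_finite_measure set T -> \bar R}) (M : T -> R)
  (u v w : T -> T -> T) (C : R) (G : bilinear_geometry mu M u v w C).

(* The level sets of F at the heights [rearr t] are enlarged by gauge balls of
   comparable volume, so that F * M ^ (- om) decays in t at the combined rate. *)
Record level_decomposition (F : T -> R) (p om K : R) (E : R -> set T) (c : R -> R) : Prop :=
  LevelDecomposition {
  lev_meas : forall t, measurable (E t) ;
  lev_mu : forall t, mu (E t) <= (expR t)%:E ;
  lev_mono : forall s t, (s <= t)%R -> E s `<=` E t ;
  lev_cover : forall x, exists n : nat, E n%:R x ;
  lev_c0 : forall t, (0 <= c t)%R ;
  lev_sum : forall n : nat, (\sum_(i < 2 * n) c (i%:R - n%:R) `^ p <= K)%R ;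
  lev_le : forall (n : nat) x, E n%:R x -> ~ E (- n%:R)%R x ->
    (F x * M x `^ (- om) <= \sum_(i < 2 * n) c (i%:R - n%:R) *
      expR (- ((i%:R - n%:R) * (p^-1 + om))) * \1_(E (i%:R - n%:R + 1)) x)%R
}.

Lemma ex_level_decomposition (p om : R) : (0 < p)%R -> (0 <= om)%R ->
  exists2 K : R, (0 < K)%R & forall F : T -> R, measurable_fun setT F ->
    (forall x, 0 <= F x)%R -> \int[mu]_x (F x `^ p)%:E <= 1 ->
    exists E c, level_decomposition F p om K E c.
Proof.
move=> p0 om0.
have C0 : (0 < C)%R by rewrite (lt_le_trans ltr01)//; exact: geo_C1 G.
pose B := ((C * expR 1) `^ om)%R.
have B0 : (0 < B)%R by rewrite powR_gt0// mulr_gt0// expR_gt0.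
exists (B `^ p * (expR 1 * (2 * 2 `^ p)))%R.
  by rewrite mulr_gt0 ?powR_gt0// mulr_gt0 ?expR_gt0// mulr_gt0// powR_gt0.
move=> F mF F0 Fp.
pose th := rearr mu F.
(* Each of the two pieces has measure at most e^(t-1), and 2 e^(t-1) <= e^t. Outside E t, F is below
   its rearrangement and M is at least of order e^t, so a power M^(-om) with om >= 0 is small as
   well. *)
pose E (t : R) := [set x | (th (t - 1) < F x)%R] `|` [set x | (M x <= expR (t - 1) / C)%R].
(* The factor e^(t/p) makes the p-th powers of c, up to constants, the terms summed in [sum_rearr];
   B absorbs the constants lost in M^(-om). *)
pose c (t : R) := (B * th (t - 1) * expR (t / p))%R.
have thg0 t : (0 <= th t)%R by exact: (rearr_ge0 p0 mF F0 Fp).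
exists E, c; split.
- move=> t; apply: measurableU; first exact: measurable_above.
  exact: (measurable_gauge_ball G).
- move=> t; apply: (@le_trans _ _ ((expR (t - 1))%:E + (expR (t - 1))%:E)).
    apply: (le_trans (measureU2 _ _ _)).
    + exact: measurable_above.
    + exact: (measurable_gauge_ball G).
    apply: leeD; first exact: (measure_above_rearr p0 mF F0 Fp).
    have h : (0 < expR (t - 1) / C)%R by rewrite divr_gt0// expR_gt0.
    apply: (le_trans (geo_vol_le G h)); rewrite -EFinM lee_fin mulrC divfK// gt_eqF//.
  have -> : expR t = (expR (t - 1) * expR 1)%R by rewrite -expRD subrK.
  rewrite -EFinD lee_fin; have := expR_ge1Dx (1 : R); have := expR_gt0 (t - 1).
  move: (expR (t - 1)) (expR 1) => x y x0 y1.
  have : (x * 2 <= x * y)%R by rewrite ler_wpM2l ?(ltW x0)//; lra.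
  lra.
- move=> s t st x [h|h].
    left; apply: le_lt_trans h; apply: (rearr_antitone p0 mF F0 Fp).
    by rewrite lerD2r.
  by right; apply: (le_trans h); rewrite ler_wpM2r ?invr_ge0 ?(ltW C0)// ler_expR lerD2r.
- move=> x; exists (Num.truncn (C * M x)).+2; right => /=.
  rewrite ler_pdivlMr// mulrC -natr1 addrK.
  apply: (le_trans (ltW (truncnS_gt _))).
  have := expR_ge1Dx ((Num.truncn (C * M x)).+1%:R : R); lra.
- by move=> t; rewrite /c !mulr_ge0 ?expR_ge0 ?(ltW B0).
- move=> n.
  have -> : (\sum_(i < 2 * n) c (i%:R - n%:R) `^ p =
     B `^ p * (expR 1 * \sum_(i < 2 * n) expR (- n%:R - 1 + i%:R) * th (- n%:R - 1 + i%:R) `^ p))%R.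
    rewrite !mulr_sumr; apply: eq_bigr => i _; rewrite /c.
    rewrite (_ : i%:R - n%:R - 1 = - n%:R - 1 + i%:R)%R; last by ring.
    rewrite !powRM ?mulr_ge0 ?expR_ge0 ?(ltW B0)//.
    rewrite -expRM (_ : (i%:R - n%:R) / p * p = 1 + (- n%:R - 1 + i%:R))%R; last first.
      by field; rewrite gt_eqF.
    by rewrite expRD; ring.
  rewrite ler_wpM2l ?powR_ge0// ler_wpM2l ?expR_ge0//.
  exact: (sum_rearr p0 mF F0 Fp).
- move=> n x En Enn.
  (* The step at which x enters the increasing family. Membership in E (j - n + 1) selects the
     summand, and absence from E (j - n) gives the bounds on F and M. *)
  have [j jn [Ej1 Ej]] : exists2 j : nat, (j < 2 * n)%N &
      E (j%:R - n%:R + 1)%R x /\ ~ E (j%:R - n%:R)%R x.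
    apply: contrapT => H.
    have : forall j : nat, (j <= 2 * n)%N -> ~ E (j%:R - n%:R)%R x.
      elim=> [_|j ih jn]; first by rewrite sub0r.
      move=> Ej; apply: H; exists j => //; split; last exact/ih/ltnW.
      by rewrite (_ : j%:R - n%:R + 1 = j.+1%:R - n%:R)%R// -natr1; ring.
    move=> /(_ (2 * n)%N (leqnn _)); apply.
    by rewrite (_ : (2 * n)%:R - n%:R = n%:R)%R// natrM; ring.
  have s0 (i : nat) : (0 <= c (i%:R - n%:R) * expR (- ((i%:R - n%:R) * (p^-1 + om))) *
       \1_(E (i%:R - n%:R + 1)) x)%R.
    by rewrite /c !mulr_ge0 ?expR_ge0 ?(ltW B0).
  rewrite (bigD1 (Ordinal jn))//= -[leLHS]addr0 lerD ?sumr_ge0//.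
  rewrite indicE mem_set// mulr1.
  set t := (j%:R - n%:R)%R.
  have [F1 M1] : (F x <= th (t - 1))%R /\ (expR (t - 1) / C < M x)%R.
    split; first by rewrite leNgt; apply/negP => h; apply: Ej; left.
    by rewrite ltNge; apply/negP => h; apply: Ej; right.
have et0 : (0 < expR (t - 1) / C)%R by rewrite divr_gt0// expR_gt0.
  have Mom : (M x `^ (- om) <= B * expR (- (t * om)))%R.
    have -> : (B * expR (- (t * om)) = ((expR (t - 1) / C) `^ om)^-1)%R.
      have EC : C = expR (ln C) by rewrite lnK// posrE.
      rewrite /B; move: EC; set k := ln C => ->.
      by rewrite -expRN -!expRD -!expRM -expRN -expRD; congr expR; ring.
    rewrite powRN lef_pV2 ?posrE ?powR_gt0 ?et0 ?(lt_trans et0 M1)//.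
    by rewrite ge0_ler_powR ?nnegrE ?(ltW et0) ?(ltW M1)// (geo_M0 G).
  apply: (@le_trans _ _ (th (t - 1) * (B * expR (- (t * om))))%R).
    by rewrite ler_pM// powR_ge0.
  rewrite /c le_eqVlt; apply/orP; left; apply/eqP.
  have -> : expR (- (t * om)) = (expR (t / p) * expR (- (t * (p^-1 + om))))%R.
    by rewrite -expRD; congr expR; ring.
  by ring.
Qed.

End level_decomposition.

(** * Nonnegative weights *)

Section integral_lemmas.
Local Open Scope ereal_scope.
Context (R : realType) d (T : measurableType d) (mu : {measure set T -> \bar R}).

Lemma integral_eq_null (f g : T -> \bar R) (N : set T) :
  measurable_fun setT f -> measurable_fun setT g ->
  (forall x, 0 <= f x) -> (forall x, 0 <= g x) ->
  measurable N -> mu N = 0 -> (forall x, ~ N x -> f x = g x) ->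
  \int[mu]_x f x = \int[mu]_x g x.
Proof.
move=> mf mg f0 g0 mN N0 h; apply: ge0_ae_eq_integral => //.
exists N; split => // x /= hx; apply: contrapT => Nx; apply: hx => _; exact: h.
Qed.

Lemma le_integral_null (f g : T -> \bar R) (N : set T) :
  measurable_fun setT f -> measurable_fun setT g ->
  (forall x, 0 <= f x) -> (forall x, 0 <= g x) ->
  measurable N -> mu N = 0 -> (forall x, ~ N x -> f x <= g x) ->
  \int[mu]_x f x <= \int[mu]_x g x.
Proof.
move=> mf mg f0 g0 mN N0 h; apply: ae_ge0_le_integral => //.
exists N; split => // x /= hx; apply: contrapT => Nx; apply: hx => _; exact: h.
Qed.

Lemma cvg_integral_nondecreasing (f_ : nat -> T -> \bar R) (f : T -> \bar R) :
  (forall n, measurable_fun setT (f_ n)) -> (forall n x, 0 <= f_ n x) ->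
  (forall x, nondecreasing_seq (f_^~ x)) -> (forall x, f_ n x @[n --> \oo] --> f x) ->
  \int[mu]_x f_ n x @[n --> \oo] --> \int[mu]_x f x.
Proof.
move=> mf f0 nd cv.
have -> : \int[mu]_x f x = \int[mu]_x limn (f_^~ x).
  by apply: eq_integral => x _; apply/esym/cvg_lim => //; exact: cv.
by apply: cvg_monotone_convergence.
Qed.

Lemma integral_le_of_nondecreasing (f_ : nat -> T -> \bar R) (f : T -> \bar R) (K : \bar R) :
  (forall n, measurable_fun setT (f_ n)) -> (forall n x, 0 <= f_ n x) ->
  (forall x, nondecreasing_seq (f_^~ x)) -> (forall x, f_ n x @[n --> \oo] --> f x) ->
  (forall n, \int[mu]_x f_ n x <= K) -> \int[mu]_x f x <= K.
Proof.
move=> mf f0 nd cv hK; have h := cvg_integral_nondecreasing mf f0 nd cv.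
rewrite -(cvg_lim _ h)//; apply: lime_le; last exact: nearW.
by apply/cvg_ex; eexists; exact: h.
Qed.

End integral_lemmas.

Section kernel_approximation.
Local Open Scope ereal_scope.
Context (R : realType) d (T : measurableType d)
  (mu : {sigma_finite_measure set T -> \bar R}) (M : T -> R)
  (u v w : T -> T -> T) (C : R) (G : bilinear_geometry mu M u v w C).

Lemma kernel_approximation (t e1 e2 g : R) : (e1 + e2 + 2 * g + t = 3)%R ->
  (0 < e1 < 1)%R -> (0 < e2 < 1)%R -> (0 < g < 1)%R -> (0 <= t < 1)%R ->
  exists A eps (k_ : nat -> T -> R), [/\ (0 < A)%R, (0 < eps)%R,
    forall n, kernel_bound mu u v (k_ n) A e1 e2 g eps,
    (forall n, measurable_fun setT (k_ n)) &
    [/\ forall n y, (0 <= k_ n y)%R,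
        forall m n y, (m <= n)%N -> (k_ m y <= k_ n y)%R &
        forall y, exists N, forall n, (N <= n)%N -> k_ n y = (M y `^ (- t))%R]].
Proof.
move=> hs h1 h2 h3 /andP[]; rewrite le_eqVlt => /predU1P[t0|t0] t1.
  rewrite -t0 addr0 in hs.
  have [eps eps0 hk] := kernel_bound_cst G hs h1 h2 h3.
  exists 1%R, eps, (fun _ _ => 1%R); split => //; split => //.
  by move=> y; exists 0%N => n _; rewrite -t0 oppr0 powRr0.
have ht : (0 < t < 1)%R by rewrite t0.
have [A [eps [A0 eps0 hk]]] := kernel_bound_power G hs h1 h2 h3 ht.
exists A, eps, (trunc_power M t); split => //.
  by move=> n; exact: (measurable_trunc_power G).
split.
- by move=> n y; exact: trunc_power_ge0.
- move=> m n y mn; rewrite ler_wpM2l ?powR_ge0// !indicE.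
  have [/set_mem[a b]|_] := boolP (y \in _ `\` _); last by [].
  rewrite mem_set//; split => /=.
    by apply: (le_trans a); rewrite ler_expR ler_nat.
  by move=> h; apply: b => /=; apply: (le_trans h); rewrite ler_expR lerN2 ler_nat.
- move=> y; have [M0|M0] := leP (M y) 0%R.
    (* By the convention that a nonzero power of 0 is 0, the full kernel vanishes where M y = 0 and
       so agrees with its truncations there. *)
    exists 0%N => n _; have My : M y = 0%R by apply/eqP; rewrite eq_le M0 (geo_M0 G).
    by rewrite /trunc_power My powR0 ?mul0r// oppr_eq0 gt_eqF.
  exists (Num.truncn `|ln (M y)|%R).+1 => n hn.
  rewrite /trunc_power indicE mem_set ?mulr1//.
  have e : M y = expR (ln (M y)) by rewrite lnK.
  have ln : (`|ln (M y)| < n%:R)%R.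
    by apply: (lt_le_trans (truncnS_gt _)); rewrite ler_nat.
  move: ln; rewrite ltr_norml => /andP[l1 l2]; split => /=.
    by rewrite e ler_expR ltW.
  by apply/negP; rewrite -ltNge e ltr_expR.
Qed.

End kernel_approximation.

Section level_decomposition_theory.
Local Open Scope ereal_scope.
Context (R : realType) d (T : measurableType d)
  (mu : {sigma_finite_measure set T -> \bar R}) (M : T -> R)
  (F : T -> R) (p om K : R) (E : R -> set T) (c : R -> R)
  (L : level_decomposition mu M F p om K E c).

Definition annulus (n : nat) : set T := E n%:R `\` E (- n%:R)%R.
(** The points that no annulus reaches. Off this null set the indicators of [annulus n] are
    eventually 1. *)
Definition level_null : set T := \bigcap_n E (- n%:R)%R.

Lemma measurable_annulus n : measurable (annulus n).
Proof. by apply: measurableD; exact: lev_meas L _. Qed.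

Lemma measurable_level_null : measurable level_null.
Proof. by apply: bigcapT_measurable => n; exact: lev_meas L _. Qed.

Lemma level_null0 : mu level_null = 0.
Proof.
apply/eqP; rewrite eq_le measure_ge0 andbT; apply/lee_addgt0Pr => e e0.
rewrite add0e; pose n := (Num.truncn `|ln e|%R).+1.
have hn : (`|ln e| < n%:R)%R by exact: truncnS_gt.
apply: (@le_trans _ _ (mu (E (- n%:R)%R))).
  apply: le_measure; rewrite ?inE.
  - exact: measurable_level_null.
  - exact: lev_meas L _.
  - by move=> x; exact.
apply: (le_trans (lev_mu L _)); rewrite lee_fin -[leRHS]lnK ?posrE// ler_expR.
by move: hn; rewrite ltr_norml => /andP[? _]; exact: ltW.
Qed.

Lemma le_indic_annulus m n x : (m <= n)%N -> (\1_(annulus m) x <= \1_(annulus n) x :> R)%R.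
Proof.
move=> mn; rewrite !indicE; have [/set_mem[a b]|_] := boolP (x \in annulus m); last by [].
rewrite mem_set//; split; first by apply: (lev_mono L) a; rewrite ler_nat.
by move=> h; apply: b; apply: (lev_mono L) h; rewrite lerN2 ler_nat.
Qed.

Lemma indic_annulus_near x : exists N : nat, forall n, (N <= n)%N ->
  \1_(annulus n) x = \1_(~` level_null) x :> R.
Proof.
have [a ha] := lev_cover L x.
have [z|z] := pselect (level_null x).
  exists 0%N => n _; rewrite !indicE (_ : x \in annulus n = false); last first.
    by apply: memNset => -[_]; apply; exact: z.
  by rewrite memNset// => /(_ z).
have [b hb] : exists b : nat, ~ E (- b%:R)%R x.
  by apply/existsNP => h; apply: z => k _; exact: h.
exists (maxn a b) => n; rewrite geq_max => /andP[an bn].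
rewrite !indicE !mem_set//; split; first by apply: (lev_mono L) ha; rewrite ler_nat.
by move=> h; apply: hb; apply: (lev_mono L) h; rewrite lerN2 ler_nat.
Qed.

Definition level_coef (n : nat) (i : nat) : R :=
  (c (i%:R - n%:R) * expR (- ((i%:R - n%:R) * (p^-1 + om))))%R.

Lemma level_coef_ge0 n i : (0 <= level_coef n i)%R.
Proof. by rewrite mulr_ge0 ?expR_ge0//; exact: lev_c0 L _. Qed.

Lemma level_annulus_le n x : (F x * M x `^ (- om) * \1_(annulus n) x <=
  \sum_(i < 2 * n) level_coef n i * \1_(E (i%:R - n%:R + 1)) x)%R.
Proof.
rewrite indicE; have [/set_mem[a b]|_] := boolP (x \in annulus n).
  by rewrite mulr1; exact: lev_le L _ _ _ _.
by rewrite mulr0; apply: sumr_ge0 => i _; rewrite mulr_ge0 ?level_coef_ge0 ?indic_ge0.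
Qed.

End level_decomposition_theory.

Section nonnegative_weights.
Local Open Scope ereal_scope.
Context (R : realType) d (T : measurableType d)
  (mu : {sigma_finite_measure set T -> \bar R}) (M : T -> R)
  (u v w : T -> T -> T) (C : R) (G : bilinear_geometry mu M u v w C).

Let mind (A : set T) : measurable A -> measurable_fun setT (\1_A : T -> R).
Proof. by move=> mA; exact: measurable_indic. Qed.

Let mMp (a : R) : measurable_fun setT (fun x => M x `^ a)%R.
Proof. exact: (measurableT_comp (@measurable_powR R a) (geo_mM G)). Qed.

(** For every x, and not merely almost every x, the preimages of the null sets under u x and v x are
    null by invariance. *)
Lemma biform_null (f g k : T -> R) (N1 N2 : set T) x :
  measurable_fun setT f -> measurable_fun setT g -> measurable_fun setT k ->
  (forall x, 0 <= f x)%R -> (forall x, 0 <= g x)%R -> (forall x, 0 <= k x)%R ->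
  measurable N1 -> measurable N2 -> mu N1 = 0 -> mu N2 = 0 ->
  biform mu u v f g k x =
  biform mu u v (fun x => f x * \1_(~` N1) x)%R (fun x => g x * \1_(~` N2) x)%R k x.
Proof.
move=> mf mg mk f0 g0 k0 mN1 mN2 z1 z2.
have int_indic (D : set T) : measurable D -> \int[mu]_x (\1_D x)%:E = mu D.
  by move=> mD; rewrite integral_indic// setIT.
have minde (A : set T) : measurable A -> measurable_fun setT (fun x => (\1_A x : R)%:E).
  by move=> mA; apply/measurable_EFinP; exact: measurable_indic.
have i0 (A : set T) y : 0 <= (\1_A y : R)%:E by rewrite lee_fin indicE.
have mU : measurable_fun setT (u x) by exact: (measurableT_comp (geo_mu G) (pair1_measurable x)).
have mV : measurable_fun setT (v x) by exact: (measurableT_comp (geo_mv G) (pair1_measurable x)).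
have mP1 : measurable (u x @^-1` N1) by rewrite -[X in measurable X]setTI; exact: mU.
have mP2 : measurable (v x @^-1` N2) by rewrite -[X in measurable X]setTI; exact: mV.
have p1 : mu (u x @^-1` N1) = 0.
  have [iu _ _ _] := geo_int G (minde _ mN1) (i0 N1).
  by rewrite -int_indic// -z1 -(int_indic N1)// -(iu x).
have p2 : mu (v x @^-1` N2) = 0.
  have [_ iv _ _] := geo_int G (minde _ mN2) (i0 N2).
  by rewrite -int_indic// -z2 -(int_indic N2)// -(iv x).
have mf' : measurable_fun setT (fun x => f x * \1_(~` N1) x)%R.
  by apply: measurable_funM => //; apply: mind; exact: measurableC.
have mg' : measurable_fun setT (fun x => g x * \1_(~` N2) x)%R.
  by apply: measurable_funM => //; apply: mind; exact: measurableC.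
rewrite /biform; apply: (@integral_eq_null _ _ _ _ _ _ (u x @^-1` N1 `|` v x @^-1` N2)).
- exact: (measurable_biform_integrand G).
- exact: (measurable_biform_integrand G mf' mg' mk x).
- by move=> y; rewrite lee_fin !mulr_ge0.
- by move=> y; rewrite lee_fin !mulr_ge0 ?indic_ge0.
- exact: measurableU.
- by apply: null_set_setU.
- move=> y h; congr ((_ * _ * _)%:E).
    by rewrite indicE mem_set ?mulr1// => h1; apply: h; left.
  by rewrite indicE mem_set ?mulr1// => h1; apply: h; right.
Qed.

Variables (p q r om1 om2 om3 tau : R).
Hypotheses (p1 : (1 < p)%R) (q1 : (1 < q)%R) (r0 : (0 < r)%R)
  (hr : (r^-1 <= p^-1 + q^-1)%R)
  (om10 : (0 <= om1)%R) (om20 : (0 <= om2)%R) (om30 : (0 <= om3)%R)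
  (tau0 : (0 <= tau < 1)%R)
  (h1 : (p^-1 + om1 < 1)%R) (h2 : (q^-1 + om2 < 1)%R) (h3 : (om3 < r^-1)%R)
  (hs : (om1 + om2 + om3 + tau = 1 + r^-1 - p^-1 - q^-1)%R).

Let p0 : (0 < p)%R. Proof. exact: lt_trans p1. Qed.
Let q0 : (0 < q)%R. Proof. exact: lt_trans q1. Qed.
Let pi : (0 < p^-1 < 1)%R. Proof. by rewrite invr_gt0 p0 invf_lt1. Qed.
Let qi : (0 < q^-1 < 1)%R. Proof. by rewrite invr_gt0 q0 invf_lt1. Qed.
Let ri : (0 < r^-1)%R. Proof. by rewrite invr_gt0. Qed.

Let P := (2 * r)%R.
Let S := (P / (P - 1))%R.

Let r2 : (1 < P)%R.
Proof.
have ri2 : (r^-1 < 2)%R by have /andP[_ ?] := pi; have /andP[_ ?] := qi; have := hr; lra.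
by have := ltr_pM2l r0 (r^-1)%R 2%R; rewrite ri2 mulfV ?gt_eqF// mulrC.
Qed.

Let Si : (S^-1 = 1 - r^-1 / 2)%R.
Proof. by rewrite /S invf_div /P; have := r2; rewrite /P => ?; field; rewrite gt_eqF. Qed.

Let S0 : (0 < S)%R.
Proof. by rewrite /S divr_gt0 ?subr_gt0//; have := r2; lra. Qed.

(** A factor in L^p contributes 1/p to the exponent of the measure of its level sets, and its weight
    contributes om. The weight om3 sits outside the form, so the square root halves it before it
    reaches h. *)
Let e1 := (p^-1 + om1)%R.
Let e2 := (q^-1 + om2)%R.
Let e3 := (S^-1 + om3 / 2)%R.

(** The square root paired with h in the dual of L^(2r). The three hypotheses on norms are
    normalisations, removed later by homogeneity. *)
Let tested : exists2 K : R, (0 < K)%R & forall F H h : T -> R,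
  measurable_fun setT F -> measurable_fun setT H -> measurable_fun setT h ->
  (forall x, 0 <= F x)%R -> (forall x, 0 <= H x)%R -> (forall x, 0 <= h x)%R ->
  \int[mu]_x (F x `^ p)%:E <= 1 -> \int[mu]_x (H x `^ q)%:E <= 1 ->
  \int[mu]_x (h x `^ S)%:E <= 1 ->
  \int[mu]_x ((h x * M x `^ (- (om3 / 2)))%:E *
    biform mu u v (fun x => F x * M x `^ (- om1))%R (fun x => H x * M x `^ (- om2))%R
      (fun y => M y `^ (- tau))%R x `^ 2^-1) <= K%:E.
Proof.
have [K1 K10 hK1] := ex_level_decomposition G p0 om10.
have [K2 K20 hK2] := ex_level_decomposition G q0 om20.
have om32 : (0 <= om3 / 2)%R by rewrite divr_ge0.
have [K3 K30 hK3] := ex_level_decomposition G S0 om32.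
have /andP[pi0 pi1] := pi; have /andP[qi0 qi1] := qi; have Sv := Si.
have hsum : (e1 + e2 + 2 * e3 + tau = 3)%R by rewrite /e1 /e2 /e3 Sv; have := hs; lra.
have g1 : (0 < e1 < 1)%R by rewrite /e1 h1 andbT ltr_wpDr.
have g2 : (0 < e2 < 1)%R by rewrite /e2 h2 andbT ltr_wpDr.
have g3 : (0 < e3 < 1)%R by rewrite /e3 Sv; apply/andP; split; have := hr; have := h3; have := om30; lra.
have [A [eps [k_ [A0 eps0 hk mk [k0 ndk cvk]]]]] := kernel_approximation G hsum g1 g2 g3 tau0.
have P1 : (0 < 2 * p)%R by rewrite mulr_gt0.
have P2 : (0 < 2 * q)%R by rewrite mulr_gt0.
(* The coefficients of f and g enter under a root, so they are summable to the powers 2p and 2q.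
   Since 1/S = 1 - 1/(2r), the condition of [trilinear_sum_le] is half of 1/r <= 1/p + 1/q. *)
have hP : (1 <= (2 * p)^-1 + (2 * q)^-1 + S^-1)%R.
  by rewrite Sv (invfM 2%R p) (invfM 2%R q); have := hr; lra.
have [K K0 hK] := trilinear_sum_le eps0 P1 P2 S0 hP K10 K20 K30.
(* The exponential pays for an index shift: the i-th coefficient is taken at i - n, while its set
   has measure up to e^(i - n + 1). *)
pose B := (A * expR ((e1 + e2 + 2 * e3) / 2))%R.
have B0 : (0 < B)%R by rewrite mulr_gt0// expR_gt0.
exists (B * K)%R; first by rewrite mulr_gt0.
move=> F H h mF mH mh F0 H0 h0 Fp Hq hS.
have [E1 [c1 L1]] := hK1 F mF F0 Fp.
have [E2 [c2 L2]] := hK2 H mH H0 Hq.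
have [E3 [c3 L3]] := hK3 h mh h0 hS.
pose f n x := (F x * M x `^ (- om1) * \1_(annulus E1 n) x)%R.
pose g n x := (H x * M x `^ (- om2) * \1_(annulus E2 n) x)%R.
pose hh n x := (h x * M x `^ (- (om3 / 2)) * \1_(annulus E3 n) x)%R.
have mf n : measurable_fun setT (f n).
  apply: measurable_funM; first by apply: measurable_funM => //; exact: mMp.
  by apply: mind; exact: measurable_annulus L1 n.
have mg n : measurable_fun setT (g n).
  apply: measurable_funM; first by apply: measurable_funM => //; exact: mMp.
  by apply: mind; exact: measurable_annulus L2 n.
have mhh n : measurable_fun setT (hh n).
  apply: measurable_funM; first by apply: measurable_funM => //; exact: mMp.
  by apply: mind; exact: measurable_annulus L3 n.
have f0 n x : (0 <= f n x)%R by rewrite !mulr_ge0 ?powR_ge0 ?indic_ge0.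
have g0 n x : (0 <= g n x)%R by rewrite !mulr_ge0 ?powR_ge0 ?indic_ge0.
have hh0 n x : (0 <= hh n x)%R by rewrite !mulr_ge0 ?powR_ge0 ?indic_ge0.
have bound n : \int[mu]_x ((hh n x)%:E * biform mu u v (f n) (g n) (k_ n) x `^ 2^-1) <= (B * K)%:E.
  apply: (le_trans (atomic_bound G (mf n) (mg n) (mhh n) (mk n) (f0 n) (g0 n) (hh0 n) (k0 n)
    (level_coef_ge0 L1 n) (level_coef_ge0 L2 n) (level_coef_ge0 L3 n)
    (fun i => lev_meas L1 (i%:R - n%:R + 1)) (fun i => lev_meas L2 (i%:R - n%:R + 1))
    (fun i => lev_meas L3 (i%:R - n%:R + 1))
    (level_annulus_le L1 n) (level_annulus_le L2 n) (level_annulus_le L3 n))).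
  pose x i := (c1 (i%:R - n%:R) `^ 2^-1)%R.
  pose y i := (c2 (i%:R - n%:R) `^ 2^-1)%R.
  pose z i := c3 (i%:R - n%:R)%R.
  apply: (@le_trans _ _ (\sum_(i < 2 * n) \sum_(l < 2 * n) \sum_(m < 2 * n)
    (B * (x i * y l * z m * expR (- (eps * (`|i%:R - l%:R| + `|i%:R - m%:R|)))))%:E)).
    apply: lee_sum => i _; apply: lee_sum => l _; apply: lee_sum => m _.
    apply: (le_trans (lee_wpmul2l _ (hk n _ _ _ _ _ _ (lev_meas L1 _) (lev_meas L2 _)
      (lev_meas L3 _) (lev_mu L1 _) (lev_mu L2 _) (lev_mu L3 _)))).
      by rewrite lee_fin; apply: mulr_ge0; [apply: mulr_ge0; exact: powR_ge0|exact: level_coef_ge0 L3 n m].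
    rewrite -EFinM lee_fin /level_coef !powRM ?expR_ge0 ?(lev_c0 L1) ?(lev_c0 L2)//.
    rewrite -!expRM.
    rewrite (_ : (i%:R - n%:R + 1 - (l%:R - n%:R + 1) = i%:R - l%:R)%R); last by ring.
    rewrite (_ : (i%:R - n%:R + 1 - (m%:R - n%:R + 1) = i%:R - m%:R)%R); last by ring.
    rewrite -/(x i) -/(y l) -/(z m) -/e1 -/e2 -/e3 /B.
    set D := (eps * _)%R.
    move: (x i) (y l) (z m) => X Y Z.
    have ee (a b c a' d' : R) : (a + b + c + a' = d')%R ->
        (X * expR a * (Y * expR b) * (Z * expR c) * (A * expR a') = X * Y * Z * A * expR d')%R.
      by move=> <-; rewrite !expRD; ring.
    rewrite (ee _ _ _ _ ((e1 + e2 + 2 * e3) / 2 - D)%R); last by field.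
    by rewrite expRD le_eqVlt; apply/orP; left; apply/eqP; ring.
  have -> : \sum_(i < 2 * n) \sum_(l < 2 * n) \sum_(m < 2 * n)
      (B * (x i * y l * z m * expR (- (eps * (`|i%:R - l%:R| + `|i%:R - m%:R|)))))%:E =
    (B * (\sum_(i < 2 * n) \sum_(l < 2 * n) \sum_(m < 2 * n)
      x i * y l * z m * expR (- (eps * (`|i%:R - l%:R| + `|i%:R - m%:R|)))))%R%:E.
    rewrite mulr_sumr -sumEFin; apply: eq_bigr => i _.
    rewrite mulr_sumr -sumEFin; apply: eq_bigr => l _.
    by rewrite mulr_sumr -sumEFin; apply: eq_bigr.
  rewrite lee_fin ler_pM2l//; apply: hK.
  - by move=> i; exact: powR_ge0.
  - by move=> i; exact: powR_ge0.
  - by move=> i; exact: lev_c0 L3 _.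
  - apply: le_trans (lev_sum L1 n); apply: ler_sum => i _.
    by rewrite /x -powRrM mulKf.
  - apply: le_trans (lev_sum L2 n); apply: ler_sum => i _.
    by rewrite /y -powRrM mulKf.
  - exact: lev_sum L3 n.
pose N1 := level_null E1; pose N2 := level_null E2; pose N3 := level_null E3.
have mN1 : measurable N1 by exact: measurable_level_null L1.
have mN2 : measurable N2 by exact: measurable_level_null L2.
have mN3 : measurable N3 by exact: measurable_level_null L3.
pose ft x := (F x * M x `^ (- om1))%R.
pose gt x := (H x * M x `^ (- om2))%R.
pose kt y := (M y `^ (- tau))%R.
have mft : measurable_fun setT ft by apply: measurable_funM => //; exact: mMp.
have mgt : measurable_fun setT gt by apply: measurable_funM => //; exact: mMp.
have mkt : measurable_fun setT kt by exact: mMp.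
have ft0 x : (0 <= ft x)%R by rewrite mulr_ge0 ?powR_ge0.
have gt0 x : (0 <= gt x)%R by rewrite mulr_ge0 ?powR_ge0.
have kt0 x : (0 <= kt x)%R by exact: powR_ge0.
pose f' x := (ft x * \1_(~` N1) x)%R.
pose g' x := (gt x * \1_(~` N2) x)%R.
have mf' : measurable_fun setT f'.
  by apply: measurable_funM => //; apply: mind; exact: measurableC.
have mg' : measurable_fun setT g'.
  by apply: measurable_funM => //; apply: mind; exact: measurableC.
have f'0 x : (0 <= f' x)%R by rewrite mulr_ge0 ?indic_ge0.
have g'0 x : (0 <= g' x)%R by rewrite mulr_ge0 ?indic_ge0.
have mB n : measurable_fun setT (biform mu u v (f n) (g n) (k_ n)).
  by apply: (measurable_biform G).
have mB' : measurable_fun setT (biform mu u v f' g' kt).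
  by apply: (measurable_biform G).
have mBt : measurable_fun setT (biform mu u v ft gt kt).
  by apply: (measurable_biform G).
have ndf m n x : (m <= n)%N -> (f m x <= f n x)%R.
  by move=> mn; rewrite ler_wpM2l ?mulr_ge0 ?powR_ge0//; exact: le_indic_annulus L1 _ _ _ mn.
have ndg m n x : (m <= n)%N -> (g m x <= g n x)%R.
  by move=> mn; rewrite ler_wpM2l ?mulr_ge0 ?powR_ge0//; exact: le_indic_annulus L2 _ _ _ mn.
have ndh m n x : (m <= n)%N -> (hh m x <= hh n x)%R.
  by move=> mn; rewrite ler_wpM2l ?mulr_ge0 ?powR_ge0//; exact: le_indic_annulus L3 _ _ _ mn.
have ndB x : nondecreasing_seq (fun n => biform mu u v (f n) (g n) (k_ n) x).
  move=> m n mn; apply: (biform_le G) => // y; [exact: ndf|exact: ndg|exact: ndk].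
have cB x : biform mu u v (f n) (g n) (k_ n) x @[n --> \oo] --> biform mu u v f' g' kt x.
  apply: cvg_integral_nondecreasing.
  - by move=> n; exact: (measurable_biform_integrand G).
  - by move=> n y; rewrite lee_fin; exact: mulr_ge0 (mulr_ge0 (f0 _ _) (g0 _ _)) (k0 _ _).
  - move=> y m n mn; rewrite lee_fin.
    apply: ler_pM (ndk _ _ _ mn) => //; first exact: mulr_ge0 (f0 _ _) (g0 _ _).
    by apply: ler_pM (ndf _ _ _ mn) (ndg _ _ _ mn).
  - move=> y; apply: cvg_near_cst.
    have [n1 hn1] := indic_annulus_near L1 (u x y).
    have [n2 hn2] := indic_annulus_near L2 (v x y).
    have [n3 hn3] := cvk y.
    exists (maxn n1 (maxn n2 n3)) => // n /=; rewrite !geq_max => /and3P[a1 a2 a3].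
    by rewrite /f /g hn1// hn2// hn3.
(* The truncated forms converge to the form with the three null sets removed, so the removal is made
   explicit before passing to the limit. *)
rewrite (_ : \int[mu]_x _ = \int[mu]_x ((h x * M x `^ (- (om3 / 2)) * \1_(~` N3) x)%:E *
  biform mu u v f' g' kt x `^ 2^-1)); last first.
  apply: (@integral_eq_null _ _ _ _ _ _ N3).
  - apply: emeasurable_funM; last exact: (measurableT_comp (@measurable_poweR R 2^-1) mBt).
    by apply/measurable_EFinP; apply: measurable_funM => //; exact: mMp.
  - apply: emeasurable_funM; last exact: (measurableT_comp (@measurable_poweR R 2^-1) mB').
    apply/measurable_EFinP; apply: measurable_funM; first by apply: measurable_funM => //; exact: mMp.
    by apply: mind; exact: measurableC.
  - by move=> x; rewrite mule_ge0 ?poweR_ge0// lee_fin mulr_ge0 ?powR_ge0.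
  - by move=> x; rewrite mule_ge0 ?poweR_ge0// lee_fin !mulr_ge0 ?powR_ge0 ?indic_ge0.
  - exact: mN3.
  - exact: level_null0 L3.
  - move=> x hx; rewrite indicE mem_set// mulr1; congr (_ * _ `^ _).
    by apply: biform_null => //; [exact: level_null0 L1|exact: level_null0 L2].
apply: (integral_le_of_nondecreasing _ _ _ _ bound).
- move=> n; apply: emeasurable_funM; last exact: (measurableT_comp (@measurable_poweR R 2^-1) (mB n)).
  exact/measurable_EFinP.
- by move=> n x; rewrite mule_ge0 ?poweR_ge0// lee_fin.
- move=> x m n mn; apply: lee_pmul; rewrite ?poweR_ge0 ?lee_fin//; first exact: ndh.
  by apply: le_sqrte; [exact: biform_ge0|exact: ndB].
- move=> x; have [n3 hn3] := indic_annulus_near L3 x.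
  have cc : (h x * M x `^ (- (om3 / 2)) * \1_(~` N3) x)%:E * biform mu u v (f n) (g n) (k_ n) x `^ 2^-1
      @[n --> \oo] --> (h x * M x `^ (- (om3 / 2)) * \1_(~` N3) x)%:E * biform mu u v f' g' kt x `^ 2^-1.
    apply: cvgeZl => //; apply: cvg_sqrte (ndB x) (cB x) => n.
    exact: biform_ge0.
  apply: cvg_trans cc; apply: near_eq_cvg; exists n3 => // n /= hn.
  by rewrite /hh hn3.
Qed.

Lemma nonnegative_weights_bound : exists2 K : R, (0 < K)%R & forall F H : T -> R,
  measurable_fun setT F -> measurable_fun setT H ->
  (forall x, 0 <= F x)%R -> (forall x, 0 <= H x)%R ->
  \int[mu]_x (F x `^ p)%:E <= 1 -> \int[mu]_x (H x `^ q)%:E <= 1 ->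
  \int[mu]_x (((M x `^ (- om3))%:E *
    biform mu u v (fun x => F x * M x `^ (- om1))%R (fun x => H x * M x `^ (- om2))%R
      (fun y => M y `^ (- tau))%R x) `^ r) <= K%:E.
Proof.
have [K K0 hK] := tested; exists (K `^ P)%R; first by rewrite powR_gt0.
move=> F H mF mH F0 H0 Fp Hq.
have := hK F H ^~ mF; set Bf := biform _ _ _ _ _ _ => tB.
have mB : measurable_fun setT Bf.
  by apply: (measurable_biform G);
    [apply: measurable_funM => //; exact: mMp|apply: measurable_funM => //; exact: mMp|
     exact: mMp|move=> x; rewrite mulr_ge0 ?powR_ge0|move=> x; rewrite mulr_ge0 ?powR_ge0|
     move=> x; exact: powR_ge0].
have B0 x : 0 <= Bf x.
  by apply: biform_ge0 => y; rewrite ?mulr_ge0 ?powR_ge0.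
(* Since P / 2 = r, the P-th power of phi is the integrand to be bounded. *)
pose phi x := ((M x `^ (- om3))%:E * Bf x) `^ 2^-1.
have c0 x : 0 <= (M x `^ (- om3))%:E by rewrite lee_fin powR_ge0.
rewrite (_ : \int[mu]_x _ = \int[mu]_x (phi x `^ P)); last first.
  by apply: eq_integral => x _; rewrite /phi -poweRrM mulKf.
apply: (@duality _ _ _ mu phi (fun n => [set x | (M x <= n.+1%:R)%R])).
- exact: r2.
- exact: ltW.
- apply: (measurableT_comp (@measurable_poweR R 2^-1)); apply: emeasurable_funM mB.
  by apply/measurable_EFinP; exact: mMp.
- by move=> x; exact: poweR_ge0.
- by move=> n; exact: (measurable_gauge_ball G).
- move=> n; apply: (le_lt_trans (geo_vol_le G _)); first by rewrite ltr0n.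
  by rewrite -EFinM ltry.
- move=> m n mn; apply/subsetPset => x /= h; apply: (le_trans h); rewrite ler_nat ltnS//.
- move=> x; exists (Num.truncn (M x)) => /=; exact: ltW (truncnS_gt _).
- move=> h mh h0 hS.
  rewrite (_ : \int[mu]_x _ =
    \int[mu]_x ((h x * M x `^ (- (om3 / 2)))%:E * Bf x `^ 2^-1)); last first.
    apply: eq_integral => x _; rewrite /phi poweRM// muleC EFinM -muleA; congr (_ * (_ * _)).
    by rewrite /= -powRrM mulNr.
  exact: hK.
Qed.

End nonnegative_weights.

(** * Signed weights *)

Section real_weights.
Variable R : realType.

(* After fixing the first exponent, the remaining mass W - max(o, 0) is spread
   proportionally to the room left below the caps. *)
Lemma exponent_choice (c1 c2 c3 c4 o W : R) : 0 < c1 -> 0 < c2 -> 0 < c3 -> 0 < c4 ->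
  o < c1 -> o <= W -> 0 <= W -> W < c1 + c2 + c3 + c4 ->
  exists o1 o2 o3 o4, [/\ 0 <= o1 < c1, 0 <= o2 < c2, 0 <= o3 < c3, 0 <= o4 < c4 &
    o <= o1 /\ o1 + o2 + o3 + o4 = W].
Proof.
move=> c10 c20 c30 c40 oc oW W0 Wc.
have [b [b0 bo bc bW]] : exists b : R, [/\ 0 <= b, o <= b, b < c1 & b <= W].
  exists (Num.max o 0); split; first by rewrite le_max lexx orbT.
  - by rewrite le_max lexx.
  - by rewrite gt_max oc c10.
  - by rewrite ge_max oW W0.
have s0 : 0 < c1 + c2 + c3 + c4 - b by lra.
pose t := (W - b) / (c1 + c2 + c3 + c4 - b).
have t0 : 0 <= t by rewrite divr_ge0//; lra.
have t1 : t < 1 by rewrite ltr_pdivrMr//; lra.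
have cap c : 0 < c -> 0 <= t * c < c.
  by move=> h; rewrite mulr_ge0//= ?(ltW h)// -{2}[c]mul1r ltr_pM2r.
have e : t * (c1 + c2 + c3 + c4 - b) = W - b by rewrite divfK// gt_eqF.
have /andP[u0 u1] := cap (c1 - b) ltac:(by rewrite subr_gt0).
exists (b + t * (c1 - b)), (t * c2), (t * c3), (t * c4); split; rewrite ?cap//.
  by apply/andP; split; lra.
split; first lra.
by rewrite -[RHS](subrK b) -e; ring.
Qed.

(** The x_j are logarithms of gauges, x1 the smallest and the others within kappa of each other's
    reference x2. Equal totals make the exponents differ by (w1 - o1)(x2 - x1), which has the
    favourable sign, up to terms bounded by kappa. *)
Lemma region_weight (kappa o1 o2 o3 o4 w1 w2 w3 w4 : R) :
  o1 + o2 + o3 + o4 = w1 + w2 + w3 + w4 -> o1 <= w1 ->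
  exists2 c : R, 0 < c & forall x1 x2 x3 x4, x1 <= x2 -> `|x3 - x2| <= kappa ->
    `|x4 - x2| <= kappa -> expR (- (o1 * x1 + o2 * x2 + o3 * x3 + o4 * x4)) <=
    c * expR (- (w1 * x1 + w2 * x2 + w3 * x3 + w4 * x4)).
Proof.
move=> hs ow; exists (expR ((`|w3 - o3| + `|w4 - o4|) * kappa)); first exact: expR_gt0.
move=> x1 x2 x3 x4 h1 h3 h4; rewrite -expRD ler_expR.
have a1 : 0 <= (w1 - o1) * (x2 - x1) by rewrite mulr_ge0// subr_ge0.
have a3 : (w3 - o3) * (x3 - x2) <= `|w3 - o3| * kappa.
  by rewrite (le_trans (ler_norm _))// normrM ler_wpM2l.
have a4 : (w4 - o4) * (x4 - x2) <= `|w4 - o4| * kappa.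
  by rewrite (le_trans (ler_norm _))// normrM ler_wpM2l.
have e2 : w2 = o1 + o2 + o3 + o4 - w1 - w3 - w4 by lra.
have e : w1 * x1 + w2 * x2 + w3 * x3 + w4 * x4 = o1 * x1 + o2 * x2 + o3 * x3 + o4 * x4 -
    (w1 - o1) * (x2 - x1) + (w3 - o3) * (x3 - x2) + (w4 - o4) * (x4 - x2).
  by rewrite e2; ring.
rewrite e mulrDl; move: a1 a3 a4; set X := (w1 - o1) * _; set Y := (w3 - o3) * _.
by set Z := (w4 - o4) * _; lra.
Qed.

(** Bounding a + b by twice the larger term works for every r > 0, whether the power is convex or
    concave. *)
Lemma poweRD_le (r : R) (a b : \bar R) : 0 < r -> (0 <= a)%E -> (0 <= b)%E ->
  ((a + b) `^ r <= (2 `^ r)%:E * (a `^ r + b `^ r))%E.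
Proof.
move=> r0; wlog ab : a b / (a <= b)%E => [h a0 b0|a0 b0].
  have [ab|/ltW ba] := leP a b; first exact: h.
  by rewrite addeC [X in (_ * X)%E]addeC; exact: h.
apply: (@le_trans _ _ ((2%:E * b) `^ r)%E).
  apply: gt0_ler_poweR; rewrite ?in_itv/= ?leey ?andbT ?adde_ge0 ?mule_ge0//.
  - exact: ltW.
  - by rewrite mule_natl mule2n leeD2r.
rewrite poweRM//= lee_wpmul2l ?lee_fin ?powR_ge0//.
by rewrite leeDr// poweR_ge0.
Qed.

Lemma poweRD4_le (r : R) (a b c d : \bar R) : 0 < r ->
  (0 <= a)%E -> (0 <= b)%E -> (0 <= c)%E -> (0 <= d)%E ->
  ((a + b + (c + d)) `^ r <=
    (2 `^ r * 2 `^ r)%:E * (a `^ r + b `^ r + (c `^ r + d `^ r)))%E.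
Proof.
move=> r0 a0 b0 c0 d0; apply: (le_trans (poweRD_le r0 _ _)); rewrite ?adde_ge0//.
rewrite EFinM -muleA; apply: lee_wpmul2l; first by rewrite lee_fin powR_ge0.
rewrite muleDr ?ge0_adde_def ?inE ?adde_ge0 ?poweR_ge0//.
by apply: leeD; exact: poweRD_le.
Qed.

End real_weights.

Section signed_weights.
Local Open Scope ereal_scope.
Context (R : realType) d (T : measurableType d)
  (mu : {sigma_finite_measure set T -> \bar R}) (M : T -> R)
  (u v w : T -> T -> T) (C : R) (G : bilinear_geometry mu M u v w C).

Definition weight (o1 o2 o3 o4 : R) (x y : T) : R :=
  (M (u x y) `^ (- o1) * M (v x y) `^ (- o2) * M x `^ (- o3) * M y `^ (- o4))%R.

Let mMp (a : R) : measurable_fun setT (fun x => M x `^ a)%R.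
Proof. exact: (measurableT_comp (@measurable_powR R a) (geo_mM G)). Qed.

Let mU x : measurable_fun setT (u x).
Proof. exact: (measurableT_comp (geo_mu G) (pair1_measurable x)). Qed.

Let mV x : measurable_fun setT (v x).
Proof. exact: (measurableT_comp (geo_mv G) (pair1_measurable x)). Qed.

Let weightE o1 o2 o3 o4 x y : (0 < M (u x y))%R -> (0 < M (v x y))%R -> (0 < M x)%R ->
  (0 < M y)%R -> weight o1 o2 o3 o4 x y =
  expR (- (o1 * ln (M (u x y)) + o2 * ln (M (v x y)) + o3 * ln (M x) + o4 * ln (M y))).
Proof.
move=> a b c e; rewrite /weight /powR !gt_eqF// -!expRD; congr expR; ring.
Qed.

Lemma weight_ge0 o1 o2 o3 o4 x y : (0 <= weight o1 o2 o3 o4 x y)%R.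
Proof. by rewrite /weight !mulr_ge0 ?powR_ge0. Qed.

Lemma measurable_weight o1 o2 o3 o4 x : measurable_fun setT (weight o1 o2 o3 o4 x).
Proof.
apply: measurable_funM => //; apply: measurable_funM; last exact: measurable_cst.
by apply: measurable_funM; [exact: (measurableT_comp (mMp _) (mU x))|
  exact: (measurableT_comp (mMp _) (mV x))].
Qed.

Let ln_dist (a b : R) : (0 < a)%R -> (0 < b)%R -> (a <= C * b)%R -> (b <= C * a)%R ->
  (`|ln a - ln b| <= ln C)%R.
Proof.
move=> a0 b0 h1 h2; have C0 : (0 < C)%R by exact: lt_le_trans (geo_C1 G).
have {}h1 : (ln a <= ln C + ln b)%R by rewrite -lnM ?posrE// ler_ln ?posrE ?mulr_gt0.
have {}h2 : (ln b <= ln C + ln a)%R by rewrite -lnM ?posrE// ler_ln ?posrE ?mulr_gt0.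
by rewrite ler_norml; apply/andP; split; lra.
Qed.

Let four_min (a b c e : R) : [\/ [/\ a <= b, a <= c & a <= e]%R, [/\ b <= a, b <= c & b <= e]%R,
  [/\ c <= a, c <= b & c <= e]%R | [/\ e <= a, e <= b & e <= c]%R].
Proof.
have [ab|ab] := leP a b; have [ce|ce] := leP c e.
- have [h|h] := leP a c; [constructor 1|constructor 3]; split; lra.
- have [h|h] := leP a e; [constructor 1|constructor 4]; split; lra.
- have [h|h] := leP b c; [constructor 2|constructor 3]; split; lra.
- have [h|h] := leP b e; [constructor 2|constructor 4]; split; lra.
Qed.

(* Where one of the four gauges is smallest the other three are comparable,
   so mass can be moved from their exponents onto the smallest one. *)
Lemma weight_regions (o1 o2 o3 o4 : R)
    (a1 a2 a3 a4 b1 b2 b3 b4 c1 c2 c3 c4 e1 e2 e3 e4 : R) :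
  (o1 <= a1)%R -> (o2 <= b2)%R -> (o3 <= c3)%R -> (o4 <= e4)%R ->
  (o1 + o2 + o3 + o4 = a1 + a2 + a3 + a4)%R ->
  (o1 + o2 + o3 + o4 = b1 + b2 + b3 + b4)%R ->
  (o1 + o2 + o3 + o4 = c1 + c2 + c3 + c4)%R ->
  (o1 + o2 + o3 + o4 = e1 + e2 + e3 + e4)%R ->
  exists2 K : R, (0 < K)%R & forall x y, (0 < M (u x y))%R -> (0 < M (v x y))%R ->
    (0 < M x)%R -> (0 < M y)%R ->
    (weight o1 o2 o3 o4 x y <= K * (weight a1 a2 a3 a4 x y + weight b1 b2 b3 b4 x y +
      (weight c1 c2 c3 c4 x y + weight e1 e2 e3 e4 x y)))%R.
Proof.
move=> l1 l2 l3 l4 s1 s2 s3 s4.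
have [K1 K10 h1] := region_weight (ln C) s1 l1.
have [K2 K20 h2] := @region_weight R (ln C) o2 o1 o3 o4 b2 b1 b3 b4 ltac:(lra) l2.
have [K3 K30 h3] := @region_weight R (ln C) o3 o1 o2 o4 c3 c1 c2 c4 ltac:(lra) l3.
have [K4 K40 h4] := @region_weight R (ln C) o4 o1 o2 o3 e4 e1 e2 e3 ltac:(lra) l4.
exists (K1 + K2 + K3 + K4)%R; first by rewrite !addr_gt0.
move=> x y U0 V0 X0 Y0.
have WA := weight_ge0 a1 a2 a3 a4 x y; have WB := weight_ge0 b1 b2 b3 b4 x y.
have WC := weight_ge0 c1 c2 c3 c4 x y; have WE := weight_ge0 e1 e2 e3 e4 x y.
have [qXY qUV qUX qUY [qVX qVY]] :
   [/\ (forall s, M x <= s -> M y <= s -> M (u x y) <= C * s /\ M (v x y) <= C * s)%R,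
        (forall s, M (u x y) <= s -> M (v x y) <= s -> M x <= C * s /\ M y <= C * s)%R,
        (forall s, M (u x y) <= s -> M x <= s -> M (v x y) <= C * s /\ M y <= C * s)%R,
        (forall s, M (u x y) <= s -> M y <= s -> M (v x y) <= C * s /\ M x <= C * s)%R
      & (forall s, M (v x y) <= s -> M x <= s -> M (u x y) <= C * s /\ M y <= C * s)%R /\
      (forall s, M (v x y) <= s -> M y <= s -> M (u x y) <= C * s /\ M x <= C * s)%R].
  split; last split; move=> s ha hb;
    have s0 : (0 <= s)%R by apply: le_trans hb; exact: geo_M0 G _.
  - by have [] := geo_quasi G x y s0; auto.
  - by have [] := geo_quasi G x y s0; auto.
  - by have [] := geo_quasi G x y s0; auto.
  - by have [] := geo_quasi G x y s0; auto.
  - by have [_ _ _ _ []] := geo_quasi G x y s0; auto.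
  - by have [_ _ _ _ []] := geo_quasi G x y s0; auto.
have [fin1 fin2 fin3 fin4] :
  [/\ K1 * weight a1 a2 a3 a4 x y <= (K1 + K2 + K3 + K4) * (weight a1 a2 a3 a4 x y +
        weight b1 b2 b3 b4 x y + (weight c1 c2 c3 c4 x y + weight e1 e2 e3 e4 x y)),
      K2 * weight b1 b2 b3 b4 x y <= (K1 + K2 + K3 + K4) * (weight a1 a2 a3 a4 x y +
        weight b1 b2 b3 b4 x y + (weight c1 c2 c3 c4 x y + weight e1 e2 e3 e4 x y)),
      K3 * weight c1 c2 c3 c4 x y <= (K1 + K2 + K3 + K4) * (weight a1 a2 a3 a4 x y +
        weight b1 b2 b3 b4 x y + (weight c1 c2 c3 c4 x y + weight e1 e2 e3 e4 x y))
    & K4 * weight e1 e2 e3 e4 x y <= (K1 + K2 + K3 + K4) * (weight a1 a2 a3 a4 x y +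
        weight b1 b2 b3 b4 x y + (weight c1 c2 c3 c4 x y + weight e1 e2 e3 e4 x y))]%R.
  move: WA WB WC WE K10 K20 K30 K40; move: (weight a1 _ _ _ _ _) (weight b1 _ _ _ _ _).
  move: (weight c1 _ _ _ _ _) (weight e1 _ _ _ _ _); clear => s4 s3 s1 s2 ? ? ? ? ? ? ? ?.
  by split; apply: ler_pM; lra.
have [[m1 m2 m3]|[m1 m2 m3]|[m1 m2 m3]|[m1 m2 m3]] :=
  four_min (M (u x y)) (M (v x y)) (M x) (M y).
- have [t1 t2] := qUV _ m1 (lexx _); have [t3 _] := qUX _ m2 (lexx _).
  have [t4 _] := qUY _ m3 (lexx _).
  apply: (@le_trans _ _ (K1 * weight a1 a2 a3 a4 x y)%R); last exact: fin1.
  rewrite !weightE//; apply: h1; rewrite ?ler_ln ?posrE//; exact: ln_dist.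
- have [t1 t2] := qUV _ (lexx _) m1; have [t3 _] := qVX _ m2 (lexx _).
  have [t4 _] := qVY _ m3 (lexx _).
  apply: (@le_trans _ _ (K2 * weight b1 b2 b3 b4 x y)%R); last exact: fin2.
  rewrite !weightE// (addrC (o1 * _)%R) (addrC (b1 * _)%R).
  by apply: h2; rewrite ?ler_ln ?posrE//; exact: ln_dist.
- have [t1 t2] := qUX _ (lexx _) m1; have [t3 _] := qVX _ (lexx _) m2.
  have [_ t4] := qXY _ m3 (lexx _).
  have [t5 _] := qXY _ m3 (lexx _).
  apply: (@le_trans _ _ (K3 * weight c1 c2 c3 c4 x y)%R); last exact: fin3.
  rewrite !weightE// (addrC _ (o3 * _)%R) (addrC _ (c3 * _)%R) !addrA.
  by apply: h3; rewrite ?ler_ln ?posrE//; exact: ln_dist.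
- have [t1 t2] := qUY _ (lexx _) m1; have [t3 _] := qVY _ (lexx _) m2.
  have [t5 _] := qXY _ (lexx _) m3.
  apply: (@le_trans _ _ (K4 * weight e1 e2 e3 e4 x y)%R); last exact: fin4.
  rewrite !weightE// (addrC _ (o4 * _)%R) (addrC _ (e4 * _)%R) !addrA.
  by apply: h4; rewrite ?ler_ln ?posrE//; exact: ln_dist.
Qed.

End signed_weights.

Section signed_weights_bound.
Local Open Scope ereal_scope.
Context (R : realType) d (T : measurableType d)
  (mu : {sigma_finite_measure set T -> \bar R}) (M : T -> R)
  (u v w : T -> T -> T) (C : R) (G : bilinear_geometry mu M u v w C).

Local Notation weight := (weight M u v).

Let mMp (a : R) : measurable_fun setT (fun x => M x `^ a)%R.
Proof. exact: (measurableT_comp (@measurable_powR R a) (geo_mM G)). Qed.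

Let mU x : measurable_fun setT (u x).
Proof. exact: (measurableT_comp (geo_mu G) (pair1_measurable x)). Qed.

Let mV x : measurable_fun setT (v x).
Proof. exact: (measurableT_comp (geo_mv G) (pair1_measurable x)). Qed.

Let weighted_biform o1 o2 o3 o4 (F H : T -> R) x :
  measurable_fun setT F -> measurable_fun setT H ->
  (forall x, 0 <= F x)%R -> (forall x, 0 <= H x)%R ->
  (M x `^ (- o3))%:E * biform mu u v (fun x => F x * M x `^ (- o1))%R
    (fun x => H x * M x `^ (- o2))%R (fun y => M y `^ (- o4))%R x =
  \int[mu]_y (F (u x y) * H (v x y) * weight o1 o2 o3 o4 x y)%:E.
Proof.
move=> mF mH F0 H0; rewrite /biform -ge0_integralZl//.
- by apply: eq_integral => y _; rewrite -EFinM /weight; congr EFin; ring.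
- have mf : measurable_fun setT (fun x => F x * M x `^ (- o1))%R by apply: measurable_funM => //; exact: mMp.
  have mg : measurable_fun setT (fun x => H x * M x `^ (- o2))%R by apply: measurable_funM => //; exact: mMp.
  exact: (measurable_biform_integrand G mf mg (mMp _) x).
- by move=> y _; rewrite lee_fin !mulr_ge0 ?powR_ge0.
- by rewrite lee_fin powR_ge0.
Qed.

Lemma gauge_null : mu [set x | (M x <= 0)%R] = 0.
Proof.
have C0 : (0 < C)%R by exact: lt_le_trans (geo_C1 G).
apply/eqP; rewrite eq_le measure_ge0 andbT; apply/lee_addgt0Pr => e e0.
have eC : (0 < e / C)%R by rewrite divr_gt0.
rewrite add0e; apply: (@le_trans _ _ (mu [set x | (M x <= e / C)%R])).
  by apply: le_measure; rewrite ?inE; try exact: (measurable_gauge_ball G);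
    move=> x /= /le_trans; apply; exact: ltW.
by apply: (le_trans (geo_vol_le G eC)); rewrite -EFinM lee_fin mulrC divfK// gt_eqF.
Qed.

Lemma measurable_weighted o1 o2 o3 o4 (F H : T -> R) :
  measurable_fun setT F -> measurable_fun setT H ->
  (forall x, 0 <= F x)%R -> (forall x, 0 <= H x)%R ->
  measurable_fun setT (fun x => (M x `^ (- o3))%:E * biform mu u v (fun x => F x * M x `^ (- o1))%R
    (fun x => H x * M x `^ (- o2))%R (fun y => M y `^ (- o4))%R x).
Proof.
move=> mF mH F0 H0; apply: emeasurable_funM; first by apply/measurable_EFinP; exact: mMp.
apply: (measurable_biform G); last by move=> x; rewrite powR_ge0.
- by apply: measurable_funM => //; exact: mMp.
- by apply: measurable_funM => //; exact: mMp.
- exact: mMp.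
- by move=> x; rewrite mulr_ge0 ?powR_ge0.
- by move=> x; rewrite mulr_ge0 ?powR_ge0.
Qed.

Lemma weighted_ge0 o1 o2 o3 o4 (F H : T -> R) x :
  (forall x, 0 <= F x)%R -> (forall x, 0 <= H x)%R ->
  0 <= (M x `^ (- o3))%:E * biform mu u v (fun x => F x * M x `^ (- o1))%R
    (fun x => H x * M x `^ (- o2))%R (fun y => M y `^ (- o4))%R x.
Proof.
move=> F0 H0; rewrite mule_ge0 ?lee_fin ?powR_ge0//.
by apply: biform_ge0 => y; rewrite ?mulr_ge0 ?powR_ge0.
Qed.

(** Each condition o_j <= W says that the other three exponents have nonnegative sum; in the norm
    these are the four inequalities of (b). They are what [exponent_choice] needs to raise o_j to a
    nonnegative exponent without exceeding the total. *)
Lemma signed_weights_bound (p q r o1 o2 o3 o4 : R) :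
  (1 < p)%R -> (1 < q)%R -> (0 < r)%R -> (r^-1 <= p^-1 + q^-1)%R ->
  (p^-1 + o1 < 1)%R -> (q^-1 + o2 < 1)%R -> (o3 < r^-1)%R -> (o4 < 1)%R ->
  (o1 + o2 + o3 + o4 = 1 + r^-1 - p^-1 - q^-1)%R ->
  let W := (o1 + o2 + o3 + o4)%R in
  (0 <= W)%R -> (o1 <= W)%R -> (o2 <= W)%R -> (o3 <= W)%R -> (o4 <= W)%R ->
  exists2 K : R, (0 < K)%R & forall F H : T -> R,
    measurable_fun setT F -> measurable_fun setT H ->
    (forall x, 0 <= F x)%R -> (forall x, 0 <= H x)%R ->
    \int[mu]_x (F x `^ p)%:E <= 1 -> \int[mu]_x (H x `^ q)%:E <= 1 ->
    \int[mu]_x (((M x `^ (- o3))%:E *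
      biform mu u v (fun x => F x * M x `^ (- o1))%R (fun x => H x * M x `^ (- o2))%R
        (fun y => M y `^ (- o4))%R x) `^ r) <= K%:E.
Proof.
move=> p1 q1 r0 hr h1 h2 h3 h4 hs W W0 w1 w2 w3 w4.
have pi : (0 < p^-1 < 1)%R by rewrite invr_gt0 invf_lt1 ?(lt_trans ltr01)// p1.
have qi : (0 < q^-1 < 1)%R by rewrite invr_gt0 invf_lt1 ?(lt_trans ltr01)// q1.
have ri : (0 < r^-1)%R by rewrite invr_gt0.
have hW : W = (1 + r^-1 - p^-1 - q^-1)%R by [].
have P1 : (0 < 1 - p^-1)%R by lra.
have Q1 : (0 < 1 - q^-1)%R by lra.
have choice (c1 c2 c3 c4 o : R) := @exponent_choice R c1 c2 c3 c4 o W.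
(* The four caps 1 - 1/p, 1 - 1/q, 1/r and 1 add up to W + 2, so there is always room for the total
   W. *)
have [a1 [a2 [a3 [a4 [A1 A2 A3 A4 [oA sA]]]]]] := choice _ _ _ _ o1 P1 Q1 ri ltr01
  ltac:(lra) w1 W0 ltac:(rewrite hW; lra).
have [b2 [b1 [b3 [b4 [B2 B1 B3 B4 [oB sB]]]]]] := choice _ _ _ _ o2 Q1 P1 ri ltr01
  ltac:(lra) w2 W0 ltac:(rewrite hW; lra).
have [c3 [c1 [c2 [c4 [C3 C1 C2 C4 [oC sC]]]]]] := choice _ _ _ _ o3 ri P1 Q1 ltr01
  h3 w3 W0 ltac:(rewrite hW; lra).
have [e4 [e1 [e2 [e3 [E4 E1 E2 E3 [oE sE]]]]]] := choice _ _ _ _ o4 ltr01 P1 Q1 ri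
  h4 w4 W0 ltac:(rewrite hW; lra).
have sB' : (b1 + b2 + b3 + b4 = W)%R by rewrite -sB; ring.
have sC' : (c1 + c2 + c3 + c4 = W)%R by rewrite -sC; ring.
have sE' : (e1 + e2 + e3 + e4 = W)%R by rewrite -sE; ring.
have bnd (x1 x2 x3 x4 : R) : (0 <= x1 < 1 - p^-1)%R -> (0 <= x2 < 1 - q^-1)%R ->
    (0 <= x3 < r^-1)%R -> (0 <= x4 < 1)%R -> (x1 + x2 + x3 + x4 = W)%R -> _ :=
  fun X1 X2 X3 X4 sX => @nonnegative_weights_bound _ _ _ _ _ _ _ _ _ G p q r x1 x2 x3 x4
    p1 q1 r0 hr (andP X1).1 (andP X2).1 (andP X3).1 X4
    (ltac:(case/andP: X1; lra)) (ltac:(case/andP: X2; lra)) (andP X3).2 (ltac:(by rewrite sX)).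
have [K1 K10 hK1] := bnd _ _ _ _ A1 A2 A3 A4 sA.
have [K2 K20 hK2] := bnd _ _ _ _ B1 B2 B3 B4 sB'.
have [K3 K30 hK3] := bnd _ _ _ _ C1 C2 C3 C4 sC'.
have [K4 K40 hK4] := bnd _ _ _ _ E1 E2 E3 E4 sE'.
have [K K0 hK] := @weight_regions _ _ _ _ _ _ _ _ _ G o1 o2 o3 o4 a1 a2 a3 a4 b1 b2 b3 b4 c1 c2 c3 c4 e1 e2 e3 e4
  oA oB oC oE (esym sA) (esym sB') (esym sC') (esym sE').
have KE0 : 0 <= K%:E by rewrite lee_fin ltW.
pose L := ((K `^ r) * (2 `^ r * 2 `^ r))%R.
have L0 : (0 < L)%R by rewrite !mulr_gt0// powR_gt0.
have LE0 : 0 <= L%:E by rewrite lee_fin ltW.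
exists (L * (K1 + K2 + (K3 + K4)))%R; first by rewrite mulr_gt0 ?addr_gt0.
move=> F H mF mH F0 H0 Fp Hq.
pose Th (x1 x2 x3 x4 : R) x := (M x `^ (- x3))%:E *
  biform mu u v (fun x => F x * M x `^ (- x1))%R (fun x => H x * M x `^ (- x2))%R
        (fun y => M y `^ (- x4))%R x.
have mTh x1 x2 x3 x4 : measurable_fun setT (Th x1 x2 x3 x4) by exact: measurable_weighted.
have Th0 x1 x2 x3 x4 x : 0 <= Th x1 x2 x3 x4 x by exact: weighted_ge0.
have mThr x1 x2 x3 x4 : measurable_fun setT (fun x => Th x1 x2 x3 x4 x `^ r).
  exact: (measurableT_comp (@measurable_poweR R r) (mTh _ _ _ _)).
have ThE x1 x2 x3 x4 x : Th x1 x2 x3 x4 x =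
    \int[mu]_y (F (u x y) * H (v x y) * weight x1 x2 x3 x4 x y)%:E.
  exact: weighted_biform.
have mI x1 x2 x3 x4 x : measurable_fun setT
    (fun y => (F (u x y) * H (v x y) * weight x1 x2 x3 x4 x y)%:E).
  apply/measurable_EFinP; apply: measurable_funM; last exact: (measurable_weight G x1 x2 x3 x4 x).
  by apply: measurable_funM; [exact: (measurableT_comp mF (mU x))|exact: (measurableT_comp mH (mV x))].
have I0 x1 x2 x3 x4 x y : (0 <= F (u x y) * H (v x y) * weight x1 x2 x3 x4 x y)%R.
  by rewrite mulr_ge0 ?weight_ge0// mulr_ge0.
pose Z := [set x | (M x <= 0)%R].
have Z0 : mu Z = 0 by exact: gauge_null.
have mZ : measurable Z by exact: (measurable_gauge_ball G).
(* The comparison of weights takes logarithms of all four gauges, so the points where one of them is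
   0 must be discarded; they form null sets by invariance. *)
have pre (f : T -> T) : measurable_fun setT f ->
    (forall g : T -> \bar R, measurable_fun setT g -> (forall x, 0 <= g x) ->
      \int[mu]_y g (f y) = \int[mu]_y g y) -> measurable (f @^-1` Z) /\ mu (f @^-1` Z) = 0.
  move=> mf hf; have mfZ : measurable (f @^-1` Z) by rewrite -[X in measurable X]setTI; exact: mf.
  split => //; transitivity (mu Z); last exact: gauge_null.
  have int_indic D : measurable D -> \int[mu]_x (\1_D x : R)%:E = mu D.
    by move=> mD; rewrite integral_indic// setIT.
  rewrite -(int_indic _ mfZ) -(int_indic _ mZ).
  apply: (hf (fun x => (\1_Z x : R)%:E)).
    by apply/measurable_EFinP; exact: measurable_indic.
  by move=> x; rewrite lee_fin indic_ge0.
have pointwise x : ~ Z x -> Th o1 o2 o3 o4 x <= K%:E * (Th a1 a2 a3 a4 x + Th b1 b2 b3 b4 x +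
    (Th c1 c2 c3 c4 x + Th e1 e2 e3 e4 x)).
  move=> /negP; rewrite -ltNge => Mx.
  have [mP1 P10] := pre _ (mU x) (fun g mg g0 => let: And4 h _ _ _ := geo_int G mg g0 in h x).
  have [mP2 P20] := pre _ (mV x) (fun g mg g0 => let: And4 _ h _ _ := geo_int G mg g0 in h x).
  pose I x1 x2 x3 x4 y := (F (u x y) * H (v x y) * weight x1 x2 x3 x4 x y)%:E.
  have mII x1 x2 x3 x4 : measurable_fun setT (I x1 x2 x3 x4) by exact: mI.
  have II0 x1 x2 x3 x4 y : 0 <= I x1 x2 x3 x4 y by rewrite lee_fin.
  have -> : Th a1 a2 a3 a4 x + Th b1 b2 b3 b4 x + (Th c1 c2 c3 c4 x + Th e1 e2 e3 e4 x) =
      \int[mu]_y (I a1 a2 a3 a4 y + I b1 b2 b3 b4 y + (I c1 c2 c3 c4 y + I e1 e2 e3 e4 y)).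
    rewrite ge0_integralD//.
    - by rewrite !ge0_integralD// !ThE.
    - by move=> y _; exact: adde_ge0.
    - exact: emeasurable_funD.
    - by move=> y _; exact: adde_ge0.
    - exact: emeasurable_funD.
  rewrite ThE -ge0_integralZl//; last first.
  - by move=> y _; rewrite !adde_ge0.
  - by apply: emeasurable_funD; exact: emeasurable_funD.
  apply: (@le_integral_null _ _ _ _ _ _ ((u x @^-1` Z `|` v x @^-1` Z) `|` Z)).
  - exact: mI.
  - by apply: measurable_funeM; apply: emeasurable_funD; exact: emeasurable_funD.
  - exact: II0.
  - by move=> y; rewrite mule_ge0// !adde_ge0.
  - by apply: measurableU => //; exact: measurableU.
  - by apply: null_set_setU; rewrite ?null_set_setU//; exact: measurableU.
  - move=> y hy; rewrite /I -!EFinD -EFinM lee_fin.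
    have h : (weight o1 o2 o3 o4 x y <= K * (weight a1 a2 a3 a4 x y + weight b1 b2 b3 b4 x y +
        (weight c1 c2 c3 c4 x y + weight e1 e2 e3 e4 x y)))%R.
      by apply: hK => //; rewrite ltNge; apply/negP => h; apply: hy; [left; left|left; right|right].
    have X0 : (0 <= F (u x y) * H (v x y))%R by rewrite mulr_ge0.
    have alg (X L' a b c e : R) :
      (L' * (X * a + X * b + (X * c + X * e)) = X * (L' * (a + b + (c + e))))%R by ring.
    by rewrite alg; exact: (ler_wpM2l X0 h).
have S0 x : 0 <= Th a1 a2 a3 a4 x + Th b1 b2 b3 b4 x + (Th c1 c2 c3 c4 x + Th e1 e2 e3 e4 x).
  by rewrite !adde_ge0.
apply: (@le_trans _ _ (\int[mu]_x (L%:E * (Th a1 a2 a3 a4 x `^ r + Th b1 b2 b3 b4 x `^ r +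
    (Th c1 c2 c3 c4 x `^ r + Th e1 e2 e3 e4 x `^ r))))).
  apply: (@le_integral_null _ _ _ _ _ _ Z) => //.
  - exact: mThr.
  - by apply: measurable_funeM; apply: emeasurable_funD; apply: emeasurable_funD.
  - by move=> x; exact: poweR_ge0.
  - by move=> x; rewrite mule_ge0// !adde_ge0 ?poweR_ge0.
  - move=> x Zx; apply: (@le_trans _ _ ((K%:E * (Th a1 a2 a3 a4 x + Th b1 b2 b3 b4 x +
      (Th c1 c2 c3 c4 x + Th e1 e2 e3 e4 x))) `^ r)).
      apply: gt0_ler_poweR; rewrite ?in_itv/= ?leey ?andbT//; first exact: ltW.
      + exact: Th0.
      + by rewrite mule_ge0.
      + exact: pointwise.
    rewrite poweRM//= /L EFinM -muleA.
    apply: lee_wpmul2l; first by rewrite lee_fin powR_ge0.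
    by apply: poweRD4_le.
rewrite ge0_integralZl//; last first.
- by move=> x _; rewrite !adde_ge0 ?poweR_ge0.
- by apply: emeasurable_funD; apply: emeasurable_funD.
rewrite (EFinM L); apply: lee_wpmul2l; first exact: LE0.
rewrite ge0_integralD//; last first.
- by apply: emeasurable_funD.
- by move=> x _; rewrite adde_ge0 ?poweR_ge0.
- by apply: emeasurable_funD.
- by move=> x _; rewrite adde_ge0 ?poweR_ge0.
rewrite !ge0_integralD//; last first.
all: try by move=> x _; exact: poweR_ge0.
rewrite !EFinD; apply: leeD; apply: leeD; [exact: hK1|exact: hK2|exact: hK3|exact: hK4].
Qed.

End signed_weights_bound.

Section homogeneous_bound.
Local Open Scope ereal_scope.
Context (R : realType) d (T : measurableType d)
  (mu : {sigma_finite_measure set T -> \bar R}) (M : T -> R)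
  (u v w : T -> T -> T) (C : R) (G : bilinear_geometry mu M u v w C).

Lemma biform_le_ae (f g f' g' k : T -> R) (N1 N2 : set T) x :
  measurable_fun setT f -> measurable_fun setT g -> measurable_fun setT f' ->
  measurable_fun setT g' -> measurable_fun setT k ->
  (forall x, 0 <= f x)%R -> (forall x, 0 <= g x)%R -> (forall x, 0 <= f' x)%R ->
  (forall x, 0 <= g' x)%R -> (forall x, 0 <= k x)%R ->
  measurable N1 -> measurable N2 -> mu N1 = 0 -> mu N2 = 0 ->
  (forall x, ~ N1 x -> f x <= f' x)%R -> (forall x, ~ N2 x -> g x <= g' x)%R ->
  biform mu u v f g k x <= biform mu u v f' g' k x.
Proof.
move=> mf mg mf' mg' mk f0 g0 f'0 g'0 k0 mN1 mN2 z1 z2 hf hg.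
have mi (N : set T) : measurable N -> measurable_fun setT (\1_(~` N) : T -> R).
  by move=> mN; apply: measurable_indic; exact: measurableC.
have le (N : set T) (a b : T -> R) : (forall x, 0 <= b x)%R ->
    (forall x, ~ N x -> a x <= b x)%R -> forall x, (a x * \1_(~` N) x <= b x)%R.
  move=> b0 h y; rewrite indicE; have [/set_mem /h|_] := boolP (y \in ~` N).
    by rewrite mulr1.
  by rewrite mulr0.
rewrite (biform_null G x mf mg mk f0 g0 k0 mN1 mN2 z1 z2).
apply: (biform_le G) => //.
- by apply: measurable_funM => //; exact: mi.
- by apply: measurable_funM => //; exact: mi.
- by move=> y; rewrite mulr_ge0 ?indic_ge0.
- by move=> y; rewrite mulr_ge0 ?indic_ge0.
- exact: le.
- exact: le.
Qed.

Variables (p q r o1 o2 o3 o4 : R) (p0 : (0 < p)%R) (q0 : (0 < q)%R) (r0 : (0 < r)%R).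

Let mMp (a : R) : measurable_fun setT (fun x => M x `^ a)%R.
Proof. exact: (measurableT_comp (@measurable_powR R a) (geo_mM G)). Qed.

Definition weighted_form (F H : T -> R) x := (M x `^ (- o3))%:E *
  biform mu u v (fun x => F x * M x `^ (- o1))%R (fun x => H x * M x `^ (- o2))%R
    (fun y => M y `^ (- o4))%R x.

Let null_of_integral (F : T -> R) (s : R) : (0 < s)%R -> measurable_fun setT F ->
  (forall x, 0 <= F x)%R -> \int[mu]_x (F x `^ s)%:E = 0 ->
  exists N, [/\ measurable N, mu N = 0 & forall x, ~ N x -> F x = 0%R].
Proof.
move=> s0 mF F0 h.
have mFs : measurable_fun setT (fun x => (F x `^ s)%:E).
  by apply/measurable_EFinP; exact: (measurableT_comp (@measurable_powR R s) mF).
have : ae_eq mu setT (fun x => (F x `^ s)%:E) (cst 0).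
  apply/(ae_eq_integral_abs mu measurableT mFs); rewrite -[RHS]h.
  by apply: eq_integral => x _; rewrite gee0_abs// lee_fin powR_ge0.
move=> [N [mN N0 hN]]; exists N; split => // x Nx.
have : (F x `^ s)%:E = 0.
  by apply: contrapT => hx; apply: Nx; apply: hN => /= /(_ I).
by move=> [] /powR_eq0_eq0.
Qed.

(* In the degenerate cases one of the norms is 0 or infinite, and the
   convention 0 * +oo = 0 forces the left side to be shown to vanish. *)
Lemma homogeneous_bound (K : R) : (0 < K)%R ->
  (forall F H : T -> R,
    measurable_fun setT F -> measurable_fun setT H ->
    (forall x, 0 <= F x)%R -> (forall x, 0 <= H x)%R ->
    \int[mu]_x (F x `^ p)%:E <= 1 -> \int[mu]_x (H x `^ q)%:E <= 1 ->
    \int[mu]_x (weighted_form F H x `^ r) <= K%:E) ->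
  forall F H : T -> R,
    measurable_fun setT F -> measurable_fun setT H ->
    (forall x, 0 <= F x)%R -> (forall x, 0 <= H x)%R ->
    (\int[mu]_x (weighted_form F H x `^ r)) `^ r^-1 <=
      (K `^ r^-1)%:E * (\int[mu]_x (F x `^ p)%:E) `^ p^-1 *
      (\int[mu]_x (H x `^ q)%:E) `^ q^-1.
Proof.
move=> K0 hK F H mF mH F0 H0.
have mM (f : T -> R) (o : R) : measurable_fun setT f -> measurable_fun setT (fun x => f x * M x `^ o)%R.
  by move=> mf; apply: measurable_funM => //; exact: mMp.
have M0 (f : T -> R) (o : R) : (forall x, 0 <= f x)%R -> forall x, (0 <= f x * M x `^ o)%R.
  by move=> f0 x; rewrite mulr_ge0 ?powR_ge0.
have mc : measurable_fun setT (fun _ : T => 0%R : R) by exact: measurable_cst.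
have wf0 F' H' x : (forall x, 0 <= F' x)%R -> (forall x, 0 <= H' x)%R -> 0 <= weighted_form F' H' x.
  move=> a b; rewrite /weighted_form mule_ge0 ?lee_fin ?powR_ge0//.
  by apply: biform_ge0 => y; rewrite ?mulr_ge0 ?powR_ge0.
have rhs0 : 0 <= (K `^ r^-1)%:E * (\int[mu]_x (F x `^ p)%:E) `^ p^-1 *
      (\int[mu]_x (H x `^ q)%:E) `^ q^-1.
  by rewrite !mule_ge0 ?poweR_ge0 ?lee_fin ?powR_ge0.
have vanish : (forall x, weighted_form F H x <= 0) ->
    (\int[mu]_x (weighted_form F H x `^ r)) `^ r^-1 <= (K `^ r^-1)%:E *
      (\int[mu]_x (F x `^ p)%:E) `^ p^-1 * (\int[mu]_x (H x `^ q)%:E) `^ q^-1.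
  move=> h; rewrite integral0_eq ?poweR0r ?invr_eq0 ?gt_eqF// => x _.
  have -> : weighted_form F H x = 0 by apply/eqP; rewrite eq_le h wf0.
  by rewrite poweR0r// gt_eqF.
have biform0l g k x : biform mu u v (fun=> 0%R) g k x = 0.
  by rewrite /biform integral0_eq// => y _; rewrite !mul0r.
have biform0r f k x : biform mu u v f (fun=> 0%R) k x = 0.
  by rewrite /biform integral0_eq// => y _; rewrite mulr0 mul0r.
have [X0|X0] := eqVneq (\int[mu]_x (F x `^ p)%:E) 0.
  have [N [mN N0 hN]] := null_of_integral p0 mF F0 X0.
  apply: vanish => x; rewrite /weighted_form mule_ge0_le0 ?lee_fin ?powR_ge0//.
  apply: (@le_trans _ _ (biform mu u v (fun=> 0%R) (fun x => H x * M x `^ (- o2))%R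
    (fun y => M y `^ (- o4))%R x)); last by rewrite biform0l.
  apply: (biform_le_ae x (N1 := N) (N2 := set0)) => //; try exact: mM; try exact: M0; try by move=> *; exact: powR_ge0.
    by move=> y Ny; rewrite hN// mul0r.
have [Y0|Y0] := eqVneq (\int[mu]_x (H x `^ q)%:E) 0.
  have [N [mN N0 hN]] := null_of_integral q0 mH H0 Y0.
  apply: vanish => x; rewrite /weighted_form mule_ge0_le0 ?lee_fin ?powR_ge0//.
  apply: (@le_trans _ _ (biform mu u v (fun x => F x * M x `^ (- o1))%R (fun=> 0%R)
    (fun y => M y `^ (- o4))%R x)); last by rewrite biform0r.
  apply: (biform_le_ae x (N1 := set0) (N2 := N)) => //; try exact: mM; try exact: M0; try by move=> *; exact: powR_ge0.
    by move=> y Ny; rewrite hN// mul0r.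
have Xge : 0 <= \int[mu]_x (F x `^ p)%:E by apply: integral_ge0 => x _; rewrite lee_fin powR_ge0.
have Yge : 0 <= \int[mu]_x (H x `^ q)%:E by apply: integral_ge0 => x _; rewrite lee_fin powR_ge0.
have KE0 : (0 < K `^ r^-1)%R by rewrite powR_gt0.
have pinv0 : (p^-1 != 0)%R by rewrite invr_neq0// gt_eqF.
have qinv0 : (q^-1 != 0)%R by rewrite invr_neq0// gt_eqF.
move: X0 Xge Y0 Yge; case EX : (\int[mu]_x (F x `^ p)%:E) => [X| |] //; last first.
  move=> _ _ Y0 Yge; rewrite poweRyr// gt0_muley ?lte_fin// gt0_mulye ?leey//.
  by rewrite poweR_gt0// lt0e Y0.
case EY : (\int[mu]_x (H x `^ q)%:E) => [Y| |] // X0 Xge Y0 Yge; last first.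
  have {}X0 : (0 < X)%R by rewrite lt_neqAle eq_sym; rewrite eqe in X0; rewrite X0.
  by rewrite (poweRyr qinv0) gt0_muley ?leey// mule_gt0 ?lte_fin// powR_gt0.
have {}X0 : (0 < X)%R by rewrite lt_neqAle eq_sym; rewrite eqe in X0; rewrite X0.
have {}Y0 : (0 < Y)%R by rewrite lt_neqAle eq_sym; rewrite eqe in Y0; rewrite Y0.
pose a := (X `^ (- p^-1))%R; pose b := (Y `^ (- q^-1))%R.
have a0 : (0 < a)%R by rewrite powR_gt0.
have b0 : (0 < b)%R by rewrite powR_gt0.
have unit (f : T -> R) (s Z c : R) : (0 < s)%R -> (0 < Z)%R -> c = (Z `^ (- s^-1))%R ->
    measurable_fun setT f -> (forall x, 0 <= f x)%R -> \int[mu]_x (f x `^ s)%:E = Z%:E ->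
    \int[mu]_x ((c * f x) `^ s)%:E <= 1.
  move=> s0 Z0 -> mf f0 h.
  rewrite (_ : \int[mu]_x _ = \int[mu]_x (Z^-1%:E * (f x `^ s)%:E)); last first.
    apply: eq_integral => x _; rewrite powRM ?powR_ge0// -powRrM mulNr mulVf ?gt_eqF//.
    by rewrite powR_inv1 ?ltW.
  rewrite ge0_integralZl//.
  - by rewrite h -EFinM mulVf ?gt_eqF.
  - by apply/measurable_EFinP; exact: (measurableT_comp (@measurable_powR R s) mf).
  - by move=> x _; rewrite lee_fin powR_ge0.
  - by rewrite lee_fin invr_ge0 ltW.
have maF : measurable_fun setT (fun x => a * F x)%R by exact: measurable_funM.
have mbH : measurable_fun setT (fun x => b * H x)%R by exact: measurable_funM.
have aF0 x : (0 <= a * F x)%R by rewrite mulr_ge0// ltW.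
have bH0 x : (0 <= b * H x)%R by rewrite mulr_ge0// ltW.
have scale x : weighted_form (fun x => a * F x)%R (fun x => b * H x)%R x =
    (a * b)%:E * weighted_form F H x.
  rewrite /weighted_form muleCA; congr (_ * _).
  rewrite /biform -ge0_integralZl//.
  - by apply: eq_integral => y _; rewrite -EFinM; congr EFin; ring.
  - exact: (measurable_biform_integrand G (mM F (- o1) mF)%R (mM H (- o2) mH)%R (mMp _) x).
  - by move=> y _; rewrite lee_fin !mulr_ge0 ?powR_ge0.
  - by rewrite lee_fin ltW// mulr_gt0.
have mW : measurable_fun setT (weighted_form F H).
  apply: emeasurable_funM; first by apply/measurable_EFinP; exact: mMp.
  apply: (measurable_biform G) => //; try exact: mM; try exact: M0; try exact: mMp.
  by move=> x; exact: powR_ge0.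
have := hK _ _ maF mbH aF0 bH0 (unit F p X a p0 X0 erefl mF F0 EX) (unit H q Y b q0 Y0 erefl mH H0 EY).
rewrite (_ : \int[mu]_x _ = ((a * b) `^ r)%:E * \int[mu]_x (weighted_form F H x `^ r)); last first.
  rewrite -ge0_integralZl//.
  - apply: eq_integral => x _; rewrite scale poweRM//; first by rewrite lee_fin ltW// mulr_gt0.
    exact: wf0.
  - exact: (measurableT_comp (@measurable_poweR R r) mW).
  - by move=> x _; exact: poweR_ge0.
  - by rewrite lee_fin powR_ge0.
set I := \int[mu]_x _ => hI.
have I0 : 0 <= I by apply: integral_ge0 => x _; exact: poweR_ge0.
have abI : I <= (K * (a * b) `^ (- r))%:E.
  rewrite -(@lee_pmul2l _ ((a * b) `^ r)%:E) ?lte_fin ?powR_gt0 ?mulr_gt0//.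
  apply: (le_trans hI); rewrite -EFinM lee_fin mulrCA -powRD ?subrr ?powRr0 ?mulr1//.
  by apply/implyP => _; rewrite gt_eqF// mulr_gt0.
apply: (@le_trans _ _ ((K * (a * b) `^ (- r))%:E `^ r^-1)).
  by apply: gt0_ler_poweR; rewrite ?in_itv/= ?leey ?andbT ?lee_fin ?invr_ge0 ?mulr_ge0 ?powR_ge0// ltW.
rewrite /= -!EFinM lee_fin powRM ?powR_ge0 ?(ltW K0)// -powRrM mulNr mulfV ?gt_eqF// -mulrA.
rewrite ler_pM2l// powRN powRr1 ?mulr_ge0 ?(ltW a0) ?(ltW b0)// invfM.
by rewrite /a /b !powRN !invrK.
Qed.

End homogeneous_bound.

(** * Sufficiency *)

(** [Blam] integrates a signed function, so Tonelli measurability is applied to the positive and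
    negative parts. *)
Lemma measurable_integral_section (R : realType) d1 d2 (T1 : measurableType d1)
    (T2 : measurableType d2) (mu : {sigma_finite_measure set T2 -> \bar R})
    (f : T1 * T2 -> \bar R) : measurable_fun setT f ->
  measurable_fun setT (fun x => \int[mu]_y f (x, y))%E.
Proof.
move=> mf.
rewrite (_ : (fun x => _) = (fun x => (\int[mu]_y f^\+ (x, y)) - (\int[mu]_y f^\- (x, y)))%E); last first.
  by apply/funext => x; rewrite integralE; congr (_ - _)%E; apply: eq_integral => y _;
    rewrite ?funeposE ?funenegE.
apply: emeasurable_funB.
- exact: (@measurable_fun_fubini_tonelli_F _ _ _ _ R mu _ (measurable_funepos mf) (fun z => funepos_ge0 f z)).
- exact: (@measurable_fun_fubini_tonelli_F _ _ _ _ R mu _ (measurable_funeneg mf) (fun z => funeneg_ge0 f z)).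
Qed.

Section sufficiency.
Variables (R : realType) (n : nat).
Hypothesis n1 : (1 <= n)%N.
Notation H := (Hn R n).
Notation mu := (Hmeas R n).
Notation Q := (Qdim R n).

Lemma gauge_powR (x : H) (a : R) : gauge x `^ (- (a / Q)) = koranyi x `^ (- a).
Proof.
by rewrite /gauge -powRrM mulrN mulrCA divff ?mulr1// gt_eqF// Qdim_gt0.
Qed.

Let mkor (a : R) : measurable_fun setT (fun x : H => koranyi x `^ a).
Proof. exact: (measurableT_comp (@measurable_powR R a) (@measurable_koranyi R n)). Qed.

Let div_hconj (s : R) : 1 < s -> Q / hconj s = Q * (1 - s^-1).
Proof.
move=> s1; rewrite /hconj; have s0 : s != 0 by rewrite gt_eqF// (lt_trans ltr01).
by field; rewrite s0 subr_eq0 gt_eqF.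
Qed.

Lemma sufficiency (p q r lam alpha beta gamma : R) :
  1 < p -> 1 < q -> 0 < r -> r^-1 <= p^-1 + q^-1 ->
  0 < lam -> lam < Q ->
  alpha < Q / hconj p -> beta < Q / hconj q -> gamma < Q / r ->
  r^-1 = p^-1 + q^-1 - (lam - alpha - beta - gamma) / Q ->
  - Q + lam <= beta + gamma -> - Q + lam <= gamma + alpha ->
  - Q + lam <= alpha + beta -> 0 <= alpha + beta + gamma ->
  exists K : R, 0 < K /\
     forall f g : H -> R,
       f \in Lfun mu p%:E -> g \in Lfun mu q%:E ->
       (Lnorm mu r%:E
          (fun x => (powR (koranyi x) (- gamma))%:E * Blam lam f g x)
        <= K%:E * Lnorm mu p%:E (fun x => (powR (koranyi x) alpha * f x)%:E)
                * Lnorm mu q%:E (fun x => (powR (koranyi x) beta * g x)%:E))%E.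
Proof.
move=> p1 q1 r0 hr l0 lQ ha hb hg hs c1 c2 c3 c4.
have Q0 : 0 < Q by exact: Qdim_gt0.
have [C G] := heisenberg_geometry R n1.
(* Division by Q converts powers of the norm into powers of the gauge; o4 is the exponent of the
   kernel |y|^(lam - Q). *)
pose o1 := alpha / Q; pose o2 := beta / Q; pose o3 := gamma / Q; pose o4 := (Q - lam) / Q.
have Qn : Q != 0 by rewrite gt_eqF.
have e1 : alpha = Q * o1 by rewrite /o1 mulrCA divff ?mulr1.
have e2 : beta = Q * o2 by rewrite /o2 mulrCA divff ?mulr1.
have e3 : gamma = Q * o3 by rewrite /o3 mulrCA divff ?mulr1.
have e4 : lam = Q * (1 - o4) by rewrite /o4; field.
have h1 : p^-1 + o1 < 1.
  by move: ha; rewrite div_hconj// e1 ltr_pM2l//; lra.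
have h2 : q^-1 + o2 < 1.
  by move: hb; rewrite div_hconj// e2 ltr_pM2l//; lra.
have h3 : o3 < r^-1 by move: hg; rewrite e3 ltr_pM2l.
have h4 : o4 < 1 by move: l0; rewrite e4 pmulr_rgt0//; lra.
have o40 : 0 < o4 by rewrite divr_gt0// subr_gt0.
have h5 : o1 + o2 + o3 + o4 = 1 + r^-1 - p^-1 - q^-1.
  have -> : r^-1 = p^-1 + q^-1 - (1 - o4 - o1 - o2 - o3).
    by rewrite hs e1 e2 e3 e4; congr (_ - _); field.
  by ring.
have Qle (x y : R) : Q * x <= Q * y -> x <= y by rewrite ler_pM2l.
have w1 : 0 <= o2 + o3 + o4.
  have : Q * - o4 <= Q * (o2 + o3) by move: c1; rewrite e2 e3 e4; lra.
  by move/Qle; lra.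
have w2 : 0 <= o3 + o1 + o4.
  have : Q * - o4 <= Q * (o3 + o1) by move: c2; rewrite e1 e3 e4; lra.
  by move/Qle; lra.
have w3 : 0 <= o1 + o2 + o4.
  have : Q * - o4 <= Q * (o1 + o2) by move: c3; rewrite e1 e2 e4; lra.
  by move/Qle; lra.
have w4 : 0 <= o1 + o2 + o3.
  by move: c4; rewrite e1 e2 e3 -!mulrDr pmulr_rge0.
have p0 : 0 < p by exact: lt_trans p1.
have q0 : 0 < q by exact: lt_trans q1.
(* Nonnegativity of the total weight follows from the four conditions, which add up to three times
   that total. *)
have [K K0 hK] := @signed_weights_bound _ _ _ _ _ _ _ _ _ G p q r o1 o2 o3 o4 p1 q1 r0 hr
  h1 h2 h3 h4 h5 ltac:(lra) ltac:(lra) ltac:(lra) ltac:(lra) ltac:(lra).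
exists (K `^ r^-1); split; first by rewrite powR_gt0.
move=> f g Lf Lg.
have mf : measurable_fun setT f by have := sub_Lfun_mfun Lf; rewrite inE.
have mg : measurable_fun setT g by have := sub_Lfun_mfun Lg; rewrite inE.
pose F x := koranyi x `^ alpha * `|f x|.
pose E x := koranyi x `^ beta * `|g x|.
have mF : measurable_fun setT F.
  by apply: measurable_funM; [exact: mkor|exact: (measurableT_comp (@normr_measurable R setT) mf)].
have mE : measurable_fun setT E.
  by apply: measurable_funM; [exact: mkor|exact: (measurableT_comp (@normr_measurable R setT) mg)].
have F0 x : 0 <= F x by rewrite mulr_ge0 ?powR_ge0.
have E0 x : 0 <= E x by rewrite mulr_ge0 ?powR_ge0.
have := @homogeneous_bound _ _ _ _ _ _ _ _ _ G p q r o1 o2 o3 o4 p0 q0 r0 K K0 hK F E mF mE F0 E0.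
have normE (s a : R) (h : H -> R) : Lnorm mu s%:E (fun x => (koranyi x `^ a * h x)%:E) =
    ((\int[mu]_x ((koranyi x `^ a * `|h x|) `^ s)%:E) `^ s^-1)%E.
  rewrite unlock /=; congr (_ `^ _)%E; apply: eq_integral => x _.
  by rewrite normrM (ger0_norm (powR_ge0 _ _)).
rewrite !normE -/F -/E => hom; apply: le_trans hom.
rewrite unlock /=.
pose k (y : H) := koranyi y `^ (lam - Q).
have mk : measurable_fun setT k by exact: mkor.
have mI : measurable_fun setT (fun z : H * H => (f (hu z.1 z.2) * g (hv z.1 z.2) * k z.2)%:E).
  by exact: (measurable_biform_integrand2 G mf mg mk).
have mB : measurable_fun setT (Blam lam f g).
  exact: (@measurable_integral_section R _ _ _ _ mu _ mI).
have kE (y : H) : k y = gauge y `^ (- o4).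
  by rewrite gauge_powR /k opprB.
have mnf : measurable_fun setT (fun x => `|f x|).
  exact: (measurableT_comp (@normr_measurable R setT) mf).
have mng : measurable_fun setT (fun x => `|g x|).
  exact: (measurableT_comp (@normr_measurable R setT) mg).
have mW : measurable_fun setT (weighted_form mu (gauge (n:=n)) (hu (n:=n)) (hv (n:=n)) o1 o2 o3 o4 F E).
  exact: (measurable_weighted G o1 o2 o3 o4 mF mE F0 E0).
have W0 x : (0 <= weighted_form mu (gauge (n:=n)) (hu (n:=n)) (hv (n:=n)) o1 o2 o3 o4 F E x)%E.
  exact: (weighted_ge0 mu (@gauge R n) (@hu R n) (@hv R n) o1 o2 o3 o4 x F0 E0).
have Nz : mu [set x | gauge x <= 0] = 0%E by exact: (gauge_null G).
have mN : measurable [set x : H | gauge x <= 0] by exact: (measurable_gauge_ball G).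
(* The weight in the norm and the opposite weight in the form cancel wherever the gauge is positive.
   At gauge 0 the power convention may give 0, so only an almost everywhere bound is claimed. *)
have recover (a : R) (h : H -> R) x : ~ [set x : H | gauge x <= 0] x ->
    `|h x| <= koranyi x `^ a * `|h x| * gauge x `^ (- (a / Q)).
  move=> /negP; rewrite -ltNge gauge_powR /gauge => kx.
  have {}kx : 0 < koranyi x.
    rewrite lt_neqAle koranyi_ge0 andbT; apply/negP => /eqP kx0; move: kx.
    by rewrite -kx0 powR0 ?ltxx.
  by rewrite mulrAC powRN mulfV ?mul1r// powR_eq0 gt_eqF.
apply: gt0_ler_poweR; rewrite ?in_itv/= ?leey ?andbT ?invr_ge0 ?(ltW r0)//.
- by apply: integral_ge0 => x _; exact: poweR_ge0.
- by apply: integral_ge0 => x _; exact: poweR_ge0.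
apply: ge0_le_integral => //.
- by move=> x _; exact: poweR_ge0.
- apply: (measurableT_comp (@measurable_poweR R r)); apply: (measurableT_comp (@abse_measurable R setT)).
  by apply: emeasurable_funM => //; apply/measurable_EFinP; exact: mkor.
- exact: (measurableT_comp (@measurable_poweR R r) mW).
move=> x _; apply: gt0_ler_poweR; rewrite ?in_itv/= ?leey ?andbT ?abse_ge0 ?W0 ?(ltW r0)//.
have kg : gauge x `^ (- o3) = koranyi x `^ (- gamma) by exact: gauge_powR.
have k30 : (0 <= (koranyi x `^ (- gamma))%:E)%E by rewrite lee_fin powR_ge0.
rewrite abseM (gee0_abs k30) /weighted_form [X in (_ <= X * _)%E](congr1 EFin kg).
apply: (lee_wpmul2l k30).
have mIx : measurable_fun setT (fun y => (f (hu x y) * g (hv x y) * k y)%:E).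
  exact: (measurable_biform_integrand G mf mg mk x).
apply: (le_trans (le_abse_integral mu measurableT mIx)).
rewrite (_ : (\int[mu]_y _)%E = biform mu (hu (n:=n)) (hv (n:=n)) (fun x => `|f x|) (fun x => `|g x|) k x); last first.
  by apply: eq_integral => y _; rewrite /= !normrM (ger0_norm (powR_ge0 _ _)).
have kk : k = (fun y : H => gauge y `^ (- o4)) by apply/funext.
have mMp (a : R) : measurable_fun setT (fun x : H => gauge x `^ a).
  exact: (measurableT_comp (@measurable_powR R a) (geo_mM G)).
pose F' (x : H) := F x * gauge x `^ (- o1).
pose E' (x : H) := E x * gauge x `^ (- o2).
have mF' : measurable_fun setT F' by exact: (measurable_funM mF (mMp _)).
have mE' : measurable_fun setT E' by exact: (measurable_funM mE (mMp _)).
have F'0 x' : 0 <= F' x' by rewrite mulr_ge0 ?powR_ge0.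
have E'0 x' : 0 <= E' x' by rewrite mulr_ge0 ?powR_ge0.
have k0 x' : 0 <= k x' by exact: powR_ge0.
rewrite -/F' -/E' -kk.
exact: (@biform_le_ae _ _ _ _ _ _ _ _ _ G _ _ _ _ _ _ _ x mnf mng mF' mE' mk
  (fun=> normr_ge0 _) (fun=> normr_ge0 _) F'0 E'0 k0 mN mN Nz Nz (recover alpha f) (recover beta g)).
Qed.

End sufficiency.

(** * Necessity *)

Section constant_bounds.
Local Open Scope ereal_scope.
Context (R : realType) d (T : measurableType d) (mu : {measure set T -> \bar R}).

Lemma integral_cst_indic (c : R) (S : set T) : (0 <= c)%R -> measurable S ->
  \int[mu]_x (c * \1_S x)%:E = c%:E * mu S.
Proof.
move=> c0 mS; rewrite -(setIT S) -(integral_indic mu measurableT mS) -ge0_integralZl//.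
- by rewrite setIT; apply: eq_integral => x _; rewrite EFinM.
- by apply/measurable_EFinP; exact: measurable_indic.
Qed.

Lemma integral_ge_on (c : R) (S : set T) (F : T -> \bar R) : (0 <= c)%R -> measurable S ->
  measurable_fun setT F -> (forall x, 0 <= F x) -> (forall x, S x -> c%:E <= F x) ->
  c%:E * mu S <= \int[mu]_x F x.
Proof.
move=> c0 mS mF F0 h; rewrite -integral_cst_indic//; apply: ge0_le_integral => //.
- by move=> x _; rewrite lee_fin mulr_ge0.
- by apply/measurable_EFinP; apply: measurable_funM => //; exact: measurable_indic.
- by move=> x _; rewrite indicE; case: (boolP (x \in S)) => [/set_mem /h|_];
    rewrite ?mulr1 ?mulr0.
Qed.

Lemma integral_le_on (c : R) (S : set T) (F : T -> \bar R) : (0 <= c)%R -> measurable S ->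
  measurable_fun setT F -> (forall x, 0 <= F x) -> (forall x, F x <= (c * \1_S x)%:E) ->
  \int[mu]_x F x <= c%:E * mu S.
Proof.
move=> c0 mS mF F0 h; rewrite -integral_cst_indic//; apply: ge0_le_integral => //.
by apply/measurable_EFinP; apply: measurable_funM => //; exact: measurable_indic.
Qed.

End constant_bounds.

Section necessity.
Variables (R : realType) (n : nat).
Hypothesis n1 : (1 <= n)%N.
Notation H := (Hn R n).
Notation mu := (Hmeas R n).
Notation Q := (Qdim R n).

Definition vbox (c a b : R) : set H :=
  @box R (2 * n) (fun i => if (i < 2 * n)%N then 0 else c)
    (fun i => if (i < 2 * n)%N then a else b).

Lemma vboxP c a b x : vbox c a b x <->
  (forall i, (i < 2 * n)%N -> `|crd x i| <= a) /\ `|Ht x - c| <= b.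
Proof.
split => [h|[h1 h2] i].
  split => [i hi|]; first by have := h i (ltnW hi); rewrite hi subr0.
  by have := h _ (leqnn _); rewrite ltnn.
rewrite leq_eqVlt => /predU1P[->|hi]; first by rewrite ltnn.
by rewrite hi subr0; exact: h1.
Qed.

Lemma measurable_vbox c a b : measurable (vbox c a b).
Proof. exact: measurable_box. Qed.

Lemma measure_vbox c a b : 0 <= a -> 0 <= b ->
  mu (vbox c a b) = ((2 * a) ^+ (2 * n) * (2 * b))%:E.
Proof.
by move=> a0 b0; rewrite /vbox measure_box ?prod_sides// => i; case: ifP.
Qed.

Lemma Hz2_vbox c a b x : vbox c a b x -> Hz2 x <= 2 * n%:R * a ^+ 2.
Proof.
move=> /vboxP[h _]; rewrite /Hz2.
have sq i : (i < 2 * n)%N -> crd x i ^+ 2 <= a ^+ 2.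
  by move=> /h hi; rewrite -real_normK ?num_real// ler_pXn2r// nnegrE (le_trans _ hi).
apply: (@le_trans _ _ (\sum_(j < n) (2 * a ^+ 2))).
  apply: ler_sum => j _; have := sq _ (ltn_re j); have := sq _ (ltn_im j).
  by rewrite /Hre /Him; lra.
by rewrite sumr_const card_ord -mulr_natr; lra.
Qed.

(** On a unit box [Hz2] is at most 2 n <= |c| / 2, so the height dominates and the norm is
    comparable to |c|^(1/2). *)
Lemma ln_koranyi_vbox (c : R) x : 4 * n%:R <= `|c| -> vbox c 1 1 x ->
  0 < koranyi x /\ `|ln (koranyi x) - ln `|c| / 2| <= ln 4.
Proof.
move=> hc hx; have hz := Hz2_vbox hx; have z0 := Hz2_ge0 x.
have [_ ht] := (vboxP c 1 1 x).1 hx.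
have n1' : 1 <= n%:R :> R by rewrite ler1n.
rewrite expr1n mulr1 in hz.
have c0 : 0 < `|c| by lra.
have hz2 : Hz2 x ^+ 2 <= (`|c| / 2) ^+ 2 by rewrite ler_pXn2r// ?nnegrE; lra.
have t1 : `|Ht x| <= 3 / 2 * `|c|.
  by have := ler_normD (Ht x - c) c; rewrite subrK; lra.
have t2 : `|c| / 2 <= `|Ht x|.
  by have := ler_normB (Ht x) (Ht x - c); rewrite opprB addrC subrK; lra.
have t12 : Ht x ^+ 2 <= (3 / 2 * `|c|) ^+ 2.
  by rewrite -(real_normK (num_real (Ht x))) ler_pXn2r// nnegrE; lra.
have t22 : (`|c| / 2) ^+ 2 <= Ht x ^+ 2.
  by rewrite -(real_normK (num_real (Ht x))) ler_pXn2r// nnegrE; lra.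
have c20 : 0 < `|c| ^+ 2 by rewrite exprn_gt0.
pose A := Hz2 x ^+ 2 + Ht x ^+ 2.
have A1 : `|c| ^+ 2 / 4 <= A.
  by have := sqr_ge0 (Hz2 x); move: t22; rewrite /A !expr2; lra.
have A2 : A <= 4 * `|c| ^+ 2 by move: hz2 t12; rewrite /A !exprMn; lra.
have A0 : 0 < A by lra.
split; first by rewrite powR_gt0.
rewrite /koranyi -/A ln_powR.
have l1 : ln A <= ln 4 + 2 * ln `|c|.
  have -> : 2 * ln `|c| = ln (`|c| ^+ 2) by rewrite lnXn// mulr_natl.
  by rewrite -lnM ?posrE// ler_ln ?posrE// mulr_gt0.
have l2 : 2 * ln `|c| <= ln A + ln 4.
  have -> : 2 * ln `|c| = ln (`|c| ^+ 2) by rewrite lnXn// mulr_natl.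
  by rewrite -lnM ?posrE// ler_ln ?posrE// ?mulr_gt0//; lra.
have l0 : 0 <= ln (4 : R) by rewrite ln_ge0// ler1n.
by rewrite ler_norml; apply/andP; split; lra.
Qed.

Lemma koranyi_powR_vbox (c a : R) x : 4 * n%:R <= `|c| -> vbox c 1 1 x ->
  expR (a / 2 * ln `|c| - `|a| * ln 4) <= koranyi x `^ a <=
  expR (a / 2 * ln `|c| + `|a| * ln 4).
Proof.
move=> hc hx; have [k0 hk] := ln_koranyi_vbox hc hx.
rewrite /powR gt_eqF// !ler_expR.
have : `|a * (ln (koranyi x) - ln `|c| / 2)| <= `|a| * ln 4 by rewrite normrM ler_wpM2l.
by rewrite ler_norml => /andP[? ?]; apply/andP; split; lra.
Qed.

Lemma vbox_le c a b a' b' : a <= a' -> b <= b' -> vbox c a b `<=` vbox c a' b'.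
Proof.
move=> ha hb x /vboxP[h1 h2]; apply/vboxP; split; last exact: le_trans hb.
by move=> i /h1 /le_trans; apply.
Qed.

(** Chosen so that [Hz2] is at most 2 n eps^2 = eps <= 1/2 on the small boxes; the heights of a
    product then deviate by at most 1/4 + 1/4 + eps <= 1. *)
Let eps : R := (2 * n%:R)^-1.

Let eps0 : 0 < eps. Proof. by rewrite invr_gt0 mulr_gt0// ltr0n. Qed.

Let eps1 : eps <= 2^-1.
Proof.
rewrite /eps lef_pV2 ?posrE ?mulr_gt0 ?ltr0n// ler_peMr//.
by rewrite ler1n.
Qed.

Lemma Hmul_vbox (m1 m2 : R) x y : vbox m1 eps 4^-1 x -> vbox m2 eps 4^-1 y ->
  vbox (m1 - m2) 1 1 (hu x y) /\ vbox (m1 + m2) 1 1 (hv x y).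
Proof.
move=> hx hy.
have zx := Hz2_vbox hx; have zy := Hz2_vbox hy.
have I := Imzw_le x y.
have e2 : 2 * n%:R * eps ^+ 2 = eps.
  by rewrite expr2 mulrA mulfV ?mul1r// gt_eqF// mulr_gt0// ltr0n.
rewrite e2 in zx zy.
move: hx hy => /vboxP[x1 x2] /vboxP[y1 y2].
have ep := eps1.
split; apply/vboxP; split.
- move=> i hi; rewrite /hu crd_Hmul// crd_Hinv ?(ltnW hi)//.
  apply: (le_trans (ler_normB _ _)); have := x1 i hi; have := y1 i hi; lra.
- rewrite /hu Ht_Hmul ImzwNr (_ : Ht (Hinv y) = - Ht y); last by rewrite /Ht crd_Hinv.
  by move: x2 y2 I; rewrite !ler_norml => /andP[? ?] /andP[? ?] /andP[? ?]; apply/andP; split; lra.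
- move=> i hi; rewrite /hv crd_Hmul//.
  apply: (le_trans (ler_normD _ _)); have := x1 i hi; have := y1 i hi; lra.
- rewrite /hv Ht_Hmul.
  by move: x2 y2 I; rewrite !ler_norml => /andP[? ?] /andP[? ?] /andP[? ?]; apply/andP; split; lra.
Qed.

Lemma indic_Lfun (p : R) (S : set H) : 0 < p -> measurable S -> (mu S < +oo)%E ->
  (\1_S : H -> R) \in Lfun mu p%:E.
Proof.
move=> p0 mS S1.
have mi : measurable_fun setT (\1_S : H -> R) by exact: measurable_indic.
rewrite inE; apply/andP; split; rewrite inE//=.
rewrite /finite_norm unlock /= poweR_lty//.
rewrite (_ : (\int[mu]_x _)%E = mu S)// -[RHS]mul1e -(integral_cst_indic mu ler01 mS).
apply: eq_integral => x _; rewrite /= mul1r indicE.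
by case: (x \in S); rewrite /= ?normr1 ?normr0 ?powR1// powR0// gt_eqF.
Qed.

Lemma Lnorm_vbox_le (p a c : R) : 0 < p -> 4 * n%:R <= `|c| ->
  (Lnorm mu p%:E (fun x => (koranyi x `^ a * \1_(vbox c 1 1) x)%:E) <=
   (expR (a / 2 * ln `|c| + `|a| * ln 4) * ((2 * 1) ^+ (2 * n) * (2 * 1)) `^ p^-1)%:E)%E.
Proof.
move=> p0 hc; rewrite unlock /=.
set E := expR _; set m := (_ ^+ _ * _).
have m0 : 0 <= m by rewrite mulr_ge0 ?exprn_ge0 ?mulr_ge0.
have mS := @measurable_vbox c 1 1.
have mk : measurable_fun setT (fun x : H => koranyi x `^ a).
  exact: (measurableT_comp (@measurable_powR R a) (@measurable_koranyi R n)).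
have mI : measurable_fun setT (fun x : H => `|koranyi x `^ a * \1_(vbox c 1 1) x| `^ p).
  apply: (measurableT_comp (@measurable_powR R p)).
  apply: (measurableT_comp (@normr_measurable R setT)).
  by apply: measurable_funM => //; exact: measurable_indic.
apply: (@le_trans _ _ (((E `^ p)%:E * mu (vbox c 1 1)) `^ p^-1)%E).
  apply: gt0_ler_poweR; rewrite ?in_itv/= ?leey ?andbT ?invr_ge0 ?(ltW p0)//.
  - by apply: integral_ge0 => x _; rewrite lee_fin powR_ge0.
  - by rewrite mule_ge0// lee_fin powR_ge0.
  apply: integral_le_on => //.
  - exact: powR_ge0.
  - exact/measurable_EFinP.
  - move=> x; rewrite /= lee_fin indicE; have [/set_mem hx|_] := boolP (x \in _).
      rewrite !mulr1 ger0_norm ?powR_ge0// ge0_ler_powR ?nnegrE ?powR_ge0 ?expR_ge0 ?(ltW p0)//.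
      by have /andP[] := koranyi_powR_vbox a hc hx.
    by rewrite !mulr0 normr0 powR0// gt_eqF.
rewrite measure_vbox// -/m -EFinM /= lee_fin powRM ?powR_ge0// -powRrM mulfV ?gt_eqF//.
by rewrite powRr1// expR_ge0.
Qed.

Let mS : R := (2 * eps) ^+ (2 * n) * (2 * 4^-1).

Let mS0 : 0 < mS.
Proof.
apply: mulr_gt0; first by apply: exprn_gt0; rewrite mulr_gt0// eps0.
by rewrite mulr_gt0// invr_gt0.
Qed.

(** Parametrised by the heights m1 of x and m2 of y: then x y^-1 and x y have heights near m1 - m2
    and m1 + m2, where the two test boxes are centred. *)
Lemma Lnorm_Blam_ge (r lam gamma m1 m2 : R) : 0 < r ->
  4 * n%:R <= `|m1| -> 4 * n%:R <= `|m2| ->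
  ((expR (- gamma / 2 * ln `|m1| - `|gamma| * ln 4) *
    (expR ((lam - Q) / 2 * ln `|m2| - `|lam - Q| * ln 4) * mS) * mS `^ r^-1)%:E <=
   Lnorm mu r%:E (fun x => (koranyi x `^ (- gamma))%:E *
     Blam lam \1_(vbox (m1 - m2) 1 1) \1_(vbox (m1 + m2) 1 1) x))%E.
Proof.
move=> r0 h1 h2; set f := \1_(vbox (m1 - m2) 1 1); set g := \1_(vbox (m1 + m2) 1 1).
set w1 := expR _; set w2 := expR _.
have w10 : 0 < w1 by exact: expR_gt0.
have w20 : 0 < w2 by exact: expR_gt0.
have [C G] := heisenberg_geometry R n1.
have mf : measurable_fun setT (f : H -> R) by apply: measurable_indic; exact: measurable_vbox.
have mg : measurable_fun setT (g : H -> R) by apply: measurable_indic; exact: measurable_vbox.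
have mk (a : R) : measurable_fun setT (fun y : H => koranyi y `^ a).
  exact: (measurableT_comp (@measurable_powR R a) (@measurable_koranyi R n)).
have mI : measurable_fun setT (fun z : H * H =>
    (f (hu z.1 z.2) * g (hv z.1 z.2) * koranyi z.2 `^ (lam - Q))%:E).
  by exact: (measurable_biform_integrand2 G mf mg (mk _)).
have mB : measurable_fun setT (Blam lam f g).
  exact: (@measurable_integral_section R _ _ _ _ mu _ mI).
have I0 x y : 0 <= f (hu x y) * g (hv x y) * koranyi y `^ (lam - Q).
  by rewrite mulr_ge0 ?powR_ge0// mulr_ge0 ?indic_ge0.
have B0 x : (0 <= Blam lam f g x)%E.
  by apply: integral_ge0 => y _; rewrite lee_fin; exact: I0.
have small c : vbox c eps 4^-1 `<=` vbox c 1 1 by apply: vbox_le; [have := eps1; lra|lra].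
have e0 := ltW eps0.
have meas c : mu (vbox c eps 4^-1) = mS%:E by rewrite measure_vbox.
have Bge x : vbox m1 eps 4^-1 x -> ((w2 * mS)%:E <= Blam lam f g x)%E.
  move=> hx; rewrite EFinM -(meas m2); apply: integral_ge_on => //.
  - exact: ltW.
  - exact: measurable_vbox.
  - exact: (measurable_biform_integrand G mf mg (mk _) x).
  - by move=> y; rewrite lee_fin; exact: I0.
  - move=> y hy; rewrite lee_fin; have [hu1 hv1] := Hmul_vbox hx hy.
    have -> : f (hu x y) = 1 by rewrite /f indicE mem_set.
    have -> : g (hv x y) = 1 by rewrite /g indicE mem_set.
    rewrite !mul1r; by have /andP[] := koranyi_powR_vbox (lam - Q) h2 (small _ _ hy).
rewrite unlock /=.
have W0 : 0 <= w1 * (w2 * mS) by apply: (mulr_ge0 (ltW w10)); apply: (mulr_ge0 (ltW w20)); exact: ltW.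
apply: (@le_trans _ _ ((((w1 * (w2 * mS)) `^ r)%:E * mu (vbox m1 eps 4^-1)) `^ r^-1)%E).
  rewrite meas -EFinM /= lee_fin (powRM _ (powR_ge0 _ _) (ltW mS0)) -powRrM mulfV ?gt_eqF//.
  by rewrite powRr1.
apply: gt0_ler_poweR; rewrite ?in_itv/= ?leey ?andbT ?invr_ge0 ?(ltW r0)//.
- by rewrite mule_ge0// lee_fin powR_ge0.
- by apply: integral_ge0 => x _; exact: poweR_ge0.
apply: integral_ge_on.
- exact: powR_ge0.
- exact: measurable_vbox.
- apply: (measurableT_comp (@measurable_poweR R r)); apply: (measurableT_comp (@abse_measurable R setT)).
  by apply: emeasurable_funM => //; apply/measurable_EFinP; exact: mk.
- by move=> x; exact: poweR_ge0.
- move=> x hx; rewrite -poweR_EFin; apply: gt0_ler_poweR; rewrite ?in_itv/= ?leey ?andbT ?(ltW r0) ?lee_fin ?abse_ge0//.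
  rewrite gee0_abs; last by rewrite mule_ge0 ?lee_fin ?powR_ge0.
  rewrite EFinM; apply: lee_pmul; rewrite ?lee_fin ?(ltW w10)//; last exact: Bge.
    exact: (mulr_ge0 (ltW w20) (ltW mS0)).
  have /andP[] := koranyi_powR_vbox (- gamma) h1 (small _ _ hx).
  by rewrite normrN.
Qed.

(** Logarithm of (a) on the test pair. Norms behave like square roots of heights, so doubling clears
    the halves; everything independent of the heights goes into L. *)
Lemma test_inequality (p q r lam alpha beta gamma K : R) : 0 < p -> 0 < q -> 0 < r -> 0 < K ->
  (forall f g : H -> R,
     f \in Lfun mu p%:E -> g \in Lfun mu q%:E ->
     (Lnorm mu r%:E (fun x => (powR (koranyi x) (- gamma))%:E * Blam lam f g x)
      <= K%:E * Lnorm mu p%:E (fun x => (powR (koranyi x) alpha * f x)%:E)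
              * Lnorm mu q%:E (fun x => (powR (koranyi x) beta * g x)%:E))%E) ->
  exists L : R, forall m1 m2 : R, 4 * n%:R <= `|m1| -> 4 * n%:R <= `|m2| ->
    4 * n%:R <= `|m1 - m2| -> 4 * n%:R <= `|m1 + m2| ->
    - gamma * ln `|m1| + (lam - Q) * ln `|m2| <=
      L + alpha * ln `|m1 - m2| + beta * ln `|m1 + m2|.
Proof.
move=> p0 q0 r0 K0 hK.
set mU : R := (2 * 1) ^+ (2 * n) * (2 * 1).
have mU0 : 0 < mU by rewrite mulr_gt0 ?exprn_gt0 ?mulr_gt0.
pose A := mS * mS `^ r^-1.
have A0 : 0 < A by rewrite mulr_gt0 ?powR_gt0.
pose B := K * mU `^ p^-1 * mU `^ q^-1.
have B0 : 0 < B by rewrite !mulr_gt0 ?powR_gt0.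
exists (2 * (ln (B / A) + (`|alpha| + `|beta| + `|gamma| + `|lam - Q|) * ln 4)).
move=> m1 m2 h1 h2 h3 h4.
have fin c : (mu (vbox c 1 1) < +oo)%E by rewrite measure_vbox// ltry.
have := hK _ _ (indic_Lfun p0 (@measurable_vbox (m1 - m2) 1 1) (fin _))
  (indic_Lfun q0 (@measurable_vbox (m1 + m2) 1 1) (fin _)).
move=> /(le_trans (Lnorm_Blam_ge lam gamma r0 h1 h2)) hle.
set a1 := (expR _ * (expR _ * _) * _)%R in hle.
have {}hle : (a1%:E <= K%:E *
    (expR (alpha / 2 * ln `|m1 - m2| + `|alpha| * ln 4) * mU `^ p^-1)%:E *
    (expR (beta / 2 * ln `|m1 + m2| + `|beta| * ln 4) * mU `^ q^-1)%:E)%E.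
  apply: (le_trans hle); apply: lee_pmul; rewrite ?mule_ge0 ?Lnorm_ge0 ?lee_fin ?(ltW K0)//.
  - by apply: lee_wpmul2l; [rewrite lee_fin ltW|exact: Lnorm_vbox_le].
  - exact: Lnorm_vbox_le.
move: hle; rewrite -!EFinM lee_fin /a1.
set x1 := - gamma / 2 * _ - _; set x2 := (lam - Q) / 2 * _ - _.
set y1 := alpha / 2 * _ + _; set y2 := beta / 2 * _ + _ => hle.
have {}hle : expR (x1 + x2) <= expR (y1 + y2 + ln (B / A)).
  rewrite (expRD x1) (expRD (y1 + y2)) (expRD y1) lnK ?posrE ?divr_gt0// mulrA ler_pdivlMr//.
  move: hle; rewrite /A /B; move: (expR x1) (expR x2) (expR y1) (expR y2) (_ `^ _) (_ `^ _) (_ `^ _).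
  by move=> a b c e f g h; lra.
move: hle; rewrite ler_expR /x1 /x2 /y1 /y2; lra.
Qed.

(** If the logarithms grow like s_j t up to bounded errors, the inequality forces the corresponding
    inequality between slopes. *)
Lemma linear_growth (a b c d s1 s2 s3 s4 L kap t0 : R) :
  (forall t, t0 <= t -> exists x1 x2 x3 x4, [/\ `|x1 - s1 * t| <= kap, `|x2 - s2 * t| <= kap,
    `|x3 - s3 * t| <= kap, `|x4 - s4 * t| <= kap & a * x1 + b * x2 <= L + c * x3 + d * x4]) ->
  a * s1 + b * s2 <= c * s3 + d * s4.
Proof.
move=> h; rewrite leNgt; apply/negP => hlt.
pose e := a * s1 + b * s2 - c * s3 - d * s4.
have e0 : 0 < e by rewrite /e; lra.
pose B := L + (`|a| + `|b| + `|c| + `|d|) * kap.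
pose t := Num.max t0 ((B + 1) / e).
have [x1 [x2 [x3 [x4 [h1 h2 h3 h4 hx]]]]] := h t ltac:(by rewrite le_max lexx).
have bnd (k x s : R) : `|x - s * t| <= kap -> `|k * (x - s * t)| <= `|k| * kap.
  by move=> hk; rewrite normrM ler_wpM2l.
have {h1}/ler_normlP[h1 h1'] := bnd a _ _ h1.
have {h2}/ler_normlP[h2 h2'] := bnd b _ _ h2.
have {h3}/ler_normlP[h3 h3'] := bnd c _ _ h3.
have {h4}/ler_normlP[h4 h4'] := bnd d _ _ h4.
have et : e * t <= B.
  have -> : e * t = a * x1 + b * x2 - c * x3 - d * x4 - a * (x1 - s1 * t) - b * (x2 - s2 * t) +
    c * (x3 - s3 * t) + d * (x4 - s4 * t) by rewrite /e; ring.
  by rewrite /B; lra.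
have : (B + 1) / e <= t by rewrite le_max lexx orbT.
by rewrite ler_pdivrMr// mulrC; lra.
Qed.

Lemma necessity (p q r lam alpha beta gamma K : R) : 0 < p -> 0 < q -> 0 < r -> 0 < K ->
  (forall f g : H -> R,
     f \in Lfun mu p%:E -> g \in Lfun mu q%:E ->
     (Lnorm mu r%:E (fun x => (powR (koranyi x) (- gamma))%:E * Blam lam f g x)
      <= K%:E * Lnorm mu p%:E (fun x => (powR (koranyi x) alpha * f x)%:E)
              * Lnorm mu q%:E (fun x => (powR (koranyi x) beta * g x)%:E))%E) ->
  [/\ - Q + lam <= beta + gamma, - Q + lam <= gamma + alpha,
     - Q + lam <= alpha + beta & 0 <= alpha + beta + gamma].
Proof.
move=> p0 q0 r0 K0 hK; have [L hL] := test_inequality p0 q0 r0 K0 hK.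
clear p0 q0 r0 K0 hK.
pose D : R := 4 * n%:R.
have n1' : 1 <= n%:R :> R by rewrite ler1n.
have D1 : 1 <= D by rewrite /D; lra.
have D0 : 0 < D by lra.
have l3 : 0 <= ln (3 : R) by rewrite ln_ge0// ler1n.
have lD : 0 <= ln D by rewrite ln_ge0.
pose kap := ln 3 + ln D.
have near0 t : `|ln D - 0 * t| <= kap by rewrite mul0r subr0 ger0_norm// /kap; lra.
(* The factor 3 suffices because every large height used below is at most 2 T + D or T + 2 D with D
   <= T = e^t. *)
have near1 t x : expR t <= x -> x <= 3 * expR t -> `|ln x - 1 * t| <= kap.
  move=> h1 h2; have T0 := expR_gt0 t; have x0 : 0 < x by lra.
  have {}h1 : t <= ln x by rewrite -[t]expRK ler_ln ?posrE ?expR_gt0.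
  have {}h2 : ln x <= ln 3 + t.
    by rewrite -[X in _ + X]expRK -lnM ?posrE ?expR_gt0// ler_ln ?posrE ?mulr_gt0.
  by rewrite /kap mul1r ger0_norm; lra.
have big t : ln D <= t -> D <= expR t.
  by move=> h; rewrite -[D]lnK ?posrE// ler_expR.
have nD : `|D| = D by rewrite ger0_norm// ltW.
have grow s1 s2 s3 s4 (m1 m2 : R -> R) :
    (forall t, ln D <= t -> [/\ D <= `|m1 (expR t)|, D <= `|m2 (expR t)|,
       D <= `|m1 (expR t) - m2 (expR t)| & D <= `|m1 (expR t) + m2 (expR t)|] /\
     [/\ `|ln `|m1 (expR t)| - s1 * t| <= kap, `|ln `|m2 (expR t)| - s2 * t| <= kap,
       `|ln `|m1 (expR t) - m2 (expR t)| - s3 * t| <= kap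
      & `|ln `|m1 (expR t) + m2 (expR t)| - s4 * t| <= kap]) ->
    - gamma * s1 + (lam - Q) * s2 <= alpha * s3 + beta * s4.
  move=> h; apply: (@linear_growth _ _ _ _ _ _ _ _ L kap (ln D)) => t /h[[? ? ? ?] [? ? ? ?]].
  by do 4!eexists; split; try eassumption; exact: hL.
have far t x : ln D <= t -> expR t <= x -> x <= 3 * expR t ->
    D <= `|x| /\ `|ln `|x| - 1 * t| <= kap.
  move=> /big Dt h1 h2; have x0 : 0 <= x by exact: le_trans (expR_ge0 t) h1.
  by rewrite ger0_norm//; split; [exact: le_trans h1|exact: near1].
have nearD t : D <= `|D| /\ `|ln `|D| - 0 * t| <= kap by rewrite nD.
clear hL near0 near1 l3 lD nD.
split.
(* Of m1, m2, m1 - m2 and m1 + m2 exactly one stays bounded in each case; here it is m1 - m2, so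
   alpha drops out. The offset D keeps the bounded height at the admissible size 4 n. *)
- have : - gamma * 1 + (lam - Q) * 1 <= alpha * 0 + beta * 1; last by lra.
  apply: (grow _ _ _ _ (fun T => T + D) id) => t ht; have := big _ ht => Tt.
  rewrite (_ : expR t + D - expR t = D); last by ring.
  have [a1 b1] := far t (expR t + D) ht ltac:(lra) ltac:(lra).
  have [a2 b2] := far t (expR t) ht ltac:(lra) ltac:(lra).
  have [a3 b3] := far t (expR t + D + expR t) ht ltac:(lra) ltac:(lra).
  by have [a4 b4] := nearD t.
- have : - gamma * 1 + (lam - Q) * 1 <= alpha * 1 + beta * 0; last by lra.
  apply: (grow _ _ _ _ (fun T => T + D) -%R) => t ht; have := big _ ht => Tt.
  rewrite (_ : expR t + D - expR t = D); last by ring.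
  rewrite opprK normrN.
  have [a1 b1] := far t (expR t + D) ht ltac:(lra) ltac:(lra).
  have [a2 b2] := far t (expR t) ht ltac:(lra) ltac:(lra).
  have [a3 b3] := far t (expR t + D + expR t) ht ltac:(lra) ltac:(lra).
  by have [a4 b4] := nearD t.
(* The height of x stays bounded, which removes gamma. *)
- have : - gamma * 0 + (lam - Q) * 1 <= alpha * 1 + beta * 1; last by lra.
  apply: (grow _ _ _ _ (fun=> D) (fun T => T + D)) => t ht; have := big _ ht => Tt.
  rewrite (_ : D - (expR t + D) = - expR t); last by ring.
  rewrite normrN.
  have [a1 b1] := far t (expR t + D) ht ltac:(lra) ltac:(lra).
  have [a2 b2] := far t (expR t) ht ltac:(lra) ltac:(lra).
  have [a3 b3] := far t (D + (expR t + D)) ht ltac:(lra) ltac:(lra).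
  by have [a4 b4] := nearD t.
(* The height of y stays bounded, so the kernel is of constant size and lam disappears. *)
- have : - gamma * 1 + (lam - Q) * 0 <= alpha * 1 + beta * 1; last by lra.
  apply: (grow _ _ _ _ (fun T => T + D) (fun=> D)) => t ht; have := big _ ht => Tt.
  rewrite addrK.
  have [a1 b1] := far t (expR t + D) ht ltac:(lra) ltac:(lra).
  have [a2 b2] := far t (expR t) ht ltac:(lra) ltac:(lra).
  have [a3 b3] := far t (expR t + D + D) ht ltac:(lra) ltac:(lra).
  by have [a4 b4] := nearD t.
Qed.

End necessity.

Theorem theorem1p2 (R : realType) (n : nat) (p q r lam alpha beta gamma : R) :
  (1 <= n)%N ->
  1 < p -> 1 < q -> 0 < r -> r^-1 <= p^-1 + q^-1 ->
  0 < lam -> lam < Qdim R n ->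
  alpha < Qdim R n / hconj p -> beta < Qdim R n / hconj q ->
  gamma < Qdim R n / r ->
  r^-1 = p^-1 + q^-1 - (lam - alpha - beta - gamma) / Qdim R n ->
  0 < p^-1 + q^-1 - (lam - alpha - beta - gamma) / Qdim R n ->
  (exists K : R, 0 < K /\
     forall f g : Hn R n -> R,
       f \in Lfun (Hmeas R n) p%:E -> g \in Lfun (Hmeas R n) q%:E ->
       (Lnorm (Hmeas R n) r%:E
          (fun x => (powR (koranyi x) (- gamma))%:E * Blam lam f g x)
        <= K%:E * Lnorm (Hmeas R n) p%:E
                    (fun x => (powR (koranyi x) alpha * f x)%:E)
                * Lnorm (Hmeas R n) q%:E
                    (fun x => (powR (koranyi x) beta * g x)%:E))%E)
  <->
  (- Qdim R n + lam <= beta + gamma /\ - Qdim R n + lam <= gamma + alpha /\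
   - Qdim R n + lam <= alpha + beta /\ 0 <= alpha + beta + gamma).

Proof.
move=> n1 p1 q1 r0 hr l0 lQ ha hb hg hs hpos; split.
  move=> [K [K0 hK]].
  have [c1 c2 c3 c4] := necessity n1 (lt_trans ltr01 p1) (lt_trans ltr01 q1) r0 K0 hK.
  by [].
move=> [c1 [c2 [c3 c4]]].
exact: (sufficiency n1 p1 q1 r0 hr l0 lQ ha hb hg hs c1 c2 c3 c4).
Qed.
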